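(* Under the setting below, $G_{10}$ is a plane $6$-spanner of the visibility graph $\mathrm{Vis}(V,S)$ in which every vertex has degree at most $10$.
   Context: Setting: $V$ is a finite set of points (vertices) in the plane and $S$ a finite set of simple polygonal obstacles, pairwise non-intersecting, all of whose corners lie in $V$; each vertex is a corner of at most one obstacle and occurs at most once on its boundary. General position: no three vertices collinear and no two vertices on a line parallel to a cone boundary ray. Points $p,q$ are visible if segment $pq$ does not properly intersect any obstacle (touching at vertices or running along boundaries is allowed, meeting an obstacle interior is not). $\mathrm{Vis}(V,S)$ is the graph on $V$ with an edge for every visible pair, weighted by Euclidean length; $d_G$ is shortest-path length, and a subgraph $H$ is a $t$-spanner of $G$ if $d_H(x,y)\le t\,d_G(x,y)$ for all $x,y$. Plane means no two edges properly cross. Cones: around each vertex $u$ the plane is partitioned into six cones of angle $\pi/3$ with apex $u$; $C_0^u$ has the upward vertical bisector, and counterclockwise the cones are $C_0^u,\overline{C_2^u},C_1^u,\overline{C_0^u},C_2^u,\overline{C_1^u}$ (positive cones $C_i$, negative cones $\overline{C_i}$). If the obstacle having $u$ as a corner splits a cone so that there are vertices visible from $u$ on both sides of the obstacle within it, the cone is regarded as two subcones; otherwise a single subcone. $G_\infty$: for every vertex $u$ and every positive subcone of $u$, add an edge from $u$ to the vertex visible from $u$ in that subcone whose orthogonal projection onto the cone's bisector is closest to $u$. The canonical sequence of a negative subcone of $u$ is the list of vertices adjacent to $u$ in $G_\infty$ lying in that subcone, in counterclockwise order around $u$; its canonical path consists of the segments joining consecutive vertices of this sequence. $G_{10}$ is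 the graph on $V$ whose edges are, for every vertex $u$ and every negative subcone of $u$: the edge from $u$ to the closest (smallest projection onto the cone's bisector) $G_\infty$-neighbour of $u$ in that subcone, and all edges of the canonical path of that subcone. *)

(* Defs.v *)
From HB Require Import structures.
From mathcomp Require Import all_boot all_order all_algebra.
From mathcomp Require Import boolp reals.
Set Implicit Arguments. Unset Strict Implicit. Unset Printing Implicit Defensive.
Import Order.TTheory GRing.Theory Num.Theory.
Local Open Scope ring_scope.

Section Geometry.
Variable R : realType.

Definition point := (R * R)%type.

Definition vsub (p q : point) : point := (p.1 - q.1, p.2 - q.2).
Definition vadd (p q : point) : point := (p.1 + q.1, p.2 + q.2).
Definition vscale (t : R) (p : point) : point := (t * p.1, t * p.2).
Definition dot (p q : point) : R := p.1 * q.1 + p.2 * q.2.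
(* cross p q > 0  iff  q is counterclockwise of p (angle in (0,pi)) *)
Definition cross (p q : point) : R := p.1 * q.2 - p.2 * q.1.
Definition dist (p q : point) : R := Num.sqrt (dot (vsub q p) (vsub q p)).

Definition on_seg (p q x : point) : Prop :=
  exists t : R, 0 <= t <= 1 /\ x = vadd p (vscale t (vsub q p)).
Definition open_seg (p q x : point) : Prop :=
  exists t : R, 0 < t < 1 /\ x = vadd p (vscale t (vsub q p)).

(** Polygons: a polygon is the cyclic sequence of its corners. *)
Definition pedge (P : seq point) (i : nat) : point * point :=
  (nth (0, 0) P i, nth (0, 0) P ((i + 1) %% size P)).

Definition on_boundary (P : seq point) (x : point) : Prop :=
  exists2 i, (i < size P)%N & on_seg (pedge P i).1 (pedge P i).2 x.

Definition simple_polygon (P : seq point) : Prop :=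
  (3 <= size P)%N /\ uniq P /\
  forall i j, (i < j < size P)%N -> forall x,
    on_seg (pedge P i).1 (pedge P i).2 x -> on_seg (pedge P j).1 (pedge P j).2 x ->
    (x = (pedge P i).1 \/ x = (pedge P i).2) /\ (x = (pedge P j).1 \/ x = (pedge P j).2).

Fixpoint chain_avoid (B : point -> Prop) (x : point) (c : seq point) : Prop :=
  match c with
  | [::] => ~ B x
  | y :: c' => (forall z, on_seg x y z -> ~ B z) /\ chain_avoid B y c'
  end.

(* exterior: connected in the complement of the boundary to a point lying to
   the right of all corners (hence in the unbounded component) *)
Definition exterior (P : seq point) (x : point) : Prop :=
  exists c : seq point, chain_avoid (on_boundary P) x c /\
    forall q, q \in P -> q.1 < (last x c).1.

(* interior = bounded component(s) of the complement of the boundary *)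
Definition interior (P : seq point) (x : point) : Prop :=
  ~ on_boundary P x /\ ~ exterior P x.

Definition closed_region (P : seq point) (x : point) : Prop :=
  on_boundary P x \/ interior P x.

Definition valid_setting (V : seq point) (S : seq (seq point)) : Prop :=
  uniq V /\
  (forall O, O \in S -> simple_polygon O /\ {subset O <= V}) /\
  (forall i j, (i < size S)%N -> (j < size S)%N -> i <> j ->
     (forall x, ~ (closed_region (nth [::] S i) x /\ closed_region (nth [::] S j) x)) /\
     (forall v, ~ (v \in nth [::] S i /\ v \in nth [::] S j))) /\
  (forall a b c, a \in V -> b \in V -> c \in V -> a <> b -> a <> c -> b <> c ->
     cross (vsub b a) (vsub c a) <> 0) /\
  (* no two vertices on a line parallel to a cone boundary ray
     (directions 0, 60 and 120 degrees) *)
  (forall a b, a \in V -> b \in V -> a <> b ->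
     let d := vsub b a in
     d.2 <> 0 /\ d.2 <> Num.sqrt 3 * d.1 /\ d.2 <> - (Num.sqrt 3 * d.1)).

Definition visible (S : seq (seq point)) (p q : point) : Prop :=
  forall O, O \in S -> forall x, on_seg p q x -> ~ interior O x.

Definition vis_edge (V : seq point) (S : seq (seq point)) (p q : point) : Prop :=
  p \in V /\ q \in V /\ p <> q /\ visible S p q.

(** Cones.  Cone j (j = 0..5) has apex u, angle pi/3 and unit bisector at angle
    pi/2 + j*pi/3.  Counterclockwise: j=0: C_0, j=1: C2bar, j=2: C_1,
    j=3: C0bar, j=4: C_2, j=5: C1bar.  Positive cones: j even; negative: j odd. *)
Definition bis (j : nat) : point :=
  let s := Num.sqrt 3 / 2 in
  match j with
  | 0 => (0, 1)
  | 1 => (- s, 1 / 2)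
  | 2 => (- s, - (1 / 2))
  | 3 => (0, -1)
  | 4 => (s, - (1 / 2))
  | _ => (s, 1 / 2)
  end.

Definition positive_cone (j : nat) : bool := (j < 6)%N && ~~ odd j.
Definition negative_cone (j : nat) : bool := (j < 6)%N && odd j.

(* v lies in the (open) cone j of u: angle between v - u and the bisector
   is < pi/6 *)
Definition in_cone (u : point) (j : nat) (v : point) : Prop :=
  v <> u /\ 2 * dot (vsub v u) (bis j) > Num.sqrt 3 * Num.sqrt (dot (vsub v u) (vsub v u)).

Definition proj (u : point) (j : nat) (v : point) : R := dot (vsub v u) (bis j).

Definition prev_corner (O : seq point) (u : point) : point :=
  nth u O ((index u O + size O - 1) %% size O).
Definition next_corner (O : seq point) (u : point) : point :=
  nth u O ((index u O + 1) %% size O).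

(* the obstacle's interior near u fills the wedge strictly between
   the directions of e1 and e2 *)
Definition wedge_interior (O : seq point) (u e1 e2 : point) : Prop :=
  exists2 eps : R, 0 < eps & forall t : R, 0 < t < eps ->
    interior O (vadd u (vscale t (vadd (vsub e1 u) (vsub e2 u)))).

(* the two sides of the cone j of u with respect to the obstacle edges
   towards e1 (clockwise one) and e2 (counterclockwise one) *)
Definition cw_side (u : point) (j : nat) (e1 v : point) : Prop :=
  in_cone u j v /\ cross (vsub v u) (vsub e1 u) >= 0.
Definition ccw_side (u : point) (j : nat) (e2 v : point) : Prop :=
  in_cone u j v /\ cross (vsub e2 u) (vsub v u) >= 0.

Definition splits (V : seq point) (S : seq (seq point)) (u : point) (j : nat)
    (O : seq point) (e1 e2 : point) : Prop :=
  O \in S /\ u \in O /\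
  ((e1 = prev_corner O u /\ e2 = next_corner O u) \/
   (e1 = next_corner O u /\ e2 = prev_corner O u)) /\
  cross (vsub e1 u) (vsub e2 u) > 0 /\
  in_cone u j e1 /\ in_cone u j e2 /\ wedge_interior O u e1 e2 /\
  (exists v, vis_edge V S u v /\ cw_side u j e1 v) /\
  (exists w, vis_edge V S u w /\ ccw_side u j e2 w).

Definition subcone (V : seq point) (S : seq (seq point)) (u : point) (j : nat)
    (X : point -> Prop) : Prop :=
  (exists O e1 e2, splits V S u j O e1 e2 /\
      (X = cw_side u j e1 \/ X = ccw_side u j e2)) \/
  ((~ exists O e1 e2, splits V S u j O e1 e2) /\ X = in_cone u j).

Definition ginf_dir (V : seq point) (S : seq (seq point)) (u v : point) : Prop :=
  u \in V /\ exists j, positive_cone j /\ exists X, subcone V S u j X /\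
    [/\ vis_edge V S u v, X v &
        forall w, vis_edge V S u w -> X w -> proj u j v <= proj u j w].

Definition ginf (V : seq point) (S : seq (seq point)) (u v : point) : Prop :=
  ginf_dir V S u v \/ ginf_dir V S v u.

Definition closest_nb V S (u : point) (j : nat) (X : point -> Prop) (v : point) :=
  [/\ ginf V S u v, X v &
      forall w, ginf V S u w -> X w -> proj u j v <= proj u j w].

Definition canon_consec V S (u : point) (X : point -> Prop) (v w : point) :=
  [/\ ginf V S u v, X v, ginf V S u w, X w &
      cross (vsub v u) (vsub w u) > 0] /\
      forall z, ginf V S u z -> X z ->
        ~ (cross (vsub v u) (vsub z u) > 0 /\ cross (vsub z u) (vsub w u) > 0).

Definition g10_edge V S (x y : point) : Prop :=
  exists u, u \in V /\ exists j, negative_cone j /\ exists X, subcone V S u j X /\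
    ((x = u /\ closest_nb V S u j X y) \/ canon_consec V S u X x y).

Definition g10 V S (x y : point) : Prop := g10_edge V S x y \/ g10_edge V S y x.

Fixpoint walk (E : point -> point -> Prop) (x : point) (s : seq point) : Prop :=
  match s with
  | [::] => True
  | y :: s' => E x y /\ walk E y s'
  end.

Fixpoint walk_len (x : point) (s : seq point) : R :=
  match s with
  | [::] => 0
  | y :: s' => dist x y + walk_len y s'
  end.

(* H is a subgraph of G and d_H(x,y) <= t d_G(x,y) for all x,y in V *)
Definition spanner (V : seq point) (H G : point -> point -> Prop) (t : R) : Prop :=
  (forall x y, H x y -> G x y) /\
  forall x y, x \in V -> y \in V -> forall s, walk G x s -> last x s = y ->
    exists s', [/\ walk H x s', last x s' = y & walk_len x s' <= t * walk_len x s].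

Definition plane (H : point -> point -> Prop) : Prop :=
  forall a b c d, H a b -> H c d -> ~ ((a = c /\ b = d) \/ (a = d /\ b = c)) ->
    ~ exists x, open_seg a b x /\ open_seg c d x.

Definition max_degree (V : seq point) (H : point -> point -> Prop) (k : nat) : Prop :=
  forall u, u \in V -> (count (fun v => `[< H u v >]) V <= k)%N.

End Geometry.

(* Main.v *)
Require Import Defs.
From HB Require Import structures.
From mathcomp Require Import all_boot all_order all_algebra.
From mathcomp Require Import boolp reals.
From mathcomp Require Import ring lra zify.
Set Implicit Arguments. Unset Strict Implicit. Unset Printing Implicit Defensive.
Import Order.TTheory GRing.Theory Num.Theory.
Local Open Scope ring_scope.

(** The projections [F], [G], [H] on the bisectors of the three positive cones
    satisfy [F + G + H = 0], and the cones of a vertex are read off the signs of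
    the differences of these coordinates.

    Visibility.  The parity of the number of edges hit by a horizontal ray shows
    that a segment crossing an edge of an obstacle meets its interior, and that at
    a corner exactly one of the two wedges has odd parity.  Hence an empty triangle
    spanned by two edges [up], [uq] of the visibility graph in one subcone of [u]
    is free of obstacles; and if a visible segment [xy] crosses a visible segment
    [uv] at [c], then [u] sees, in the subcone of [v], a vertex of the triangle
    [ucy].  The latter contradicts the minimality of [v] when [y] lies in the cone
    of [u] below [v], which makes the graph [ginf] plane.

    Canonical paths.  Two members of a canonical sequence of [u] are incomparable
    in the coordinates [G], [H], so the sequence is monotone; triangles spanned by
    [u] and two consecutive members are empty, and the canonical edges belong to
    [ginf].  Thus [g10] is plane, and monotonicity bounds the detour replacing an
    edge [uv] of [ginf] by [3 |uv|].

    Stretch 2 of [ginf].  For [w] in the positive cone [F] of [u], induction on the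
    size of the cone triangle bounds the distance by [2 / sqrt 3] times [dF - dG]
    or [dF - dH], which are linear in [w - u]: one walks to the predecessor [y] of
    [w] on the convex chain of vertices visible from [u], then from [y] to [w].

    Degree.  A neighbour of [u] is the closest vertex of one of at most four
    negative subcones, or fills one of two slots attached to each positive cone. *)

(** * Parity of crossings with a polygon *)

Section Parity.
Variable R : realType.
Implicit Types (a b c d e n p q u v w x y z : point R) (P O : seq (point R)).

(** Since [interior] is defined through polygonal chains, a Jordan curve theorem seems to be called
    for. Its easy half is enough: exterior points have even parity, so two points off the boundary
    with different parities are not both exterior, and one of them is interior. A visible segment
    has no interior points, which turns each parity flip into a contradiction or into the knowledge
    of where the obstacle lies.

    Subcones are awkward in extremal choices, because [splits] quantifies over visible vertices. The
    relation [same_side] replaces them: it mentions only two points and the obstacle wedge at [u],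
    it follows from any free triangle, and within one cone its classes of visible vertices are the
    subcones.

    Most existence arguments then have one shape: minimise a real function over finitely many
    vertices so that some triangle contains no vertex; the triangle is then free of obstacles and
    its third side is visible. *)

Definition orient a b c : R := cross (vsub b a) (vsub c a).

(* The horizontal ray from [y] to the right hits the edge [ab]; the lower end of
   the edge counts as part of it and the upper end does not. *)
Definition ray_hits a b y : bool :=
  [&& a.2 <= y.2, ~~ (b.2 <= y.2) & 0 < orient a b y] ||
  [&& b.2 <= y.2, ~~ (a.2 <= y.2) & 0 < orient b a y].

(* [a] lies in the region swept by the rays issued from the segment [yz]: the
   contribution of an edge changes between [y] and [z] by the difference of this
   predicate at its ends, which cancels around a closed polygon. *)
Definition in_strip y z a : bool :=
  [&& a.2 <= z.2, ~~ (a.2 <= y.2) & 0 < orient z y a] ||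
  [&& a.2 <= y.2, ~~ (a.2 <= z.2) & 0 < orient y z a].

Lemma orientC a b c : orient b a c = - orient a b c.
Proof. rewrite /orient /cross /vsub /=; ring. Qed.

Lemma orient_swap a b c : orient a c b = - orient a b c.
Proof. rewrite /orient /cross /vsub /=; ring. Qed.

Lemma pair_ext (x y : point R) : x.1 = y.1 -> x.2 = y.2 -> x = y.
Proof. by case: x y => [? ?] [? ?] /= -> ->. Qed.

Lemma segments_meet a b y z :
  orient a b y != orient a b z -> orient a b y * orient a b z <= 0 ->
  orient y z a * orient y z b <= 0 ->
  exists x, on_seg a b x /\ on_seg y z x.
Proof.
set o1 := orient a b y; set o2 := orient a b z.
set o3 := orient y z a; set o4 := orient y z b => ne h1 h2.
have E : o1 - o2 = o4 - o3 by rewrite /o1 /o2 /o3 /o4 /orient /cross /vsub /=; ring.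
have D0 : o1 - o2 != 0 by rewrite subr_eq0.
have D1 : o4 - o3 != 0 by rewrite -E.
have t01 (r s : R) : r - s != 0 -> r * s <= 0 -> 0 <= r / (r - s) <= 1.
  move=> rs le; case: (ltP 0 (r - s)) => [sg|].
    rewrite divr_ge0 ?ler_pdivrMr //; try nra; by apply/andP; split; nra.
  rewrite le_eqVlt (negPf rs) /= => sg.
  have -> : r / (r - s) = (- r) / (s - r) by rewrite -[s - r]opprB invrN mulrNN.
  have sg' : 0 < s - r by lra.
  rewrite divr_ge0 ?ler_pdivrMr //; try nra; by apply/andP; split; nra.
exists (vadd y (vscale (o1 / (o1 - o2)) (vsub z y))); split; last first.
  by exists (o1 / (o1 - o2)); split=> //; apply: t01.
exists (o3 / (o3 - o4)); split.
  apply: t01 => //; by rewrite -oppr_eq0 opprB.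
have D2 : o3 - o4 != 0 by rewrite -oppr_eq0 opprB.
have key : o1 / (o1 - o2) = - o1 / (o3 - o4).
  by rewrite E -opprB invrN mulrN mulNr.
rewrite key /vadd /vscale /vsub; congr pair => /=.
  have -> : y.1 + - o1 / (o3 - o4) * (z.1 - y.1) =
     (y.1 * (o3 - o4) - o1 * (z.1 - y.1)) / (o3 - o4) by field.
  have -> : a.1 + o3 / (o3 - o4) * (b.1 - a.1) =
     (a.1 * (o3 - o4) + o3 * (b.1 - a.1)) / (o3 - o4) by field.
  congr (_ / _); rewrite /o1 /o3 /o4 /orient /cross /vsub /=; ring.
have -> : y.2 + - o1 / (o3 - o4) * (z.2 - y.2) =
   (y.2 * (o3 - o4) - o1 * (z.2 - y.2)) / (o3 - o4) by field.
have -> : a.2 + o3 / (o3 - o4) * (b.2 - a.2) =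
   (a.2 * (o3 - o4) + o3 * (b.2 - a.2)) / (o3 - o4) by field.
congr (_ / _); rewrite /o1 /o3 /o4 /orient /cross /vsub /=; ring.
Qed.

Lemma mulr_sign_le0 (r s : R) : (0 < r -> s <= 0) -> (r < 0 -> 0 <= s) -> r * s <= 0.
Proof. by case: (ltgtP r 0) => [? _ /(_ isT)|? /(_ isT)|-> _ _]; nra. Qed.

Lemma orient_diff a b y z :
  orient a b y - orient a b z = orient y z b - orient y z a.
Proof. rewrite /orient /cross /vsub /=; ring. Qed.

(** Second coordinate of the affine dependence of four points of the plane. By [orient_diff] it
    stays true for heights measured from any origin. *)
Lemma orient_height a b y z :
  orient a b y * z.2 - orient a b z * y.2 = orient y z b * a.2 - orient y z a * b.2.
Proof. rewrite /orient /cross /vsub /=; ring. Qed.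

Lemma ray_hitsC a b y : ray_hits a b y = ray_hits b a y.
Proof. by rewrite /ray_hits orbC. Qed.

Lemma in_stripC y z a : in_strip y z a = in_strip z y a.
Proof. by rewrite /in_strip orbC. Qed.

Lemma ray_hits_up a b y : a.2 <= b.2 ->
  ray_hits a b y = [&& a.2 <= y.2, y.2 < b.2 & 0 < orient a b y].
Proof.
move=> le; rewrite /ray_hits -ltNge; case: (leP b.2 y.2) => h /=; last by rewrite orbF.
by rewrite ltNge (le_trans le h) /= ?andbF.
Qed.

Lemma in_strip_up y z a : y.2 <= z.2 ->
  in_strip y z a = [&& a.2 <= z.2, y.2 < a.2 & orient y z a < 0].
Proof.
move=> le; rewrite /in_strip -ltNge (orientC y z) oppr_gt0.
case: (leP a.2 y.2) => h /=; last by rewrite orbF.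
by rewrite ltNge (le_trans h le) /= ?andbF.
Qed.

(** An edge that misses [yz] can enter the region swept by the rays only through one of the two
    extreme rays, so the hits at [y] and [z] differ exactly when one of its ends is inside. The
    half-open conventions keep this exact for ends at the height of [y] or [z]. *)
Lemma ray_hits_disjoint a b y z :
  (forall x, on_seg a b x -> ~ on_seg y z x) ->
  ray_hits a b y (+) ray_hits a b z = in_strip y z a (+) in_strip y z b.
Proof.
move=> dis.
have {}dis : orient a b y != orient a b z ->
   orient a b y * orient a b z <= 0 -> orient y z a * orient y z b <= 0 -> False.
  by move=> h1 h2 h3; have [x [/dis xab /xab]] := segments_meet h1 h2 h3.
wlog le1 : a b dis / a.2 <= b.2.
  move=> th; case: (leP a.2 b.2) => [|/ltW] le; first exact: th.
  rewrite !(ray_hitsC a b) [RHS]addbC th //.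
  rewrite !(orientC a b) eqr_opp mulrNN mulrC => h1 h2 h3.
  by apply: dis => //; rewrite 1?mulrC // eq_sym.
wlog le2 : y z dis / y.2 <= z.2.
  move=> th; case: (leP y.2 z.2) => [|/ltW] le; first exact: th.
  rewrite !(in_stripC y z) [LHS]addbC th //.
  rewrite !(orientC y z) mulrNN eq_sym mulrC => h1 h2 h3.
  exact: dis.
rewrite !ray_hits_up // !in_strip_up //.
move: dis (orient_diff a b y z) (orient_height a b y z) le1 le2.
move: (orient a b y) (orient a b z) (orient y z a) (orient y z b) => o1 o2 o3 o4.
move: (a.2) (b.2) (y.2) (z.2) => A B Y Z dis E2 E1 le1 le2.
(* The height identity with the origin moved to [Z], [Y], [A] and [B] in turn; each choice removes
   one of the four terms. *)
have F1 : o2 * (Z - Y) + o4 * (Z - A) + o3 * (B - Z) = 0 by nra.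
have F2 : o1 * (Z - Y) + o4 * (Y - A) + o3 * (B - Y) = 0 by nra.
have F3 : o1 * (Z - A) - o2 * (Y - A) + o3 * (B - A) = 0 by nra.
have F4 : o1 * (Z - B) - o2 * (Y - B) + o4 * (B - A) = 0 by nra.
case: (leP A Y) => h1; case: (ltP Y B) => h2; case: (leP A Z) => h3; case: (ltP Z B) => h4 /=;
 rewrite ?(ltNge Y) ?h1 ?h2 ?h3 ?h4 ?(ltNge Y) ?h1 ?h2 ?(leNgt B) ?h4 ?andbF //=;
 try (exfalso; lra).
all: repeat match goal with |- context [0 < ?o] => case: (ltP 0 o) => ? /=
      | |- context [?o < 0] => case: (ltP o 0) => ? /= end; try done.
all: exfalso; apply: dis; [apply/eqP => ?|apply: mulr_sign_le0 => ?; rewrite leNgt; apply/negP => ?|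
  apply: mulr_sign_le0 => ?; rewrite leNgt; apply/negP => ?].
all: try lra.
all: clear E1 E2.
all: nra.
Qed.


Definition comb u a b (r s : R) : point R :=
  vadd u (vadd (vscale r (vsub a u)) (vscale s (vsub b u))).

Lemma ex_lt2 (a b : R) : 0 < a -> 0 < b -> exists t, [/\ 0 < t, t < a & t < b].
Proof.
move=> a0 b0; have m0 : 0 < Num.min a b by rewrite lt_min a0 b0.
have : Num.min a b / 2 < Num.min a b by lra.
by rewrite lt_min => /andP [h1 h2]; exists (Num.min a b / 2); rewrite divr_gt0.
Qed.

Lemma lt_or_gt (r s : R) : r <> s -> r < s \/ s < r.
Proof. by move=> /eqP; rewrite neq_lt => /orP. Qed.

End Parity.

Ltac point_ring := apply: pair_ext; rewrite /comb /vadd /vscale /vsub /=; ring.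
Ltac orient_ring := rewrite /orient /comb /cross /vadd /vscale /vsub /=; ring.

Section Parity.
Variable R : realType.
Implicit Types (a b c d e n p q u v w x y z : point R) (P O : seq (point R)).

(** The edge now also passes through [yz] itself, one more crossing of the border of the swept
    region than the two rays account for. *)
Lemma ray_hits_cross a b y z :
  orient a b y * orient a b z < 0 -> orient y z a * orient y z b < 0 ->
  ray_hits a b y (+) ray_hits a b z = ~~ (in_strip y z a (+) in_strip y z b).
Proof.
move=> c1 c2.
wlog le1 : a b c1 c2 / a.2 <= b.2.
  move=> th; case: (leP a.2 b.2) => [|/ltW] le; first exact: th.
  rewrite !(ray_hitsC a b) (addbC (in_strip _ _ _)) th //; last by rewrite mulrC.
  by rewrite !(orientC a b) mulrNN.
wlog le2 : y z c1 c2 / y.2 <= z.2.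
  move=> th; case: (leP y.2 z.2) => [|/ltW] le; first exact: th.
  rewrite !(in_stripC y z) [LHS]addbC th //; first by rewrite mulrC.
  by rewrite !(orientC y z) mulrNN.
have E0 : a.2 = y.2 -> a.2 = b.2 -> orient a b y = 0.
  by rewrite /orient /cross /vsub /= => <- <-; ring.
rewrite !ray_hits_up // !in_strip_up //.
move: c1 c2 E0 (orient_diff a b y z) (orient_height a b y z) le1 le2.
move: (orient a b y) (orient a b z) (orient y z a) (orient y z b) => o1 o2 o3 o4.
move: (a.2) (b.2) (y.2) (z.2) => A B Y Z c1 c2 E0 E2 E1 le1 le2.
have F1 : o2 * (Z - Y) + o4 * (Z - A) + o3 * (B - Z) = 0 by nra.
have F3 : o1 * (Z - A) - o2 * (Y - A) + o3 * (B - A) = 0 by nra.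
have F4 : o1 * (Z - B) - o2 * (Y - B) + o4 * (B - A) = 0 by nra.
have [[s1 s2 s3 s4]|[s1 s2 s3 s4]] :
    [/\ o1 < 0, 0 < o2, 0 < o3 & o4 < 0] \/ [/\ 0 < o1, o2 < 0, o3 < 0 & 0 < o4].
- clear E0 E1 F1 F3 F4; case: (ltgtP o1 0) => [l|l|l]; last by rewrite l mul0r ltxx in c1.
    have s2 : 0 < o2 by rewrite ltNge; apply/negP => ?; nra.
    have s3 : 0 < o3 by rewrite ltNge; apply/negP => ?; nra.
    by left; split=> //; nra.
  have s2 : o2 < 0 by rewrite ltNge; apply/negP => ?; nra.
  have s3 : o3 < 0 by rewrite ltNge; apply/negP => ?; nra.
  by right; split=> //; nra.
- clear E1; case: (leP A Y) => h1; case: (ltP Y B) => h2; case: (leP A Z) => h3; case: (ltP Z B) => h4 /=;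
  rewrite ?(ltNge Y) ?h1 ?h2 ?h3 ?h4 ?(ltNge Y) ?h1 ?h2 ?(leNgt B) ?h4 ?andbF ?s1 ?s2 ?s3 ?s4 //=
   ?(ltNge o3) ?(ltNge 0 o1) ?(ltW s1) ?(ltW s3) //=; exfalso; try lra.
  all: try nra.
- clear E1; case: (leP A Y) => h1; case: (ltP Y B) => h2; case: (leP A Z) => h3; case: (ltP Z B) => h4 /=;
  rewrite ?(ltNge Y) ?h1 ?h2 ?h3 ?h4 ?(ltNge Y) ?h1 ?h2 ?(leNgt B) ?h4 ?andbF ?s1 ?s2 ?s3 ?s4 //=
   ?(ltNge o4) ?(ltNge 0 o2) ?(ltW s2) ?(ltW s4) //=; exfalso; try lra.
  all: try nra.
Qed.

Definition polygon_parity P y : bool :=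
  \big[addb/false]_(i < size P) ray_hits (pedge P i).1 (pedge P i).2 y.

(** Every corner is the first end of one edge and the second end of another, so each value is added
    twice modulo 2. *)
Lemma cyclic_addb_sum (f : point R -> bool) P :
  \big[addb/false]_(i < size P) (f (pedge P i).1 (+) f (pedge P i).2) = false.
Proof.
rewrite big_split /=.
rewrite [X in X (+) _](reindex_inj (@ordS_inj (size P))) /=.
rewrite -big_split /= big1 // => i _.
by rewrite addn1 addbb.
Qed.

Lemma polygon_parity_avoid P y z :
  (forall x, on_seg y z x -> ~ on_boundary P x) -> polygon_parity P y = polygon_parity P z.
Proof.
move=> av; apply/eqP; rewrite -negb_add /polygon_parity -big_split /=.
rewrite (eq_bigr (fun i : 'I_(size P) =>
  in_strip y z (pedge P i).1 (+) in_strip y z (pedge P i).2)) ?cyclic_addb_sum // => i _.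
apply: ray_hits_disjoint => x xi xyz; apply: av xyz _; exists i => //.
Qed.

Lemma polygon_parity_cross P y z (k : nat) : (k < size P)%N ->
  (forall i, (i < size P)%N -> i <> k -> forall x,
     on_seg (pedge P i).1 (pedge P i).2 x -> ~ on_seg y z x) ->
  orient (pedge P k).1 (pedge P k).2 y * orient (pedge P k).1 (pedge P k).2 z < 0 ->
  orient y z (pedge P k).1 * orient y z (pedge P k).2 < 0 ->
  polygon_parity P y = ~~ polygon_parity P z.
Proof.
move=> ks av c1 c2; apply/eqP; rewrite -addbT -negb_add addbA addbT negbK.
rewrite /polygon_parity -big_split /=.
pose k0 := Ordinal ks.
rewrite (bigD1 k0) //= ray_hits_cross //.
rewrite (eq_bigr (fun i : 'I_(size P) =>
  in_strip y z (pedge P i).1 (+) in_strip y z (pedge P i).2)); last first.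
  move=> i ik; apply: ray_hits_disjoint; apply: av => // eik.
  by case/eqP: ik; apply: val_inj.
have := cyclic_addb_sum (in_strip y z) P.
by rewrite (bigD1 k0) //= => h; rewrite -addbT addbAC h.
Qed.

Lemma polygon_parity_right P y : (forall q, q \in P -> q.1 < y.1) -> polygon_parity P y = false.
Proof.
move=> rt; rewrite /polygon_parity big1 // => i _.
have nz : (0 < size P)%N by apply: leq_ltn_trans (ltn_ord i).
have /rt lt1 : (pedge P i).1 \in P by apply: mem_nth.
have /rt lt2 : (pedge P i).2 \in P by apply: mem_nth; rewrite ltn_mod.
move: lt1 lt2; case: (pedge P i) => a b /= lt1 lt2.
apply/negP; rewrite /ray_hits /orient /cross /vsub /= -!ltNge.
case/orP => /and3P [h1 h2 h3]; nra.
Qed.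

(** Parity is constant along the chain and vanishes to the right of all corners. The converse, the
    hard half of the Jordan curve theorem for polygons, is avoided through [parity_interior]. *)
Lemma exterior_parity P x : exterior P x -> polygon_parity P x = false.
Proof.
case=> c; elim: c x => [|y c IH] x /= [av rt]; first exact: polygon_parity_right.
case: av => av1 av2; rewrite (@polygon_parity_avoid _ x y) //.
exact: IH.
Qed.

Lemma exterior_seg P x y : (forall z, on_seg x y z -> ~ on_boundary P z) ->
  exterior P y -> exterior P x.
Proof. by move=> av [c [cav rt]]; exists (y :: c). Qed.

Lemma on_segC a b x : on_seg a b x -> on_seg b a x.
Proof.
case=> t [/andP [t0 t1] ->]; exists (1 - t); split; first by apply/andP; split; lra.
by point_ring.
Qed.

Lemma on_segl a b : on_seg a b a.
Proof.
by exists 0; split; [rewrite lexx ler01|point_ring].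
Qed.

Lemma on_segr a b : on_seg a b b.
Proof. exact/on_segC/on_segl. Qed.

Lemma interior_seg P x y : (forall z, on_seg x y z -> ~ on_boundary P z) ->
  interior P x -> interior P y.
Proof.
move=> av [bx ex]; split; first exact: av (on_segr _ _).
by move=> ey; apply: ex; apply: exterior_seg ey.
Qed.

End Parity.

(** * Neighbourhoods that meet few edges, and transverse crossings *)

Section Local.
Variable R : realType.
Implicit Types (a b c d e n p q u v w x y z : point R) (P O : seq (point R)).

Definition near (eps : R) x y : Prop := `|y.1 - x.1| < eps /\ `|y.2 - x.2| < eps.

Lemma lt_lerp (l r s t : R) : 0 <= t <= 1 -> l < r -> l < s -> l < r + t * (s - r).
Proof.
case/andP => t0 t1 lr ls.
have [->|tn] := eqVneq t 1; first by lra.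
have : 0 < (1 - t) * (r - l) by rewrite mulr_gt0 // subr_gt0 // lt_neqAle tn.
have : 0 <= t * (s - l) by rewrite mulr_ge0 // subr_ge0 ltW.
by nra.
Qed.

Lemma lerp_lt (l r s t : R) : 0 <= t <= 1 -> r < l -> s < l -> r + t * (s - r) < l.
Proof.
move=> t01 rl sl.
have := @lt_lerp (- l) (- r) (- s) t t01; rewrite !ltrN2 => /(_ rl sl); lra.
Qed.

Lemma near_convex eps x y z w : near eps x y -> near eps x z -> on_seg y z w -> near eps x w.
Proof.
rewrite /near !ltr_norml => -[/andP [a1 a2] /andP [a3 a4]] [/andP [b1 b2] /andP [b3 b4]].
case=> t [t01 ->]; rewrite /vadd /vscale /vsub /=.
split; apply/andP; split; rewrite ?ltrBrDr ?ltrBlDr;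
  by [apply: lt_lerp; lra|apply: lerp_lt; lra].
Qed.

Lemma near_ray eps x d : 0 < eps ->
  exists2 t0 : R, 0 < t0 & forall t : R, 0 <= t -> t < t0 -> near eps x (vadd x (vscale t d)).
Proof.
move=> e0; pose m := `|d.1| + `|d.2| + 1.
have n1 := normr_ge0 d.1; have n2 := normr_ge0 d.2.
have m0 : 0 < m by rewrite /m; lra.
exists (eps / m); first by rewrite divr_gt0.
move=> t t0; rewrite ltr_pdivlMr // => tm.
by split; rewrite /vadd /vscale /= addrAC subrr add0r normrM (ger0_norm t0); rewrite /m in tm *; nra.
Qed.

Lemma on_seg_orient a b x : on_seg a b x -> orient a b x = 0.
Proof. by case=> t [_ ->]; orient_ring. Qed.

(** A point off the line is separated by a normal of the line, a point of the line beyond an end by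
    the direction of the segment, and a point off a degenerate segment by the vector from it. *)
Lemma not_on_seg_separated a b x : ~ on_seg a b x ->
  exists n, 0 < dot n (vsub x a) /\ 0 < dot n (vsub x b).
Proof.
move=> nx; pose o := orient a b x.
case: (ltgtP o 0) => [lo|go|eo].
- exists ((b.2 - a.2), (a.1 - b.1)).
  by move: lo; rewrite /o /orient /cross /vsub /dot /= => ?; split; nra.
- exists ((a.2 - b.2), (b.1 - a.1)).
  by move: go; rewrite /o /orient /cross /vsub /dot /= => ?; split; nra.
pose L := dot (vsub b a) (vsub b a).
have L0 : 0 <= L by rewrite /L /dot -!expr2 addr_ge0 ?sqr_ge0.
have [Lz|Lnz] := eqVneq L 0.
  have eab : a = b.
    move: Lz; rewrite /L /dot -!expr2 => /eqP; rewrite paddr_eq0 ?sqr_ge0 // !sqrf_eq0 !subr_eq0.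
    by case/andP => /eqP h1 /eqP h2; apply: pair_ext.
  subst b; exists (vsub x a).
  have : 0 < dot (vsub x a) (vsub x a); last by [].
  rewrite lt_neqAle eq_sym; apply/andP; split; last by rewrite /dot -!expr2 addr_ge0 ?sqr_ge0.
  rewrite /dot -!expr2 paddr_eq0 ?sqr_ge0 // !sqrf_eq0 !subr_eq0; apply/negP.
  case/andP => /eqP h1 /eqP h2; apply: nx; rewrite (pair_ext h1 h2); exact: on_segl.
have Lp : 0 < L by rewrite lt_neqAle eq_sym Lnz.
pose t := dot (vsub x a) (vsub b a) / L.
have tL : t * L = dot (vsub x a) (vsub b a) by rewrite /t divfK.
have xE : x = vadd a (vscale t (vsub b a)).
  apply: pair_ext; apply: (mulIf Lnz); rewrite /vadd /vscale /= mulrDl mulrAC tL;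
    move: eo; rewrite /L /o /orient /cross /dot /vsub /= => eo.
    by apply/eqP; rewrite -subr_eq0; apply/eqP; rewrite -[RHS](mulr0 (a.2 - b.2)) -eo; ring.
  by apply/eqP; rewrite -subr_eq0; apply/eqP; rewrite -[RHS](mulr0 (b.1 - a.1)) -eo; ring.
case: (ltP t 0) => [t0|t0].
  exists (vsub a b).
  have e1 : dot (vsub a b) (vsub x a) = - t * L by rewrite mulNr tL /dot /vsub /=; ring.
  have e2 : dot (vsub a b) (vsub x b) = - t * L + L by rewrite mulNr tL /L /dot /vsub /=; ring.
  by rewrite e1 e2; split; nra.
case: (leP t 1) => [t1|t1].
  by case: nx; exists t; rewrite t0 t1; split.
exists (vsub b a).
have e1 : dot (vsub b a) (vsub x a) = t * L by rewrite tL /dot /vsub /=; ring.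
have e2 : dot (vsub b a) (vsub x b) = t * L - L by rewrite tL /L /dot /vsub /=; ring.
by rewrite e1 e2; split; nra.
Qed.

Lemma near_avoids_seg a b x : ~ on_seg a b x ->
  exists2 eps : R, 0 < eps & forall y, near eps x y -> ~ on_seg a b y.
Proof.
move=> /not_on_seg_separated [n [h1 h2]].
(* On the box of radius [eps] the functional [n] varies by less than [m * eps]; the summand 1 keeps
   [m] positive. *)
pose m := `|n.1| + `|n.2| + 1.
have n1 := normr_ge0 n.1; have n2 := normr_ge0 n.2.
have m0 : 0 < m by rewrite /m; lra.
pose k := Num.min (dot n (vsub x a)) (dot n (vsub x b)).
have k0 : 0 < k by rewrite lt_min h1 h2.
exists (k / m); first by rewrite divr_gt0.
move=> y [y1 y2] [t [/andP [t0 t1] yE]].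
have e1 : k <= dot n (vsub x y).
  have -> : dot n (vsub x y) = (1 - t) * dot n (vsub x a) + t * dot n (vsub x b).
    by rewrite yE /dot /vsub /vadd /vscale /=; ring.
  have ka : k <= dot n (vsub x a) by rewrite ge_min lexx.
  have kb : k <= dot n (vsub x b) by rewrite ge_min lexx orbT.
  nra.
have e2 : dot n (vsub x y) <= `|n.1| * `|y.1 - x.1| + `|n.2| * `|y.2 - x.2|.
  rewrite -!normrM /dot /vsub /=.
  have := ler_norm (- (n.1 * (y.1 - x.1))); have := ler_norm (- (n.2 * (y.2 - x.2))).
  by rewrite !normrN; nra.
have e3 : 0 < k / m by rewrite divr_gt0.
have e4 : k / m * m = k by rewrite divfK // gt_eqF.
have e5 : k / m * m = k / m * `|n.1| + k / m * `|n.2| + k / m by rewrite /m; ring.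
have e6 : `|n.1| * `|y.1 - x.1| <= k / m * `|n.1| by rewrite mulrC ler_wpM2r // ltW.
have e7 : `|n.2| * `|y.2 - x.2| <= k / m * `|n.2| by rewrite mulrC ler_wpM2r // ltW.
lra.
Qed.

Lemma near_le (e1 e2 : R) x y : e1 <= e2 -> near e1 x y -> near e2 x y.
Proof. by move=> le [h1 h2]; split; apply: lt_le_trans le. Qed.

Lemma near_avoids_edges P (J : nat -> Prop) x :
  (forall i, (i < size P)%N -> J i -> ~ on_seg (pedge P i).1 (pedge P i).2 x) ->
  exists2 eps : R, 0 < eps & forall i, (i < size P)%N -> J i ->
    forall y, near eps x y -> ~ on_seg (pedge P i).1 (pedge P i).2 y.
Proof.
have: (size P <= size P)%N by [].
move: {1 3 4}(size P) => n; elim: n => [|n IH] lt av; first by exists 1.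
have [|e1 e1p h1] := IH (ltnW lt); first by move=> i ni; apply: av; apply: ltnW.
have [jn|jn] := pselect (J n); last first.
  exists e1 => // i; rewrite ltnS leq_eqVlt => /orP [/eqP -> //|]; exact: h1.
have [e2 e2p h2] := near_avoids_seg (av n (ltnSn n) jn).
exists (Num.min e1 e2); first by rewrite lt_min e1p e2p.
move=> i; rewrite ltnS leq_eqVlt => /orP [/eqP -> _|ni ji] y yn.
  by apply: h2; apply: near_le yn; rewrite ge_min lexx orbT.
by apply: h1 => //; apply: near_le yn; rewrite ge_min lexx.
Qed.

(** If [y] is not interior it is exterior, hence even; then [z] is odd and cannot be exterior. *)
Lemma parity_interior P y z : ~ on_boundary P y -> ~ on_boundary P z ->
  polygon_parity P y = ~~ polygon_parity P z -> ~ interior P y -> interior P z.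
Proof.
move=> by_ bz par ny; split=> // ez; apply: ny; split=> // ey.
by move: par; rewrite !exterior_parity.
Qed.

Lemma simple_edge_inner P k i x : simple_polygon P -> (k < size P)%N -> (i < size P)%N ->
  i <> k -> on_seg (pedge P i).1 (pedge P i).2 x -> on_seg (pedge P k).1 (pedge P k).2 x ->
  x = (pedge P k).1 \/ x = (pedge P k).2.
Proof.
move=> [_ [_ sp]] kP iP /eqP; rewrite neq_ltn => /orP [ik|ki] xi xk.
  by case: (sp i k _ x xi xk) => //; rewrite ik kP.
by case: (sp k i _ x xk xi) => //; rewrite ki iP.
Qed.

(** Around [x] the boundary consists of edge [k] alone. The points of [pq] just before and just
    after [x] therefore differ in parity, and one of them is interior. *)
Lemma crossing_meets_interior P p q k x : simple_polygon P -> (k < size P)%N ->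
  open_seg (pedge P k).1 (pedge P k).2 x -> open_seg p q x ->
  cross (vsub (pedge P k).2 (pedge P k).1) (vsub q p) <> 0 ->
  exists2 y, on_seg p q y & interior P y.
Proof.
move=> sp kP; set a := (pedge P k).1; set b := (pedge P k).2.
move=> [s [/andP [s0 s1] xab]] [r [/andP [r0 r1] xpq]] tr.
set K := cross _ _ in tr.
have xe : on_seg a b x by exists s; rewrite (ltW s0) (ltW s1).
have nab : a <> b by move=> h; apply: tr; rewrite /K h /cross /vsub /=; ring.
have xa : x <> a.
  move=> h; apply: nab; move: xab; rewrite h => h'.
  have := congr1 fst h'; have := congr1 snd h'; rewrite /vadd /vscale /vsub /= => e2 e1.
  by apply: pair_ext; nra.
have xb : x <> b.
  move=> h; apply: nab; move: xab; rewrite h => h'.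
  have := congr1 fst h'; have := congr1 snd h'; rewrite /vadd /vscale /vsub /= => e2 e1.
  by apply: pair_ext; nra.
have [|eps eps0 box] := @near_avoids_edges P (fun i => i <> k) x.
  by move=> i iP ik xi; case: (simple_edge_inner sp kP iP ik xi xe).
have [t1 t10 nt1] := near_ray x (vsub q p) eps0.
have [t2 t20 nt2] := near_ray x (vsub p q) eps0.
have r1' : 0 < 1 - r by rewrite subr_gt0.
(* The step [t] has to stay in the box in both directions ([t1], [t2]) and on [pq] ([r],
   [1 - r]). *)
have [t3 [t30 t31 t32]] := ex_lt2 t10 t20; have [t4 [t40 t41 t42]] := ex_lt2 r0 r1'.
have [t [t0 tt3 tt4]] := ex_lt2 t30 t40.
have tt1 := lt_trans tt3 t31; have tt2 := lt_trans tt3 t32.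
have tr1 := lt_trans tt4 t41; have tr2 := lt_trans tt4 t42.
pose y := vadd x (vscale t (vsub p q)); pose z := vadd x (vscale t (vsub q p)).
have ny : near eps x y by apply: nt2 => //; apply: ltW.
have nz : near eps x z by apply: nt1 => //; apply: ltW.
have yE : y = vadd p (vscale (r - t) (vsub q p)).
  by apply: pair_ext; rewrite /y xpq /vadd /vscale /vsub /=; ring.
have zE : z = vadd p (vscale (r + t) (vsub q p)).
  by apply: pair_ext; rewrite /z xpq /vadd /vscale /vsub /=; ring.
have oy : orient a b y = - t * K.
  by rewrite /y xab /K; orient_ring.
have oz : orient a b z = t * K.
  by rewrite /z xab /K; orient_ring.
have K2 : 0 < K ^+ 2 by rewrite exprn_even_gt0 //=; apply/eqP.
have tp2 : 0 < t ^+ 2 by rewrite exprn_gt0.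
have bd w : near eps x w -> orient a b w <> 0 -> ~ on_boundary P w.
  move=> nw ow [i iP wi]; have [eik|nik] := pselect (i = k).
    by apply: ow; apply: on_seg_orient; rewrite /a /b -eik.
  exact: box nw wi.
have par : polygon_parity P y = ~~ polygon_parity P z.
  apply: (@polygon_parity_cross _ _ _ _ k) => //.
  - by move=> i iP ik w wi wyz; apply: box iP ik _ (near_convex ny nz wyz) wi.
  - by rewrite -/a -/b oy oz; have := mulr_gt0 tp2 K2; nra.
  - have -> : orient y z (pedge P k).1 = 2 * t * (s * K).
      by rewrite /y /z xab /K /orient /cross /vadd /vscale /vsub -/a -/b /=; ring.
    have -> : orient y z (pedge P k).2 = 2 * t * ((s - 1) * K).
      by rewrite /y /z xab /K /orient /cross /vadd /vscale /vsub -/a -/b /=; ring.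
    have -> : 2 * t * (s * K) * (2 * t * ((s - 1) * K)) = (t ^+ 2 * K ^+ 2) * (4 * (s * (s - 1))).
      by ring.
    have h1 := mulr_gt0 tp2 K2.
    have h2 : s * (s - 1) < 0 by nra.
    by nra.
have [iy|niy] := pselect (interior P y).
  by exists y => //; exists (r - t); split=> //; clear - t0 r1 tr1; apply/andP; split; lra.
exists z; first by exists (r + t); split=> //; clear - t0 r0 tr2; apply/andP; split; lra.
apply: parity_interior par niy.
  by apply: bd => //; rewrite oy => /eqP; rewrite mulf_eq0 oppr_eq0 (gt_eqF t0) => /eqP.
by apply: bd => //; rewrite oz => /eqP; rewrite mulf_eq0 (gt_eqF t0) => /eqP.
Qed.

End Local.

(** * Local structure at a corner *)

Section Corner.
Variable R : realType.
Implicit Types (a b c d e n p q u v w x y z : point R) (P O : seq (point R)).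

Definition corner_nbrs P u e1 e2 : Prop :=
  (e1 = prev_corner P u /\ e2 = next_corner P u) \/
  (e1 = next_corner P u /\ e2 = prev_corner P u).

Lemma corner_nbrsC P u e1 e2 : corner_nbrs P u e1 e2 -> corner_nbrs P u e2 e1.
Proof. by case=> -[-> ->]; [right|left]. Qed.

Lemma corner_edges P u : simple_polygon P -> u \in P ->
  exists i j, [/\ (i < size P)%N, (j < size P)%N, i <> j,
    pedge P i = (u, next_corner P u) /\ pedge P j = (prev_corner P u, u) &
    forall k, (k < size P)%N -> k <> i -> k <> j ->
      ~ on_seg (pedge P k).1 (pedge P k).2 u].
Proof.
move=> sp uP; have [n3 [un _]] := sp.
set i := index u P; have iP : (i < size P)%N by rewrite index_mem.
set j := ((i + size P - 1) %% size P)%N.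
have n0 : (0 < size P)%N by lia.
have jP : (j < size P)%N by rewrite ltn_mod.
have jE : j = if i == 0%N then (size P).-1 else i.-1.
  rewrite /j; case: eqP => [->|i0].
    by rewrite modn_small; lia.
  have -> : (i + size P - 1 = i.-1 + size P)%N by lia.
  by rewrite modnDr modn_small; lia.
have nxt k : (k < size P)%N -> ((k + 1) %% size P)%N = if k == (size P).-1 then 0%N else k.+1.
  move=> kP; case: eqP => [->|kn].
    by rewrite addn1 prednK // modnn.
  by rewrite modn_small; lia.
have ni : nth (0, 0) P i = u by rewrite nth_index.
have sj : ((j + 1) %% size P)%N = i by rewrite nxt // jE; do 2 case: eqP; lia.
have ei : pedge P i = (u, next_corner P u).
  by rewrite /pedge ni /next_corner -/i (set_nth_default (0, 0)) // ltn_mod.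
have ej : pedge P j = (prev_corner P u, u).
  by rewrite /pedge sj ni /prev_corner -/i -/j (set_nth_default (0, 0)).
have ij : i <> j by rewrite jE; case: eqP; lia.
exists i, j; split=> // k kP ki kj uk.
have ui : on_seg (pedge P i).1 (pedge P i).2 u by rewrite ei; apply: on_segl.
have inj (l m : nat) : (l < size P)%N -> (m < size P)%N -> nth (0, 0) P l = nth (0, 0) P m -> l = m.
  by move=> aP bP /eqP; rewrite nth_uniq // => /eqP.
case: (simple_edge_inner sp kP iP (fun h => ki (esym h)) ui uk); rewrite /pedge /= -{1}ni => /inj.
  by move=> h; apply: ki; rewrite h.
move=> h; have {}h : i = ((k + 1) %% size P)%N by apply: h; rewrite // ltn_mod.
by apply: kj; move: h; rewrite nxt // jE; do 2 case: eqP; lia.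
Qed.

Lemma corner_nbrs_neq P u e1 e2 : simple_polygon P -> u \in P -> corner_nbrs P u e1 e2 ->
  [/\ e1 \in P, e2 \in P, e1 <> u, e2 <> u & e1 <> e2].
Proof.
move=> sp uP; have [n3 [un _]] := sp.
set i := index u P; have iP : (i < size P)%N by rewrite index_mem.
have n0 : (0 < size P)%N by lia.
have jP : ((i + size P - 1) %% size P < size P)%N by rewrite ltn_mod.
have kP : ((i + 1) %% size P < size P)%N by rewrite ltn_mod.
have ni : nth u P i = u by rewrite nth_index.
have inj (l m : nat) : (l < size P)%N -> (m < size P)%N -> nth u P l = nth u P m -> l = m.
  by move=> aP bP /eqP; rewrite nth_uniq // => /eqP.
have jE : ((i + size P - 1) %% size P)%N = if i == 0%N then (size P).-1 else i.-1.
  case: eqP => [->|i0]; first by rewrite modn_small; lia.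
  have -> : (i + size P - 1 = i.-1 + size P)%N by lia.
  by rewrite modnDr modn_small; lia.
have kE : ((i + 1) %% size P)%N = if i == (size P).-1 then 0%N else i.+1.
  case: eqP => [->|kn]; first by rewrite addn1 prednK // modnn.
  by rewrite modn_small; lia.
have pu : prev_corner P u <> u.
  rewrite /prev_corner -/i -{2}ni => /inj; rewrite jE => /(_ _ iP).
  by case: eqP; lia.
have nu : next_corner P u <> u.
  rewrite /next_corner -/i -{2}ni => /inj; rewrite kE => /(_ _ iP).
  by case: eqP; lia.
have pn : prev_corner P u <> next_corner P u.
  rewrite /next_corner /prev_corner -/i => /inj; rewrite jE kE.
  by do 2 case: eqP; lia.
have pP : prev_corner P u \in P by apply: mem_nth.
have nP : next_corner P u \in P by apply: mem_nth.
by case=> -[-> ->]; split=> //; apply: nesym.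
Qed.

Lemma corner_local P u : simple_polygon P -> u \in P ->
  exists2 eps : R, 0 < eps &
    (forall e1 e2 w, corner_nbrs P u e1 e2 -> near eps u w -> on_boundary P w ->
        on_seg u e1 w \/ on_seg u e2 w) /\
    (forall e1 e2 y z, corner_nbrs P u e1 e2 -> near eps u y -> near eps u z ->
       orient u e1 y * orient u e1 z < 0 -> orient y z u * orient y z e1 < 0 ->
       (forall x, on_seg u e2 x -> ~ on_seg y z x) ->
       polygon_parity P y = ~~ polygon_parity P z).
Proof.
move=> sp uP; have [i [j [iP jP ij [ei ej] oth]]] := corner_edges sp uP.
have [|eps eps0 box] := @near_avoids_edges _ P (fun k => k <> i /\ k <> j) u.
  by move=> k kP [ki kj]; apply: oth.
exists eps => //; split.
  move=> e1 e2 w nb nw [k kP wk].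
  have [ki|ki] := pselect (k = i).
    by move: wk; rewrite ki ei /=; case: nb => -[-> ->]; [right|left].
  have [kj|kj] := pselect (k = j).
    by move: wk; rewrite kj ej /= => /on_segC; case: nb => -[-> ->]; [left|right].
  by case: (box k kP _ w nw wk).
move=> e1 e2 y z nb ny nz c1 c2 av.
have bx k : (k < size P)%N -> k <> i -> k <> j -> forall x,
     on_seg (pedge P k).1 (pedge P k).2 x -> ~ on_seg y z x.
  move=> kP ki kj x xk xyz; exact: box kP (conj ki kj) _ (near_convex ny nz xyz) xk.
case: nb av c1 c2 => -[-> ->] av c1 c2.
  apply: (@polygon_parity_cross _ _ _ _ j) => //; last 2 first.
  - by rewrite ej /= !(orientC u) mulrNN.
  - by rewrite ej /= mulrC.
  move=> k kP kj x xk; have [ki|ki] := pselect (k = i).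
    by apply: av; move: xk; rewrite ki ei.
  exact: bx xk.
apply: (@polygon_parity_cross _ _ _ _ i) => //; try by rewrite ei.
move=> k kP ki x xk; have [kj|kj] := pselect (k = j).
  by apply: av; apply: on_segC; move: xk; rewrite kj ej.
exact: bx xk.
Qed.

(** Farkas' lemma in the plane: [e] is outside the closed sector from [d1] to [d2]. The functional
    is [cross e], its negative, or the one that is constant on the segment from [d1] to [d2]. *)
Lemma wedge_separation (d1 d2 e : point R) : 0 < cross d1 d2 ->
  cross d1 e < 0 \/ cross e d2 < 0 ->
  exists n, [/\ 0 < dot n d1, 0 < dot n d2 & dot n e <= 0].
Proof.
move=> d12; case: (ltP (cross d1 e) 0) => [h1 _|h1 [//|h2]].
  case: (ltP 0 (cross e d2)) => h2.
    exists (- e.2, e.1); move: h1 h2; rewrite /cross /dot /= => ? ?; split; lra.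
  exists (d2.2 - d1.2, d1.1 - d2.1).
  by move: d12 h1 h2; rewrite /cross /dot /= => ? ? ?; split; nra.
case: (ltP 0 (cross d1 e)) => h3.
  exists (e.2, - e.1); move: h2 h3; rewrite /cross /dot /= => ? ?; split; lra.
exists (d2.2 - d1.2, d1.1 - d2.1).
by move: d12 h2 h3; rewrite /cross /dot /= => ? ? ?; split; nra.
Qed.

Lemma ray_seg_disjoint n u e d1 d2 (s t : R) x : 0 < s -> 0 < t ->
  0 < dot n d1 -> 0 < dot n d2 -> dot n (vsub e u) <= 0 -> on_seg u e x ->
  ~ on_seg (vadd u (vscale s d1)) (vadd u (vscale t d2)) x.
Proof.
move=> s0 t0 h1 h2 h3 [r [/andP [r0 r1] xE]] [q [/andP [q0 q1] xE']].
have e1 : dot n (vsub x u) = r * dot n (vsub e u).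
  by rewrite xE /dot /vsub /vadd /vscale /=; ring.
have e2 : dot n (vsub x u) = (1 - q) * (s * dot n d1) + q * (t * dot n d2).
  by rewrite xE' /dot /vsub /vadd /vscale /=; ring.
have p1 : 0 < s * dot n d1 by rewrite mulr_gt0.
have p2 : 0 < t * dot n d2 by rewrite mulr_gt0.
have : r * dot n (vsub e u) <= 0 by nra.
rewrite -e1 e2; move: p1 p2; move: (s * _) (t * _) => A B *.
by have := @lt_lerp R 0 A B q; rewrite q0 q1 => /(_ isT) h; have := h _ _; nra.
Qed.

Lemma corner_link P u e1 e2 (d1 d2 n1 n2 : point R) : simple_polygon P -> u \in P ->
  corner_nbrs P u e1 e2 ->
  0 < dot n1 d1 -> 0 < dot n1 d2 -> dot n1 (vsub e1 u) <= 0 ->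
  0 < dot n2 d1 -> 0 < dot n2 d2 -> dot n2 (vsub e2 u) <= 0 ->
  exists2 eps : R, 0 < eps & forall s t : R, 0 < s < eps -> 0 < t < eps -> forall x,
    on_seg (vadd u (vscale s d1)) (vadd u (vscale t d2)) x -> ~ on_boundary P x.
Proof.
move=> sp uP nb a1 a2 a3 b1 b2 b3.
have [eps eps0 [box _]] := corner_local sp uP.
have [t1 t10 nt1] := near_ray u d1 eps0; have [t2 t20 nt2] := near_ray u d2 eps0.
exists (Num.min t1 t2); first by rewrite lt_min t10 t20.
move=> s t /andP [s0 sl] /andP [t0 tl] x xs; move: sl tl; rewrite !lt_min => /andP [sl _] /andP [_ tl].
have nx : near eps u x by apply: near_convex xs; [apply: nt1|apply: nt2] => //; apply: ltW.
case/(box e1 e2 x nb nx) => h.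
  exact: (ray_seg_disjoint s0 t0 a1 a2 a3 h xs).
exact: (ray_seg_disjoint s0 t0 b1 b2 b3 h xs).
Qed.

(** Near [u], the segment between the two rays crosses the edge to [e1] and misses the edge to
    [e2]. *)
Lemma corner_flip P u e1 e2 (d1 d2 : point R) : simple_polygon P -> u \in P ->
  corner_nbrs P u e1 e2 ->
  0 < cross d1 d2 -> 0 < cross d1 (vsub e1 u) -> 0 < cross (vsub e1 u) d2 ->
  cross d1 (vsub e2 u) < 0 \/ cross (vsub e2 u) d2 < 0 ->
  exists2 eps : R, 0 < eps & forall t : R, 0 < t < eps ->
    [/\ ~ on_boundary P (vadd u (vscale t d1)), ~ on_boundary P (vadd u (vscale t d2)) &
     polygon_parity P (vadd u (vscale t d1)) = ~~ polygon_parity P (vadd u (vscale t d2))].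
Proof.
move=> sp uP nb d12 p1 p2 out.
have [eps eps0 [box par]] := corner_local sp uP.
have [n [n1 n2 n3]] := wedge_separation d12 out.
have [t1 t10 nt1] := near_ray u d1 eps0; have [t2 t20 nt2] := near_ray u d2 eps0.
pose K := cross d1 (vsub e1 u) + cross (vsub e1 u) d2.
have K0 : 0 < K by rewrite /K; lra.
(* Below [K / cross d1 d2] the segment cuts the ray towards [e1] before [e1] itself. *)
exists (Num.min (Num.min t1 t2) (K / cross d1 d2)).
  by rewrite !lt_min t10 t20 divr_gt0.
move=> t /andP [t0]; rewrite !lt_min => /andP [/andP [l1 l2]]; rewrite ltr_pdivlMr // => l3.
have ny := nt1 t (ltW t0) l1; have nz := nt2 t (ltW t0) l2.
set y := vadd u _ in ny *; set z := vadd u _ in nz *.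
have t2p : 0 < t ^+ 2 by rewrite exprn_gt0.
have oy : orient u e1 y = - (t * cross d1 (vsub e1 u)).
  by rewrite /orient /y /cross /vsub /vadd /vscale /=; ring.
have oz : orient u e1 z = t * cross (vsub e1 u) d2.
  by rewrite /orient /z /cross /vsub /vadd /vscale /=; ring.
have q1 : 0 < t * cross d1 (vsub e1 u) by rewrite mulr_gt0.
have q2 : 0 < t * cross (vsub e1 u) d2 by rewrite mulr_gt0.
have dj : forall x, on_seg u e2 x -> ~ on_seg y z x.
  by move=> x xe; apply: (ray_seg_disjoint t0 t0 n1 n2 n3 xe).
split.
- case/(box e1 e2 y nb ny) => h.
    by move: oy; rewrite (on_seg_orient h); lra.
  exact: dj h (on_segl _ _).
- case/(box e1 e2 z nb nz) => h.
    by move: oz; rewrite (on_seg_orient h); lra.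
  exact: dj h (on_segr _ _).
apply: par nb ny nz _ _ dj; first by rewrite oy oz; nra.
have -> : orient y z u = t ^+ 2 * cross d1 d2.
  by rewrite /orient /y /z /cross /vsub /vadd /vscale /=; ring.
have -> : orient y z e1 = t * (t * cross d1 d2 - K).
  by rewrite /K /orient /y /z /cross /vsub /vadd /vscale /=; ring.
have h1 : 0 < t ^+ 2 * cross d1 d2 by rewrite mulr_gt0.
have h2 : t * (t * cross d1 d2 - K) < 0 by rewrite pmulr_rlt0 // subr_lt0.
by rewrite pmulr_rlt0.
Qed.

End Corner.

(** * Visibility *)

Section Wedge.
Variable R : realType.
Variables (V : seq (point R)) (S : seq (seq (point R))).
Hypothesis VS : valid_setting V S.
Implicit Types (a b c d e n p q u v w x y z : point R) (P O : seq (point R)).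

Lemma obstacle_simple O : O \in S -> simple_polygon O.
Proof. by case: VS => _ [h _] /h []. Qed.

Lemma obstacle_sub O : O \in S -> {subset O <= V}.
Proof. by case: VS => _ [h _] /h []. Qed.

Lemma obstacle_unique O O' u : O \in S -> O' \in S -> u \in O -> u \in O' -> O = O'.
Proof.
case: VS => _ [_ [h _]] OS OS' uO uO'.
have iO : (index O S < size S)%N by rewrite index_mem.
have iO' : (index O' S < size S)%N by rewrite index_mem.
have [e|ne] := pselect (index O S = index O' S).
  by rewrite -(nth_index [::] OS) e nth_index.
by case: (h _ _ iO iO' ne) => _ /(_ u) []; rewrite !nth_index.
Qed.

Lemma orient_neq0 a b c : a \in V -> b \in V -> c \in V -> a <> b -> a <> c -> b <> c ->
  orient a b c <> 0.
Proof. by case: VS => _ [_ [_ [h _]]]; apply: h. Qed.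

Lemma pedge_mem O k : O \in S -> (k < size O)%N ->
  [/\ (pedge O k).1 \in O, (pedge O k).2 \in O & (pedge O k).1 <> (pedge O k).2].
Proof.
move=> OS kO; have [n3 [un _]] := obstacle_simple OS.
have n0 : (0 < size O)%N by lia.
split; rewrite ?mem_nth ?ltn_mod //=.
move=> /eqP; rewrite nth_uniq ?ltn_mod // => /eqP kE.
have : k = (if k == (size O).-1 then 0%N else k.+1).
  rewrite {1}kE; case: eqP => [->|kn]; first by rewrite addn1 prednK // modnn.
  by rewrite modn_small; lia.
by case: eqP; lia.
Qed.

Lemma vertex_on_edge O k u : O \in S -> (k < size O)%N -> u \in V ->
  on_seg (pedge O k).1 (pedge O k).2 u -> u = (pedge O k).1 \/ u = (pedge O k).2.
Proof.
move=> OS kO uV; have [aO bO ab] := pedge_mem OS kO.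
move=> /on_seg_orient o0; apply: contrapT => /not_orP [ua ub].
case: (@orient_neq0 (pedge O k).1 (pedge O k).2 u _ _ uV) => //; try exact: nesym.
  exact: obstacle_sub OS _ aO.
exact: obstacle_sub OS _ bO.
Qed.

Lemma vertex_on_boundary O u : O \in S -> u \in V -> on_boundary O u -> u \in O.
Proof.
move=> OS uV [k kO uk]; have [aO bO _] := pedge_mem OS kO.
by case: (vertex_on_edge OS kO uV uk) => ->.
Qed.

Lemma visible_not_interior p q O x : vis_edge V S p q -> O \in S -> on_seg p q x -> ~ interior O x.
Proof. by move=> [_ [_ [_ h]]] OS; apply: (h O OS x). Qed.

Lemma vis_edgeC p q : vis_edge V S p q -> vis_edge V S q p.
Proof.
case=> pV [qV [pq h]]; split=> //; split=> //; split; first exact: nesym.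
by move=> O OS x /on_segC; apply: (h O OS x).
Qed.

Lemma open_on_seg a b x : open_seg a b x -> on_seg a b x.
Proof. by case=> t [/andP [t0 t1] ->]; exists t; rewrite (ltW t0) (ltW t1). Qed.

Lemma open_seg_neq a b x : a <> b -> open_seg a b x -> x <> a /\ x <> b.
Proof.
move=> ab [t [/andP [t0 t1] ->]]; split=> h; apply: ab.
  have := congr1 fst h; have := congr1 snd h; rewrite /vadd /vscale /vsub /= => e2 e1.
  by apply: pair_ext; nra.
have := congr1 fst h; have := congr1 snd h; rewrite /vadd /vscale /vsub /= => e2 e1.
by apply: pair_ext; nra.
Qed.

Lemma on_seg_open a b x : on_seg a b x -> x <> a -> x <> b -> open_seg a b x.
Proof.
case=> t [/andP [t0 t1] xE] xa xb; exists t; split=> //.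
rewrite !lt_neqAle t0 t1 !andbT; apply/andP; split; apply/eqP => e.
  by apply: xa; rewrite xE -e; point_ring.
by apply: xb; rewrite xE e; point_ring.
Qed.

Lemma collinear_eq a b p : a \in V -> b \in V -> p \in V -> a <> b -> orient a b p = 0 ->
  p = a \/ p = b.
Proof.
move=> aV bV pV ab o0; apply: contrapT => /not_orP [pa pb].
by apply: (@orient_neq0 a b p) => //; apply: nesym.
Qed.

(** A corner inside [pq] contradicts general position, a transverse crossing meets the interior of
    the obstacle, and a parallel contact makes the four ends collinear, which leaves only
    equality. *)
Lemma visible_hits_edge p q x O k : vis_edge V S p q -> open_seg p q x -> O \in S ->
  (k < size O)%N -> on_seg (pedge O k).1 (pedge O k).2 x ->
  pedge O k = (p, q) \/ pedge O k = (q, p).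
Proof.
move=> vpq xpq OS kO xab; have [pV [qV [pq _]]] := vpq.
have [aO bO ab] := pedge_mem OS kO.
have aV := obstacle_sub OS aO; have bV := obstacle_sub OS bO.
move: aV bV ab; set a := (pedge O k).1 in xab *; set b := (pedge O k).2 in xab * => aV bV ab.
have [xp xq] := open_seg_neq pq xpq.
have xpq0 : orient p q x = 0 by apply/on_seg_orient/open_on_seg.
have xa : x <> a.
  by move=> h; move: xpq0; rewrite h => /(collinear_eq pV qV aV pq); rewrite -h; case.
have xb : x <> b.
  by move=> h; move: xpq0; rewrite h => /(collinear_eq pV qV bV pq); rewrite -h; case.
have xab' := on_seg_open xab xa xb.
have [par|npar] := pselect (cross (vsub b a) (vsub q p) = 0); last first.
  have [y ypq iy] := crossing_meets_interior (obstacle_simple OS) kO xab' xpq npar.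
  by case: (visible_not_interior vpq OS ypq iy).
case: xpq => t [_ xE]; have ox := on_seg_orient xab.
have op : orient a b p = 0.
  have -> : orient a b p = orient a b x - t * cross (vsub b a) (vsub q p).
    by rewrite xE /orient /cross /vsub /vadd /vscale /=; ring.
  by rewrite ox par mulr0 subr0.
have oq : orient a b q = 0.
  have -> : orient a b q = orient a b x + (1 - t) * cross (vsub b a) (vsub q p).
    by rewrite xE /orient /cross /vsub /vadd /vscale /=; ring.
  by rewrite ox par mulr0 addr0.
have eab : pedge O k = (a, b) by rewrite /a /b; case: (pedge O k).
rewrite eab.
case: (collinear_eq aV bV pV ab op) => pe; case: (collinear_eq aV bV qV ab oq) => qe.
- by case: pq; rewrite pe qe.
- by left; rewrite pe qe.
- by right; rewrite pe qe.
- by case: pq; rewrite pe qe.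
Qed.

Definition in_wedge (d1 d2 e : point R) : Prop := 0 <= cross d1 e /\ 0 <= cross e d2.

(* [p] and [q] are separated at [u] by the obstacle having [u] as a corner; for
   visible vertices of one cone, subcones are the classes of [same_side]. *)
Definition separated u p q : Prop :=
  0 < orient u p q /\ exists O e1 e2,
  [/\ O \in S, u \in O, corner_nbrs O u e1 e2, 0 < orient u e1 e2 & wedge_interior O u e1 e2] /\
  in_wedge (vsub p u) (vsub q u) (vsub e1 u) /\ in_wedge (vsub p u) (vsub q u) (vsub e2 u).

Definition same_side u p q : Prop := ~ separated u p q /\ ~ separated u q p.

Lemma same_sideC u p q : same_side u p q -> same_side u q p.
Proof. by case. Qed.

Lemma same_side_refl u p : same_side u p p.
Proof.
have o0 : orient u p p = 0 by rewrite /orient /cross; ring.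
by split=> -[]; rewrite o0 ltxx.
Qed.

Lemma visible_ray_not_interior u p O (t : R) : vis_edge V S u p -> O \in S -> 0 <= t <= 1 ->
  ~ interior O (vadd u (vscale t (vsub p u))).
Proof. by move=> vup OS t01; apply: visible_not_interior vup OS _; exists t. Qed.

Lemma corner_nbr_mem O u e1 e2 : O \in S -> u \in O -> corner_nbrs O u e1 e2 ->
  [/\ u \in V, e1 \in V, e2 \in V & [/\ e1 <> u, e2 <> u & e1 <> e2]].
Proof.
move=> OS uO nb; have [e1O e2O h1 h2 h3] := corner_nbrs_neq (obstacle_simple OS) uO nb.
by split; rewrite ?(obstacle_sub OS).
Qed.

(** If [e'] is outside the sector, the rays to [p] and [q] have different parities near [u], and one
    of the visible segments enters the interior. If [e'] is in the sector too, the same comparison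
    with the bisector of the two edges shows that the obstacle fills the wedge between them, which
    separates [p] from [q]. *)
Lemma no_edge_between u p q O e e' : vis_edge V S u p -> vis_edge V S u q ->
  ~ separated u p q -> 0 < orient u p q -> O \in S -> u \in O -> corner_nbrs O u e e' ->
  0 < orient u p e -> 0 < orient u e q -> False.
Proof.
move=> vp vq ns o0 OS uO nb pe eq.
have sp := obstacle_simple OS.
have [uV eV e'V [eu e'u ee']] := corner_nbr_mem OS uO nb.
have [out|] := pselect (orient u p e' < 0 \/ orient u e' q < 0).
  have [eps eps0 h] := corner_flip sp uO nb o0 pe eq out.
  have [t [t0 te t1]] := ex_lt2 eps0 (@ltr01 R).
  have [|b1 b2 par] := h t; first by rewrite t0 te.
  have t01 : 0 <= t <= 1 by rewrite !ltW.
  by apply: (visible_ray_not_interior vq OS t01); apply: parity_interior b1 b2 par _;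
    apply: visible_ray_not_interior vp OS t01.
move=> /not_orP [/negP + /negP]; rewrite -!leNgt => pe' e'q.
pose m := vadd (vsub e u) (vsub e' u).
have mc (d : point R) : cross d m = cross d (vsub e u) + cross d (vsub e' u).
  by rewrite /m /cross /vadd /vsub /=; ring.
have cm (d : point R) : cross m d = cross (vsub e u) d + cross (vsub e' u) d.
  by rewrite /m /cross /vadd /vsub /=; ring.
have cc (d : point R) : cross d d = 0 by rewrite /cross; ring.
have anti (d1 d2 : point R) : cross d2 d1 = - cross d1 d2 by rewrite /cross; ring.
move: pe eq pe' e'q; rewrite /orient => pe eq pe' e'q.
have oee' : orient u e e' <> 0.
  by apply: orient_neq0 => //; apply: nesym.
case: (ltgtP (orient u e e') 0) => [lt|gt|//]; [rewrite /orient in lt|rewrite /orient in gt].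
  (* e' precedes e: compare the bisector of the wedge with q *)
  have [||||eps eps0 h] := @corner_flip _ O u e e' m (vsub q u) sp uO nb.
  - by rewrite cm; lra.
  - by rewrite cm cc add0r anti; lra.
  - by [].
  - by left; rewrite cm cc addr0.
  case: ns; split=> //; exists O, e', e; split; last by split; split=> //; apply: ltW.
  split=> //; first exact: corner_nbrsC.
    by rewrite /orient anti; lra.
  exists (Num.min eps 1); first by rewrite lt_min eps0 ltr01.
  move=> t /andP [t0]; rewrite lt_min => /andP [te t1].
  have [|b1 b2 par] := h t; first by rewrite t0 te.
  have -> : vadd (vsub e' u) (vsub e u) = m.
    by apply: pair_ext; rewrite /m /vadd /vsub /=; ring.
  apply: parity_interior b2 b1 _ _; first by rewrite par negbK.
  by apply: visible_ray_not_interior vq OS _; rewrite !ltW.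
have [||||eps eps0 h] := @corner_flip _ O u e e' (vsub p u) m sp uO nb.
- by rewrite mc; lra.
- by [].
- by rewrite mc cc add0r.
- by right; rewrite mc cc addr0 anti; lra.
case: ns; split=> //; exists O, e, e'; split; last by split; split=> //; apply: ltW.
split=> //.
exists (Num.min eps 1); first by rewrite lt_min eps0 ltr01.
move=> t /andP [t0]; rewrite lt_min => /andP [te t1].
have [|b1 b2 par] := h t; first by rewrite t0 te.
apply: parity_interior b1 b2 par _.
by apply: visible_ray_not_interior vp OS _; rewrite !ltW.
Qed.

Lemma corner_visible_link u p O (d : point R) e1 e2 :
  vis_edge V S u p -> O \in S -> u \in O -> corner_nbrs O u e1 e2 ->
  (forall e, e = e1 \/ e = e2 -> exists n,
    [/\ 0 < dot n d, 0 < dot n (vsub p u) & dot n (vsub e u) <= 0]) ->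
  exists2 eps : R, 0 < eps & forall t, 0 < t < eps -> ~ interior O (vadd u (vscale t d)).
Proof.
move=> vp OS uO nb sepn.
have [|n1 [a1 a2 a3]] := sepn e1; first by left.
have [|n2 [b1 b2 b3]] := sepn e2; first by right.
have [eps eps0 h] := corner_link (obstacle_simple OS) uO nb a1 a2 a3 b1 b2 b3.
exists (Num.min eps 1); first by rewrite lt_min eps0 ltr01.
move=> t /andP [t0]; rewrite lt_min => /andP [te t1] it.
have t01 : 0 <= t <= 1 by rewrite !ltW.
apply: (visible_ray_not_interior vp OS t01); apply: interior_seg it; apply: h.
  by rewrite t0 te.
by rewrite t0 te.
Qed.

Lemma wedge_link u O e1 e2 (d1 d2 : point R) : O \in S -> u \in O -> corner_nbrs O u e1 e2 ->
  0 < cross (vsub e1 u) d1 -> 0 < cross d1 (vsub e2 u) ->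
  0 < cross (vsub e1 u) d2 -> 0 < cross d2 (vsub e2 u) ->
  exists2 eps : R, 0 < eps & forall s t : R, 0 < s < eps -> 0 < t < eps -> forall x,
    on_seg (vadd u (vscale s d1)) (vadd u (vscale t d2)) x -> ~ on_boundary O x.
Proof.
move=> OS uO nb a1 b1 a2 b2.
pose n1 : point R := (- (vsub e1 u).2, (vsub e1 u).1).
pose n2 : point R := ((vsub e2 u).2, - (vsub e2 u).1).
have E1 (x : point R) : dot n1 x = cross (vsub e1 u) x by rewrite /dot /cross /n1 /=; ring.
have E2 (x : point R) : dot n2 x = cross x (vsub e2 u) by rewrite /dot /cross /n2 /=; ring.
by apply: (@corner_link _ O u e1 e2 d1 d2 n1 n2 (obstacle_simple OS) uO nb); rewrite ?E1 ?E2 //;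
  rewrite /cross mulrC subrr.
Qed.

(** A short segment links the ray along [d] to the visible ray towards [p] without touching the
    boundary, unless [p] is a neighbouring corner; likewise for [q]. If both are neighbouring
    corners, an interior point along [d] makes the bisector interior as well, and [p], [q] would be
    separated. *)
Lemma direction_not_interior u p q (d : point R) O : vis_edge V S u p -> vis_edge V S u q ->
  ~ separated u p q -> 0 < orient u p q -> 0 < cross (vsub p u) d -> 0 < cross d (vsub q u) ->
  O \in S ->
  exists2 eps : R, 0 < eps & forall t, 0 < t < eps -> ~ interior O (vadd u (vscale t d)).
Proof.
move=> vp vq ns o0 pd dq OS.
have sp := obstacle_simple OS.
have [uV [pV [up _]]] := vp; have [_ [qV [uq _]]] := vq.
have [uO|uO] := boolP (u \in O); last first.
  have [|eps eps0 box] := @near_avoids_edges _ O (fun k => True) u.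
    move=> k kO _ uk; case/negP: uO; apply: vertex_on_boundary => //; by exists k.
  have [t1 t10 nt1] := near_ray u d eps0.
  exists t1 => // t /andP [t0 tt1] it.
  have : ~ interior O u by apply: visible_not_interior vp OS (on_segl _ _).
  apply; apply: interior_seg it => x /on_segC xs [k kO xk].
  apply: (box k kO I x) xk; apply: near_convex xs; last exact: nt1 (ltW t0) tt1.
  by split; rewrite subrr normr0.
pose e1 := prev_corner O u; pose e2 := next_corner O u.
have nb : corner_nbrs O u e1 e2 by left.
have [_ e1V e2V [e1u e2u e12]] := corner_nbr_mem OS uO nb.
have nob e : e = e1 \/ e = e2 -> ~ (0 < orient u p e /\ 0 < orient u e q).
  case=> -> [h1 h2].
    exact: no_edge_between vp vq ns o0 OS uO nb h1 h2.
  exact: no_edge_between vp vq ns o0 OS uO (corner_nbrsC nb) h1 h2.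
have eV e : e = e1 \/ e = e2 -> e \in V /\ u <> e by case=> ->; split=> //; apply: nesym.
have [pn|/contrapT pe] := pselect (~ (p = e1 \/ p = e2)).
  apply: corner_visible_link vp OS uO nb _ => e ee; have [eV' ue] := eV e ee.
  have pe0 : orient u p e <> 0.
    by apply: orient_neq0 => // pe; apply: pn; rewrite pe.
  have [|n [n1 n2 n3]] := @wedge_separation _ (vsub p u) d (vsub e u) pd; last by exists n.
  case: (ltgtP (orient u p e) 0) => [lt|gt|//]; first by left.
  right; have := nob e ee; rewrite gt => /not_andP [//|/negP]; rewrite -leNgt => eq.
  (* Three-term Pluecker relation between the directions of [p], [q], [e] and [d]. *)
  have pl : orient u p q * cross (vsub e u) d =
     - (cross d (vsub q u) * orient u p e) + cross (vsub p u) d * orient u e q.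
    by rewrite /orient /cross; ring.
  have h1 : 0 < cross d (vsub q u) * orient u p e by rewrite mulr_gt0.
  have h2 : cross (vsub p u) d * orient u e q <= 0 by nra.
  by rewrite -(pmulr_rlt0 _ o0) pl; lra.
have [qn|/contrapT qe] := pselect (~ (q = e1 \/ q = e2)).
  apply: corner_visible_link vq OS uO nb _ => e ee; have [eV' ue] := eV e ee.
  have qe0 : orient u e q <> 0.
    by apply: orient_neq0 => // qe; apply: qn; rewrite -qe.
  have [|n [n1 n2 n3]] := @wedge_separation _ d (vsub q u) (vsub e u) dq; last by exists n.
  case: (ltgtP (orient u e q) 0) => [lt|gt|//]; first by right.
  left; have := nob e ee; rewrite gt => /not_andP [/negP|//]; rewrite -leNgt => pe'.
  have pl : orient u p q * cross d (vsub e u) =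
     cross d (vsub q u) * orient u p e - (cross (vsub p u) d * orient u e q).
    by rewrite /orient /cross; ring.
  have h1 : 0 < cross (vsub p u) d * orient u e q by rewrite mulr_gt0.
  have h2 : cross d (vsub q u) * orient u p e <= 0 by nra.
  by rewrite -(pmulr_rlt0 _ o0) pl; lra.
have npq : p <> q.
  by move=> h; move: o0; rewrite h /orient /cross mulrC subrr ltxx.
have {}nb : corner_nbrs O u p q.
  case: pe qe => pe [] qe; rewrite pe qe // in npq *.
  exact: corner_nbrsC.
pose m := vadd (vsub p u) (vsub q u).
have pm : cross (vsub p u) m = orient u p q by rewrite /orient /m /cross /vadd /vsub /=; ring.
have mq : cross m (vsub q u) = orient u p q by rewrite /orient /m /cross /vadd /vsub /=; ring.
have [||||eps eps0 h] := @wedge_link u O p q d m OS uO nb; rewrite ?pm ?mq //.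
exists eps => // t te it; apply: ns; split=> //; exists O, p, q; split; last first.
  split; split; rewrite ?(ltW o0) //; by rewrite /cross mulrC subrr.
split=> //; exists eps => // s se.
by apply: interior_seg it; apply: h.
Qed.

End Wedge.

(** * Triangles free of obstacles *)

Section Triangle.
Variable R : realType.
Variables (V : seq (point R)) (S : seq (seq (point R))).
Hypothesis VS : valid_setting V S.
Implicit Types (a b c d e n p q u v w x y z : point R) (P O : seq (point R)).

Definition in_tri u a b x : Prop :=
  exists r s : R, [/\ 0 < r, 0 < s, r + s < 1 & x = comb u a b r s].

Definition in_cltri u a b x : Prop :=
  exists r s : R, [/\ 0 <= r, 0 <= s, r + s <= 1 & x = comb u a b r s].

Definition free_tri u a b : Prop :=
  forall x, in_tri u a b x -> forall O, O \in S -> ~ on_boundary O x /\ ~ interior O x.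

Lemma ex_argmin (P : point R -> Prop) (f : point R -> R) :
  (exists2 x, x \in V & P x) ->
  exists x, [/\ x \in V, P x & forall y, y \in V -> P y -> f x <= f y].
Proof.
elim: V => [[] //|a s IH] ex.
have [exs|nex] := pselect (exists2 x, x \in s & P x); last first.
  case: ex => x; rewrite inE => /orP [/eqP -> Pa|xs Px]; last by case: nex; exists x.
  exists a; split=> //; first by rewrite inE eqxx.
  by move=> y; rewrite inE => /orP [/eqP -> //|ys Py]; case: nex; exists y.
have [x [xs Px xm]] := IH exs.
have [[Pa lt]|na] := pselect (P a /\ f a < f x).
  exists a; split=> //; first by rewrite inE eqxx.
  move=> y; rewrite inE => /orP [/eqP -> //|ys Py].
  by apply: le_trans (ltW lt) (xm y ys Py).
exists x; split=> //; first by rewrite inE xs orbT.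
move=> y; rewrite inE => /orP [/eqP -> Pa|]; last exact: xm.
by rewrite leNgt; apply/negP => lt; apply: na.
Qed.

Lemma comb_coords u a b x : orient u a b <> 0 ->
  x = comb u a b (orient u x b / orient u a b) (orient u a x / orient u a b).
Proof.
move=> /eqP o0; apply: pair_ext; apply: (mulIf o0).
  have -> : (comb u a b (orient u x b / orient u a b) (orient u a x / orient u a b)).1 =
     (u.1 * orient u a b + orient u x b * (a.1 - u.1) + orient u a x * (b.1 - u.1)) / orient u a b.
    by rewrite /comb /vadd /vscale /vsub /=; field.
  by rewrite divfK //; orient_ring.
have -> : (comb u a b (orient u x b / orient u a b) (orient u a x / orient u a b)).2 =
   (u.2 * orient u a b + orient u x b * (a.2 - u.2) + orient u a x * (b.2 - u.2)) / orient u a b.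
  by rewrite /comb /vadd /vscale /vsub /=; field.
by rewrite divfK //; orient_ring.
Qed.

Lemma comb_orient1 u a b (r s : R) : orient u (comb u a b r s) b = r * orient u a b.
Proof. rewrite /orient /comb /cross /vadd /vscale /vsub /=; ring. Qed.

Lemma comb_orient2 u a b (r s : R) : orient u a (comb u a b r s) = s * orient u a b.
Proof. rewrite /orient /comb /cross /vadd /vscale /vsub /=; ring. Qed.

Lemma comb_inj u a b (r s r' s' : R) : orient u a b <> 0 ->
  comb u a b r s = comb u a b r' s' -> r = r' /\ s = s'.
Proof.
move=> /eqP o0 e; split; apply: (mulIf o0); first by rewrite -!(comb_orient1 u a b _ s) e !comb_orient1.
by rewrite -!(comb_orient2 u a b r) e !comb_orient2.
Qed.

Lemma combC u a b (r s : R) : comb u a b r s = comb u b a s r.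
Proof. by point_ring. Qed.

Lemma comb_rot u a b (r s : R) : comb u a b r s = comb a u b (1 - r - s) s.
Proof. by point_ring. Qed.

Lemma in_triC u a b x : in_tri u a b x -> in_tri u b a x.
Proof. by case=> r [s [h1 h2 h3 ->]]; exists s, r; split; rewrite 1?addrC //; exact: combC. Qed.

Lemma in_tri_rot u a b x : in_tri u a b x -> in_tri a u b x.
Proof.
by case=> r [s [h1 h2 h3 ->]]; exists (1 - r - s), s; split; [lra|lra|lra|exact: comb_rot].
Qed.

Lemma free_triC u a b : free_tri u a b -> free_tri u b a.
Proof. by move=> h x /in_triC; apply: h. Qed.

Lemma free_tri_rot u a b : free_tri u a b -> free_tri a u b.
Proof. by move=> h x /in_tri_rot; apply: h. Qed.

Lemma on_seg_trans a b x y : on_seg a b y -> on_seg a y x -> on_seg a b x.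
Proof.
case=> t [/andP [t0 t1] ->] [r [/andP [r0 r1] ->]]; exists (r * t); split.
  by apply/andP; split; nra.
by point_ring.
Qed.

Lemma tri_exit_side u a b s y : orient u a b <> 0 -> in_tri u a b y ->
  (exists r1 r2 : R, [/\ s = comb u a b r1 r2, r1 + r2 < 1 & r1 <= 0 \/ r2 <= 0]) ->
  exists2 x, on_seg s y x & [\/ open_seg u a x, open_seg u b x | x = u].
Proof.
move=> o0 [r [q [r0 q0 rq ->]]] [r1 [r2 [-> lt1 neg]]].
(* Exit through the side [ud]: the first coordinate vanishes there, the second is [s2], and the last
   hypothesis says that [s2] is nonnegative. If both coordinates of the outer point are nonpositive,
   the sign of this expression decides which side is met. *)
have main : forall c d (r q r1 r2 : R), 0 < r -> 0 < q -> r + q < 1 -> r1 + r2 < 1 -> r1 <= 0 ->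
    0 <= r * r2 - q * r1 ->
    exists2 x, on_seg (comb u c d r1 r2) (comb u c d r q) x & (open_seg u d x \/ x = u).
  move=> c d {neg} {}r {}q {}r1 {}r2 {}r0 {}q0 {}rq {}lt1 neg1 h.
  have D0 : 0 < r - r1 by lra.
  have Dn : r - r1 != 0 by rewrite gt_eqF.
  pose s2 := (r * r2 - q * r1) / (r - r1).
  have s20 : 0 <= s2 by rewrite divr_ge0 // ltW.
  have s21 : s2 < 1 by rewrite ltr_pdivrMr //; nra.
  exists (vadd u (vscale s2 (vsub d u))).
    exists (- r1 / (r - r1)); split.
      by rewrite divr_ge0 ?ler_pdivrMr //; try lra; apply/andP; split=> //; lra.
    by apply: pair_ext; rewrite /s2 /comb /vadd /vscale /vsub /=; field.
  case: (ltgtP s2 0) => [|pos|->]; first by rewrite ltNge s20.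
    by left; exists s2; rewrite pos s21.
  by right; apply: pair_ext; rewrite /vadd /vscale /=; ring.
have [n1|p1] := leP r1 0; have [n2|p2] := leP r2 0.
- case: (leP 0 (r * r2 - q * r1)) => h.
    have [x xs] := main a b r q r1 r2 r0 q0 rq lt1 n1 h.
    by case=> ?; exists x => //; [constructor 2|constructor 3].
  have [||||x] := main b a q r r2 r1 q0 r0; [lra|lra|lra|lra|].
  by rewrite !(combC u b a) => xs [] ?; exists x => //; [constructor 1|constructor 3].
- have [|x xs] := main a b r q r1 r2 r0 q0 rq lt1 n1; first nra.
  by case=> ?; exists x => //; [constructor 2|constructor 3].
- have [||||x] := main b a q r r2 r1 q0 r0; [lra|lra|lra|nra|].
  by rewrite !(combC u b a) => xs [] ?; exists x => //; [constructor 1|constructor 3].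
- by case: neg; lra.
Qed.

(** The points with [r1 + r2 >= 1] form a half-plane disjoint from the open triangle. Hence one end
    of the segment is on the side of [u], and the exit towards that end is not through [ab]. *)
Lemma tri_exit u a b s t y : orient u a b <> 0 -> in_tri u a b y -> on_seg s t y ->
  ~ in_tri u a b s -> ~ in_tri u a b t ->
  exists2 x, on_seg s t x & [\/ open_seg u a x, open_seg u b x | x = u].
Proof.
move=> o0 yT ys ns nt.
have co x : ~ in_tri u a b x -> exists r1 r2 : R,
    x = comb u a b r1 r2 /\ (1 <= r1 + r2 \/ (r1 + r2 < 1 /\ (r1 <= 0 \/ r2 <= 0))).
  move=> nx.
  have [r1 [r2 xE]] : exists r1 r2 : R, x = comb u a b r1 r2.
    by exists (orient u x b / orient u a b), (orient u a x / orient u a b); apply: comb_coords.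
  exists r1, r2; split=> //.
  case: (leP 1 (r1 + r2)) => h; first by left.
  right; split=> //; case: (leP r1 0) => h1; first by left.
  by case: (leP r2 0) => h2; [right|case: nx; exists r1, r2].
have [s1 [s2 [sE [ss|[s3 s4]]]]] := co s ns; last first.
  have [|x xs h] := @tri_exit_side u a b s y o0 yT; first by exists s1, s2.
  by exists x => //; apply: on_seg_trans xs.
have [t1 [t2 [tE [tt|[t3 t4]]]]] := co t nt; last first.
  have [|x xs h] := @tri_exit_side u a b t y o0 yT; first by exists t1, t2.
  by exists x => //; apply: on_segC; apply: on_seg_trans xs; apply: on_segC.
case: yT => r [q [r0 q0 rq yE]]; case: ys => k [/andP [k0 k1] yE'].
have : comb u a b r q = comb u a b (s1 + k * (t1 - s1)) (s2 + k * (t2 - s2)).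
  by rewrite -yE yE' sE tE; point_ring.
by case/(comb_inj o0) => e1 e2; nra.
Qed.

Lemma in_tri_orient_neq0 u a b x : orient u a b <> 0 -> in_tri u a b x ->
  orient u a x <> 0 /\ orient u b x <> 0.
Proof.
move=> /eqP o0 [r [s [r0 s0 _ ->]]]; rewrite comb_orient2.
rewrite -[orient u b _]opprK -orient_swap comb_orient1.
by split=> /eqP; rewrite ?oppr_eq0 mulf_eq0 (negPf o0) orbF gt_eqF.
Qed.

Lemma edge_at_corner O k u : O \in S -> (k < size O)%N -> u \in V ->
  on_seg (pedge O k).1 (pedge O k).2 u ->
  exists e e', [/\ u \in O, corner_nbrs O u e e' &
    forall x, on_seg (pedge O k).1 (pedge O k).2 x -> on_seg u e x].
Proof.
move=> OS kO uV uk.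
have uO : u \in O by apply: (vertex_on_boundary VS) => //; exists k.
have [i [j [iO jO ij [ei ej] oth]]] := corner_edges (obstacle_simple VS OS) uO.
have [ki|ki] := pselect (k = i).
  exists (next_corner O u), (prev_corner O u); split=> //; first by right.
  by rewrite ki ei.
have [kj|kj] := pselect (k = j).
  exists (prev_corner O u), (next_corner O u); split=> //; first by left.
  by move=> x; rewrite kj ej => /on_segC.
by case: (oth k kO ki kj).
Qed.

(** An obstacle edge entering the triangle has no corner in it, so it leaves through [ua], [ub] or
    [u]. The sides lie on visible segments, which meet only edges along them, and an edge at [u] is
    excluded by [no_edge_between]. With no boundary inside, an interior point could be moved along
    its ray to the vicinity of [u], against [direction_not_interior]. *)
Lemma free_triangle u p q (s t : R) : vis_edge V S u p -> vis_edge V S u q ->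
  orient u p q <> 0 -> same_side S u p q -> 0 < s <= 1 -> 0 < t <= 1 ->
  let a := vadd u (vscale s (vsub p u)) in let b := vadd u (vscale t (vsub q u)) in
  (forall z, z \in V -> ~ in_tri u a b z) -> free_tri u a b.
Proof.
move=> vp vq o0 sm hs ht a b.
wlog pos : p q s t vp vq o0 sm hs ht @a @b / 0 < orient u p q.
  move=> th em; case: (ltgtP (orient u p q) 0) => [lt|gt|//]; last exact: th.
  apply: free_triC; apply: th => //; last by move=> z zV /in_triC; apply: em.
  - by rewrite orient_swap => /eqP; rewrite oppr_eq0 => /eqP.
  - exact: same_sideC.
  - by rewrite orient_swap oppr_gt0.
move=> em; case/andP: hs => s0 s1; case/andP: ht => t0 t1; case: sm => ns _.
have [uV [pV [up _]]] := vp; have [_ [qV [uq _]]] := vq.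
have oab : orient u a b = s * t * orient u p q.
  by rewrite /a /b; orient_ring.
have oabp : 0 < orient u a b by rewrite oab !mulr_gt0.
have oab0 : orient u a b <> 0 by move=> h; rewrite h ltxx in oabp.
have dirs x : in_tri u a b x -> 0 < orient u p x /\ 0 < orient u x q.
  case=> r [k [r0 k0 _ ->]]; split.
    have -> : orient u p (comb u a b r k) = k * t * orient u p q.
      by rewrite /comb /a /b; orient_ring.
    by rewrite !mulr_gt0.
  have -> : orient u (comb u a b r k) q = r * s * orient u p q.
    by rewrite /comb /a /b; orient_ring.
  by rewrite !mulr_gt0.
have sub (c v : point R) (k : R) x : 0 < k -> k <= 1 -> c = vadd u (vscale k (vsub v u)) ->
    open_seg u c x -> open_seg u v x.
  move=> k0 k1 -> [r [/andP [r0 r1] ->]]; exists (r * k); split.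
    by apply/andP; split; nra.
  by point_ring.
have nbd x O : in_tri u a b x -> O \in S -> ~ on_boundary O x.
  move=> xT OS [k kO xk]; have [px xq] := dirs x xT.
  have [sO tO _] := pedge_mem VS OS kO.
  have sV := obstacle_sub VS OS sO; have tV := obstacle_sub VS OS tO.
  have [w wk] := tri_exit oab0 xT xk (em _ sV) (em _ tV).
  case=> [wu|wu|wu].
  - have := visible_hits_edge VS vp (sub _ _ _ _ s0 s1 erefl wu) OS kO wk.
    have h : orient u p x = 0 -> False by move=> h; rewrite h ltxx in px.
    by case=> e; rewrite e /= in xk; apply: h; apply/on_seg_orient => //; apply: on_segC.
  - have := visible_hits_edge VS vq (sub _ _ _ _ t0 t1 erefl wu) OS kO wk.
    have h : orient u q x = 0 -> False by move=> h; rewrite orient_swap h oppr0 ltxx in xq.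
    by case=> e; rewrite e /= in xk; apply: h; apply/on_seg_orient => //; apply: on_segC.
  rewrite wu in wk; have [e [e' [uO nb ue]]] := edge_at_corner OS kO uV wk.
  have [r [/andP [r0 r1] xE]] := ue x xk.
  have rp : 0 < r.
    rewrite lt_neqAle r0 andbT; apply/eqP => re; move: px; rewrite xE -re.
    by rewrite /orient /cross /vadd /vscale /vsub /=; lra.
  apply: (no_edge_between VS vp vq ns pos OS uO nb).
    have : orient u p x = r * orient u p e.
      by rewrite xE; orient_ring.
    by move=> h; rewrite h pmulr_rgt0 in px.
  have : orient u x q = r * orient u e q.
    by rewrite xE; orient_ring.
  by move=> h; rewrite h pmulr_rgt0 in xq.
move=> x xT O OS; split; first exact: nbd.
have [px xq] := dirs x xT.
have [eps eps0 h] := direction_not_interior VS vp vq ns pos px xq OS.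
have [k [k0 ke k1]] := ex_lt2 eps0 (@ltr01 R).
move=> ix; apply: (h k); first by rewrite k0 ke.
apply: interior_seg ix => y [l [/andP [l0 l1] yE]]; apply: nbd => //.
case: xT => r [q' [r0 q0 rq xE]].
(* The position, as a multiple of [x - u], of the point that has gone the fraction [l] of the way
   from [x] to [u + k (x - u)]. *)
pose m := 1 - l * (1 - k).
have mk : k <= m by rewrite /m; nra.
have m1 : m <= 1 by rewrite /m; nra.
exists (m * r), (m * q'); split.
- by rewrite mulr_gt0 //; lra.
- by rewrite mulr_gt0 //; lra.
- nra.
by rewrite yE xE; apply: pair_ext; rewrite /m /comb /vadd /vscale /vsub /=; ring.
Qed.

(** An interior point is off the boundary, and the rest of the segment from it to the centroid is in
    the open triangle; interiority would be carried to the centroid. *)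
Lemma free_closed u a b x O : free_tri u a b -> in_cltri u a b x -> O \in S -> ~ interior O x.
Proof.
move=> fr [r [s [r0 s0 rs xE]]] OS ix.
have [nbx _] := ix.
pose c := comb u a b (1/3) (1/3).
have cT : in_tri u a b c by exists (1/3), (1/3); split; [lra|lra|lra|].
have [_ nic] := fr c cT O OS; apply: nic; apply: interior_seg ix => y [t [/andP [t0 t1] yE]].
have [te|tn] := eqVneq t 0.
  suff -> : y = x by [].
  by rewrite yE te; point_ring.
have tp : 0 < t by rewrite lt_neqAle eq_sym tn.
suff /fr /(_ O OS) [] : in_tri u a b y by [].
exists (r + t * (1/3 - r)), (s + t * (1/3 - s)); split; [nra|nra|nra|].
by rewrite yE xE /c; point_ring.
Qed.

Lemma free_tri_visible u p q : free_tri u p q -> p \in V -> q \in V -> p <> q -> vis_edge V S p q.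
Proof.
move=> fr pV qV pq; split=> //; split=> //; split=> // O OS x [t [/andP [t0 t1] xE]].
apply: (free_closed fr _ OS); exists (1 - t), t; split; [lra|lra|lra|].
by rewrite xE; point_ring.
Qed.

(** The bisector [m] of the obstacle wedge points strictly into the sector from [p] to [q], because
    [e1] and [e2] have different directions. A short step along [m] is then both in the free
    triangle and in the obstacle. *)
Lemma free_not_separated u p q (s t : R) : 0 < s -> 0 < t ->
  free_tri u (vadd u (vscale s (vsub p u))) (vadd u (vscale t (vsub q u))) ->
  ~ separated S u p q.
Proof.
move=> s0 t0 fr [o0 [O [e1 [e2 [[OS uO nb e12 [eps eps0 wi]] [[p1 q1] [p2 q2]]]]]]].
pose m := vadd (vsub e1 u) (vsub e2 u).
have pl : orient u p q * orient u e1 e2 =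
   cross (vsub p u) (vsub e1 u) * cross (vsub q u) (vsub e2 u)
     - cross (vsub p u) (vsub e2 u) * cross (vsub q u) (vsub e1 u).
  by rewrite /orient /cross; ring.
have plp : 0 < orient u p q * orient u e1 e2 by rewrite mulr_gt0.
have mq : 0 < cross m (vsub q u).
  have -> : cross m (vsub q u) = cross (vsub e1 u) (vsub q u) + cross (vsub e2 u) (vsub q u).
    by rewrite /cross /m /vadd /=; ring.
  rewrite lt_neqAle addr_ge0 // andbT eq_sym paddr_eq0 //; apply/negP => /andP [/eqP z1 /eqP z2].
  move: pl plp; have -> : cross (vsub q u) (vsub e2 u) = - cross (vsub e2 u) (vsub q u) by rewrite /cross; ring.
  have -> : cross (vsub q u) (vsub e1 u) = - cross (vsub e1 u) (vsub q u) by rewrite /cross; ring.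
  by rewrite z1 z2 oppr0 !mulr0 subr0 => ->; rewrite ltxx.
have pm : 0 < cross (vsub p u) m.
  have -> : cross (vsub p u) m = cross (vsub p u) (vsub e1 u) + cross (vsub p u) (vsub e2 u).
    by rewrite /cross /m /vadd /=; ring.
  rewrite lt_neqAle addr_ge0 // andbT eq_sym paddr_eq0 //; apply/negP => /andP [/eqP z1 /eqP z2].
  by move: pl plp; rewrite z1 z2 !mul0r subr0 => ->; rewrite ltxx.
pose K := orient u p q.
(* Cramer's rule: the coordinates of [m] in the basis [s (p - u)], [t (q - u)]. *)
pose r := cross m (vsub q u) / (s * K); pose k := cross (vsub p u) m / (t * K).
have r0 : 0 < r by rewrite divr_gt0 // mulr_gt0.
have k0 : 0 < k by rewrite divr_gt0 // mulr_gt0.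
have rk0 : 0 < r + k by rewrite addr_gt0.
have [l [l0 le l1]] := ex_lt2 eps0 (divr_gt0 (@ltr01 R) rk0).
have lrk : l * (r + k) < 1 by rewrite -ltr_pdivlMr.
suff /fr /(_ O OS) [_] : in_tri u (vadd u (vscale s (vsub p u))) (vadd u (vscale t (vsub q u)))
    (vadd u (vscale l m)).
  by apply; apply: wi; rewrite l0 le.
exists (l * r), (l * k); split; try by rewrite mulr_gt0.
  by rewrite -mulrDr.
have Kn : K != 0 by rewrite gt_eqF.
have sn : s != 0 by rewrite gt_eqF.
have tn : t != 0 by rewrite gt_eqF.
have rs : r * s = cross m (vsub q u) / K by rewrite /r; field; rewrite sn Kn.
have kt : k * t = cross (vsub p u) m / K by rewrite /k; field; rewrite tn Kn.
have mE : vadd (vscale (r * s) (vsub p u)) (vscale (k * t) (vsub q u)) = m.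
  rewrite rs kt; apply: pair_ext; apply: (mulIf Kn); rewrite /vadd /vscale /=.
    have -> : (cross m (vsub q u) / K * (vsub p u).1 + cross (vsub p u) m / K * (vsub q u).1) * K =
      cross m (vsub q u) * (vsub p u).1 + cross (vsub p u) m * (vsub q u).1 by field.
    by rewrite /K /orient /m /cross /vadd /vsub /=; ring.
  have -> : (cross m (vsub q u) / K * (vsub p u).2 + cross (vsub p u) m / K * (vsub q u).2) * K =
    cross m (vsub q u) * (vsub p u).2 + cross (vsub p u) m * (vsub q u).2 by field.
  by rewrite /K /orient /m /cross /vadd /vsub /=; ring.
by rewrite -mE; point_ring.
Qed.

Lemma free_same_side u p q (s t : R) : 0 < s -> 0 < t ->
  free_tri u (vadd u (vscale s (vsub p u))) (vadd u (vscale t (vsub q u))) ->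
  same_side S u p q.
Proof.
move=> s0 t0 fr; split; first exact: free_not_separated fr.
by apply: (free_not_separated t0 s0); apply: free_triC.
Qed.

Lemma vadd_vscale1 u p : vadd u (vscale 1 (vsub p u)) = p.
Proof. by point_ring. Qed.

Lemma free_same_side1 u p q : free_tri u p q -> same_side S u p q.
Proof. by move=> fr; apply: (@free_same_side u p q 1 1) => //; rewrite !vadd_vscale1. Qed.

Lemma empty_free u p q : vis_edge V S u p -> vis_edge V S u q ->
  orient u p q <> 0 -> same_side S u p q ->
  (forall z, z \in V -> ~ in_tri u p q z) -> free_tri u p q.
Proof.
move=> vp vq o0 sm em; have := @free_triangle u p q 1 1 vp vq o0 sm.
by rewrite !vadd_vscale1 ltr01 lexx => /(_ isT isT em).
Qed.

Lemma separated_sub u p q (r s : R) : 0 <= r -> 0 < s ->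
  separated S u p (comb u p q r s) -> separated S u p q.
Proof.
move=> r0 s0 [o0 [O [e1 [e2 [H [[p1 q1] [p2 q2]]]]]]].
have pq : 0 < orient u p q by move: o0; rewrite comb_orient2 pmulr_rgt0.
have ed e : 0 <= cross (vsub p u) (vsub e u) ->
    0 <= cross (vsub e u) (vsub (comb u p q r s) u) -> 0 <= cross (vsub e u) (vsub q u).
  move=> h1; have -> : cross (vsub e u) (vsub (comb u p q r s) u) =
     - (r * cross (vsub p u) (vsub e u)) + s * cross (vsub e u) (vsub q u).
    by rewrite /comb /cross /vsub /vadd /vscale /=; ring.
  move=> h2; rewrite -(pmulr_rge0 _ s0).
  have := mulr_ge0 r0 h1; lra.
by split=> //; exists O, e1, e2; split=> //; split; split=> //; apply: ed.
Qed.

Lemma separated_sub_rev u p q (r s : R) : 0 <= r -> 0 < s ->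
  separated S u (comb u p q r s) p -> separated S u q p.
Proof.
move=> r0 s0 [o0 [O [e1 [e2 [H [[p1 q1] [p2 q2]]]]]]].
have pq : 0 < orient u q p.
  by move: o0; rewrite orient_swap comb_orient2 -mulrN -orient_swap pmulr_rgt0.
have ed e : 0 <= cross (vsub e u) (vsub p u) ->
    0 <= cross (vsub (comb u p q r s) u) (vsub e u) -> 0 <= cross (vsub q u) (vsub e u).
  move=> h1; have -> : cross (vsub (comb u p q r s) u) (vsub e u) =
     - (r * cross (vsub e u) (vsub p u)) + s * cross (vsub q u) (vsub e u).
    by rewrite /comb /cross /vsub /vadd /vscale /=; ring.
  move=> h2; rewrite -(pmulr_rge0 _ s0).
  have := mulr_ge0 r0 h1; lra.
by split=> //; exists O, e1, e2; split=> //; split; split=> //; apply: ed.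
Qed.

Lemma same_side_sub u p q (r s : R) : 0 <= r -> 0 < s -> same_side S u p q ->
  same_side S u p (comb u p q r s).
Proof.
move=> r0 s0 [h1 h2]; split=> h; first exact: h1 (separated_sub r0 s0 h).
exact: h2 (separated_sub_rev r0 s0 h).
Qed.

(* The vertex wanted is the one closest to [u] in the direction orthogonal to [pq]. *)
Lemma tri_visible_vertex u p q z0 : vis_edge V S u p -> vis_edge V S u q ->
  orient u p q <> 0 -> same_side S u p q -> z0 \in V -> in_tri u p q z0 ->
  exists z, [/\ z \in V, in_tri u p q z, vis_edge V S u z, same_side S u p z & same_side S u q z].
Proof.
move=> vp vq o0 sm z0V z0T; have [uV _] := vp.
pose f z := (orient u z q + orient u p z) / orient u p q.
have on : orient u p q != 0 by apply/eqP.
have fE r s : f (comb u p q r s) = r + s.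
  by rewrite /f comb_orient1 comb_orient2 -mulrDl mulfK.
have [|z [zV zT zm]] := @ex_argmin (in_tri u p q) f; first by exists z0.
have [r [s [r0 s0 rs zE]]] := zT.
pose k := r + s.
have k0 : 0 < k by rewrite /k; lra.
have kn : r + s != 0 by rewrite gt_eqF.
have fr : free_tri u (vadd u (vscale k (vsub p u))) (vadd u (vscale k (vsub q u))).
  apply: free_triangle => //; try by rewrite k0 ltW.
  move=> w wV [r' [s' [r'0 s'0 rs' wE]]].
  have wE' : w = comb u p q (r' * k) (s' * k).
    by rewrite wE; point_ring.
  have wT : in_tri u p q w.
    exists (r' * k), (s' * k); split; rewrite ?mulr_gt0 // -mulrDl /k.
    by rewrite /k in k0 *; nra.
  have := zm w wV wT; rewrite zE wE' !fE -mulrDl -/k => h.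
  by nra.
have uz : u <> z.
  move=> e; have [h _] := in_tri_orient_neq0 o0 zT; apply: h.
  by rewrite -e; orient_ring.
exists z; split=> //.
- split=> //; split=> //; split=> // O OS x [t [/andP [t0 t1] xE]].
  apply: (free_closed fr _ OS); exists (t * r / k), (t * s / k); split.
  - by rewrite divr_ge0 ?mulr_ge0 // ltW.
  - by rewrite divr_ge0 ?mulr_ge0 // ltW.
  - by rewrite -mulrDl -mulrDr -/k mulfK.
  by rewrite xE zE; apply: pair_ext; rewrite /k /comb /vadd /vscale /vsub /=; field.
- by rewrite zE; apply: same_side_sub => //; apply: ltW.
- by rewrite zE combC; apply: same_side_sub => //; [apply: ltW|apply: same_sideC].
Qed.

Lemma ex_free_triangle u p (Q : point R -> Prop) : vis_edge V S u p ->
  (forall y, Q y -> [/\ vis_edge V S u y, same_side S u p y & orient u p y <> 0]) ->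
  (forall y z (r s : R), Q y -> 0 < r -> 0 < s -> r + s < 1 -> z = comb u p y r s ->
     vis_edge V S u z -> same_side S u p z -> Q z) ->
  (exists y, Q y) ->
  exists y, [/\ Q y, free_tri u p y & forall x, x \in V -> ~ in_tri u p y x].
Proof.
move=> vp vQ cQ [y0 Qy0].
have [|y [yV Qy ym]] := @ex_argmin Q (fun y => `|orient u p y|).
  by exists y0 => //; case: (vQ y0 Qy0) => -[_ []].
have [vy sy oy] := vQ y Qy.
have em x : x \in V -> ~ in_tri u p y x.
  move=> xV xT.
  have [z [zV [r [s [r0 s0 rs zE]]] vz sz _]] := tri_visible_vertex vp vy oy sy xV xT.
  have := ym z zV (cQ y z r s Qy r0 s0 rs zE vz sz).
  rewrite zE comb_orient2 normrM gtr0_norm //.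
  have : 0 < `|orient u p y| by rewrite normr_gt0; apply/eqP.
  by clear - r0 rs; nra.
by exists y; split=> //; apply: empty_free.
Qed.

End Triangle.

(** * Crossings of visible segments *)

Section Crossing.
Variable R : realType.
Variables (V : seq (point R)) (S : seq (seq (point R))).
Hypothesis VS : valid_setting V S.
Implicit Types (a b c d e n p q u v w x y z : point R) (P O : seq (point R)).

Lemma pmulr_neq0 (r s : R) : 0 < r -> s <> 0 -> r * s <> 0.
Proof. by move=> r0 /eqP s0; apply/eqP; rewrite mulf_neq0 // gt_eqF. Qed.

(* The vertex wanted is the one of the triangle [ucy] whose direction from [u] is
   closest to [uv]. *)
Lemma crossing_visible_vertex u v x y c (l m : R) : vis_edge V S u v -> vis_edge V S x y ->
  0 < l < 1 -> c = vadd u (vscale l (vsub v u)) ->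
  0 < m < 1 -> c = vadd x (vscale m (vsub y x)) -> orient u v y <> 0 ->
  exists z, [/\ z \in V, vis_edge V S u z, same_side S u v z &
    exists r s : R, [/\ 0 <= r, 0 < s, r + s <= 1 & z = comb u c y r s]].
Proof.
move=> vuv vxy /andP [l0 l1] cE /andP [m0 m1] cE' oy.
have [uV [vV [uv _]]] := vuv; have [xV [yV [xy _]]] := vxy.
have oc : orient u c y = l * orient u v y.
  by rewrite cE; orient_ring.
have oc0 : orient u c y <> 0 by rewrite oc; apply: pmulr_neq0.
have ocn : orient u c y != 0 by apply/eqP.
pose P z := exists r s : R, [/\ 0 <= r, 0 < s, r + s <= 1 & z = comb u c y r s].
(* In coordinates [s / (r + s)]: the fraction of the way from [c] to [y] at which the ray [uz] meets
   [cy]. *)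
pose f z := (orient u c z / orient u c y) / (orient u z y / orient u c y + orient u c z / orient u c y).
have fE r s : f (comb u c y r s) = s / (r + s).
  by rewrite /f comb_orient1 comb_orient2 !mulfK.
have [|z [zV [r [s [r0 s0 rs zE]]] zm]] := @ex_argmin _ V P f.
  exists y => //; exists 0, 1; split=> //; first by rewrite add0r.
  by point_ring.
pose k := r + s.
have k0 : 0 < k by rewrite /k; lra.
have kn : r + s != 0 by rewrite gt_eqF.
pose z' := vadd u (vscale (1 / k) (vsub z u)).
pose h := s / k.
have h0 : 0 < h by rewrite divr_gt0.
have h1 : h <= 1 by rewrite ler_pdivrMr // mul1r /k; lra.
have z'E : z' = vadd c (vscale h (vsub y c)).
  by rewrite /z' zE /h /k; apply: pair_ext; rewrite /comb /vadd /vscale /vsub /=; field.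
have em w : w \in V -> ~ in_tri c u z' w.
  move=> wV [a [b [a0 b0 ab wE]]].
  have wE' : w = comb u c y (1 - a - b * h) (b * h).
    by rewrite wE z'E; point_ring.
  have bh : b * h <= b by clear - b0 h1; nra.
  have bhp : 0 < b * h by rewrite mulr_gt0.
  have Pw : P w by exists (1 - a - b * h), (b * h); split=> //; clear - ab a0 b0 bh; lra.
  have := zm w wV Pw; rewrite zE wE' !fE -/k -/h addrNK => hm.
  have : b * h / (1 - a) < h by rewrite ltr_pdivrMr; clear - a0 b0 ab h0; nra.
  by rewrite ltNge hm.
have ouz : orient c u z' = - h * orient u c y.
  by rewrite z'E; orient_ring.
have ouz0 : orient c u z' <> 0.
  by rewrite ouz mulNr => /eqP; rewrite oppr_eq0 => /eqP; apply: pmulr_neq0.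
have ouv w : in_tri c u z' w -> orient u v w <> 0.
  case=> a [b [a0 b0 ab ->]].
  have -> : orient u v (comb c u z' a b) = b * h * orient u v y.
    by rewrite z'E cE /comb; orient_ring.
  by apply: pmulr_neq0 => //; rewrite mulr_gt0.
have oxy w : in_tri c u z' w -> orient x y w <> 0.
  case=> a [b [a0 b0 ab ->]].
  have -> : orient x y (comb c u z' a b) = a * (orient x y u - orient x y c).
    by rewrite z'E /comb /orient /cross; rewrite cE' /vadd /vscale /vsub /=; ring.
  have -> : orient x y c = 0.
    by rewrite cE'; orient_ring.
  have oyu : (1 - m) * orient x y u = orient u c y.
    by rewrite cE'; orient_ring.
  rewrite subr0; apply: pmulr_neq0 => // e.
  by move: oyu; rewrite e mulr0 => /esym.
have notuv O k' w : O \in S -> (k' < size O)%N -> on_seg (pedge O k').1 (pedge O k').2 w ->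
    orient u v w <> 0 -> forall c', open_seg u v c' -> ~ on_seg (pedge O k').1 (pedge O k').2 c'.
  move=> OS kO wk ow c' c'uv c'k.
  have := visible_hits_edge VS vuv c'uv OS kO c'k.
  by case=> e; rewrite e /= in wk; apply: ow; apply/on_seg_orient => //; apply: on_segC.
have notxy O k' w : O \in S -> (k' < size O)%N -> on_seg (pedge O k').1 (pedge O k').2 w ->
    orient x y w <> 0 -> forall c', open_seg x y c' -> ~ on_seg (pedge O k').1 (pedge O k').2 c'.
  move=> OS kO wk ow c' c'xy c'k.
  have := visible_hits_edge VS vxy c'xy OS kO c'k.
  by case=> e; rewrite e /= in wk; apply: ow; apply/on_seg_orient => //; apply: on_segC.
have cuv : open_seg u v c by exists l; rewrite l0 l1.
have nbd w O : in_tri c u z' w -> O \in S -> ~ on_boundary O w.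
  move=> wT OS [k' kO wk].
  have [sO tO _] := pedge_mem VS OS kO.
  have [g gk] := tri_exit ouz0 wT wk (em _ (obstacle_sub VS OS sO)) (em _ (obstacle_sub VS OS tO)).
  case=> [gu|gu|gu].
  - apply: (notuv O k' w OS kO wk (ouv w wT) g _ gk).
    case: gu => t [/andP [t0 t1] ->]; exists (l * (1 - t)); split.
      by clear - t0 t1 l0 l1; apply/andP; split; nra.
    by rewrite cE; point_ring.
  - apply: (notxy O k' w OS kO wk (oxy w wT) g _ gk).
    case: gu => t [/andP [t0 t1] ->]; exists (m + t * h * (1 - m)); split.
      have : 0 < t * h by rewrite mulr_gt0.
      have : t * h < 1 by clear - t0 t1 h0 h1; nra.
      by clear - m0 m1; move=> *; apply/andP; split; nra.
    by rewrite z'E cE'; point_ring.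
  by rewrite gu in gk; apply: (notuv O k' w OS kO wk (ouv w wT) c cuv gk).
(* Edges are kept out by minimality and by the visible segments carrying [cu] and [cz']. Interiors
   are excluded by moving to the midpoint [g] of [uc], which is not interior and lies on no
   boundary. *)
have fr : free_tri S c u z'.
  move=> w wT O OS; split; first exact: nbd.
  pose g := vadd u (vscale (l / 2) (vsub v u)).
  have guv : open_seg u v g by exists (l / 2); split=> //; clear - l0 l1; apply/andP; split; lra.
  have ng : ~ interior O g by apply: visible_not_interior vuv OS (open_on_seg guv).
  have nbg : ~ on_boundary O g.
    move=> [k' kO gk].
    have e1 := visible_hits_edge VS vuv guv OS kO gk.
    have ck : on_seg (pedge O k').1 (pedge O k').2 c.
      by case: e1 => ->; [|apply: on_segC]; apply: open_on_seg.
    have := visible_hits_edge VS vxy _ OS kO ck.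
    case; first by exists m; rewrite m0 m1.
      case: e1 => -> [e2 e3]; apply: oy; rewrite -e3; orient_ring.
    case: e1 => -> [e2 e3]; apply: oy; rewrite -e2; orient_ring.
  move=> iw; apply: ng; apply: interior_seg iw => j [t [/andP [t0 t1] jE]].
  have [te|tn] := eqVneq t 1.
    by suff -> : j = g by []; rewrite jE te vadd_vscale1.
  have tl : t < 1 by rewrite lt_neqAle tn.
  apply: nbd => //; case: wT => a [b [a0 b0 ab wE]].
  exists ((1 - t) * a + t / 2), ((1 - t) * b); split.
  - have := @mulr_gt0 R (1 - t) a; rewrite subr_gt0 tl a0 => /(_ isT isT); clear - t0; lra.
  - by rewrite mulr_gt0 // subr_gt0.
  - clear - t0 t1 tl a0 b0 ab; nra.
  by rewrite jE wE /g; apply: pair_ext; rewrite /comb cE /vadd /vscale /vsub /=; field; rewrite /k.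
have frz : free_tri S u (vadd u (vscale l (vsub v u))) (vadd u (vscale (1 / k) (vsub z u))).
  by rewrite -cE; exact: free_tri_rot fr.
have uz : u <> z.
  move=> e; have : orient u c z = s * orient u c y by rewrite zE comb_orient2.
  rewrite -e; have -> : orient u c u = 0 by orient_ring.
  by move/esym/eqP; rewrite mulf_eq0 (negPf ocn) gt_eqF.
exists z; split=> //.
- split=> //; split=> //; split=> // O OS g [t [/andP [t0 t1] gE]].
  apply: (free_closed fr _ OS); exists (1 - t * k), (t * k); split.
  - by rewrite subr_ge0 -[1]mulr1 ler_pM // ltW.
  - by rewrite mulr_ge0 // ltW.
  - lra.
  by rewrite gE /z'; apply: pair_ext; rewrite /k /comb /vadd /vscale /vsub /=; field.
- by apply: free_same_side frz => //; rewrite divr_gt0.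
- by exists r, s.
Qed.

End Crossing.

(** * Subcones and hexagonal coordinates *)

Section Subcone.
Variable R : realType.
Variables (V : seq (point R)) (S : seq (seq (point R))).
Hypothesis VS : valid_setting V S.
Implicit Types (a b c d e n p q u v w x y z : point R) (P O : seq (point R)).
Implicit Types (X : point R -> Prop).

Definition rot120 (b : point R) : point R :=
  (- (b.1 / 2) - Num.sqrt 3 / 2 * b.2, Num.sqrt 3 / 2 * b.1 - b.2 / 2).
Definition rot240 (b : point R) : point R :=
  (- (b.1 / 2) + Num.sqrt 3 / 2 * b.2, - (Num.sqrt 3 / 2 * b.1) - b.2 / 2).

Lemma sqrt3_sq : Num.sqrt 3 * Num.sqrt 3 = 3 :> R.
Proof. by rewrite -expr2 sqr_sqrtr // ler0n. Qed.

Lemma sqrt3_gt0 : 0 < Num.sqrt 3 :> R.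
Proof. by rewrite sqrtr_gt0 ltr0n. Qed.

(** Here [3 N = 4 F^2 - 4 G H], so squaring turns the angle condition into [F > 0] and [G H > 0]; as
    the sum is 0, both [G] and [H] are negative. *)
Lemma cone_signs (F G H N : R) : F + G + H = 0 -> N = 4 / 3 * (F ^+ 2 + F * G + G ^+ 2) ->
  (Num.sqrt 3 * Num.sqrt N < 2 * F) <-> (G < 0 /\ H < 0).
Proof.
move=> s0 NE; have N0 : 0 <= N by rewrite NE; nra.
rewrite -sqrtrM ?ler0n //.
have q0 : 0 <= Num.sqrt (3 * N) by exact: sqrtr_ge0.
have q2 : Num.sqrt (3 * N) * Num.sqrt (3 * N) = 4 * (F ^+ 2 + F * G + G ^+ 2).
  by rewrite -expr2 sqr_sqrtr ?NE; [field|nra].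
move: q0 q2; move: (Num.sqrt _) => q q0 q2; have HE : H = - F - G by lra.
rewrite HE; split=> [lt|[G0 H0]].
  have F0 : 0 < F by lra.
  have h : 4 * (F ^+ 2 + F * G + G ^+ 2) < 4 * F ^+ 2 by rewrite -q2; nra.
  have h2 : G * (F + G) < 0 by nra.
  by split; rewrite ltNge; apply/negP => ?; nra.
rewrite ltNge; apply/negP => le.
have F0 : 0 < F by lra.
have : 4 * F ^+ 2 <= q * q by nra.
by rewrite q2; nra.
Qed.

Lemma bis_unit j : dot (bis R j) (bis R j) = 1.
Proof.
have h : Num.sqrt 3 / 2 * (Num.sqrt 3 / 2) = 3 / 4 :> R by have := sqrt3_sq; nra.
by case: j => [|[|[|[|[|j]]]]]; rewrite /dot /bis /= ?mulrNN ?h; lra.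
Qed.

Lemma dot_bisE j (d : point R) : [/\ dot d (bis R j) + dot d (rot120 (bis R j)) + dot d (rot240 (bis R j)) = 0 &
  dot d d = 4 / 3 * (dot d (bis R j) ^+ 2 + dot d (bis R j) * dot d (rot120 (bis R j)) + dot d (rot120 (bis R j)) ^+ 2)].
Proof.
have := bis_unit j; have := sqrt3_sq; move: (bis R j) => b; rewrite /dot /rot120 /rot240 /=.
move: (Num.sqrt 3) => s; case: b d => b1 b2 [d1 d2] /= s3 b1u; split; first by field.
have -> : d1 * d1 + d2 * d2 = (d1 * d1 + d2 * d2) * (b1 * b1 + b2 * b2) by rewrite b1u mulr1.
have -> : s / 2 * b1 = s * (b1 / 2) by field.
have -> : s / 2 * b2 = s * (b2 / 2) by field.
have e : s ^+ 2 = 3 by rewrite expr2.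
transitivity (4 / 3 * (3 / 4 * (d1 * b1 + d2 * b2) ^+ 2 + s ^+ 2 / 4 * (d2 * b1 - d1 * b2) ^+ 2)).
  by rewrite e; field.
by field.
Qed.

Lemma in_coneE u j v : in_cone u j v <->
  dot (vsub v u) (rot120 (bis R j)) < 0 /\ dot (vsub v u) (rot240 (bis R j)) < 0.
Proof.
have [h1 h2] := dot_bisE j (vsub v u); rewrite /in_cone (cone_signs h1 h2).
split=> [[]//|h]; split=> // vu; case: h; rewrite vu /dot /vsub /= !subrr !mul0r addr0.
by rewrite ltxx.
Qed.

Lemma in_cone_proj u j v : in_cone u j v -> 0 < proj u j v.
Proof. by case=> _; have := sqrtr_ge0 (3 : R); have := sqrtr_ge0 (dot (vsub v u) (vsub v u)); rewrite /proj; nra. Qed.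

Lemma in_cone_comb u j p q (r s : R) : in_cone u j p -> in_cone u j q -> 0 <= r -> 0 <= s ->
  0 < r + s -> in_cone u j (comb u p q r s).
Proof.
move=> /in_coneE [a1 a2] /in_coneE [b1 b2] r0 s0 rs; apply/in_coneE.
have E (g : point R) : dot (vsub (comb u p q r s) u) g = r * dot (vsub p u) g + s * dot (vsub q u) g.
  by rewrite /comb /dot /vsub /vadd /vscale /=; ring.
rewrite !E; move: (dot _ _) (dot _ _) (dot _ _) (dot _ _) a1 b1 a2 b2 => A B C D a1 b1 a2 b2.
have [r1|r1] := eqVneq r 0.
  by rewrite r1 !mul0r !add0r; rewrite r1 add0r in rs; split; rewrite pmulr_rlt0.
have rp : 0 < r by rewrite lt_neqAle eq_sym r1.
by split; nra.
Qed.

Lemma in_cone_wedge u j p q e : in_cone u j p -> in_cone u j q -> 0 < orient u p q ->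
  e <> u -> in_wedge (vsub p u) (vsub q u) (vsub e u) -> in_cone u j e.
Proof.
move=> cp cq o0 eu [h1 h2].
have on : orient u p q <> 0 by move=> h; rewrite h ltxx in o0.
have [r [s [r0 s0 eE]]] : exists r s : R, [/\ 0 <= r, 0 <= s & e = comb u p q r s].
  exists (orient u e q / orient u p q), (orient u p e / orient u p q).
  by split; [apply: divr_ge0 => //; apply: ltW|apply: divr_ge0 => //; apply: ltW|apply: comb_coords].
rewrite eE; apply: in_cone_comb => //; rewrite lt_neqAle addr_ge0 // andbT eq_sym paddr_eq0 //.
apply/negP => /andP [/eqP rz /eqP sz]; apply: eu; rewrite eE rz sz.
by point_ring.
Qed.

(** [E] is the Pluecker relation with the bisector as fourth direction, and all projections on the
    bisector are positive. *)
Lemma in_cone_trans u j a b c : in_cone u j a -> in_cone u j b -> in_cone u j c ->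
  0 <= orient u a b -> 0 < orient u b c -> 0 < orient u a c.
Proof.
move=> /in_cone_proj pa /in_cone_proj pb /in_cone_proj pc ab bc.
have E : proj u j b * orient u a c = proj u j c * orient u a b + proj u j a * orient u b c.
  by rewrite /proj /orient /cross /dot /vsub /=; ring.
rewrite -(pmulr_rgt0 _ pb) E; have := mulr_gt0 pa bc; have := mulr_ge0 (ltW pc) ab; lra.
Qed.

Lemma in_cone_trans' u j a b c : in_cone u j a -> in_cone u j b -> in_cone u j c ->
  0 < orient u a b -> 0 <= orient u b c -> 0 < orient u a c.
Proof.
move=> /in_cone_proj pa /in_cone_proj pb /in_cone_proj pc ab bc.
have E : proj u j b * orient u a c = proj u j c * orient u a b + proj u j a * orient u b c.
  by rewrite /proj /orient /cross /dot /vsub /=; ring.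
rewrite -(pmulr_rgt0 _ pb) E; have := mulr_ge0 (ltW pa) bc; have := mulr_gt0 pc ab; lra.
Qed.

Lemma wedge_blocks u q O e1 e2 : O \in S -> u \in O -> corner_nbrs O u e1 e2 ->
  0 < orient u e1 e2 -> wedge_interior O u e1 e2 -> vis_edge V S u q ->
  0 < orient u e1 q -> 0 < orient u q e2 -> False.
Proof.
move=> OS uO nb o12 [eps1 eps10 wi] vq e1q qe2.
pose m := vadd (vsub e1 u) (vsub e2 u).
have e1m : cross (vsub e1 u) m = orient u e1 e2 by rewrite /orient /m /cross /vadd /vsub /=; ring.
have me2 : cross m (vsub e2 u) = orient u e1 e2 by rewrite /orient /m /cross /vadd /vsub /=; ring.
have [||||eps eps0 h] := wedge_link VS OS uO nb (d1 := m) (d2 := vsub q u); rewrite ?e1m ?me2 //.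
have [t2 [t20 t2e t2e1]] := ex_lt2 eps0 eps10.
have [t [t0 tt2 t1]] := ex_lt2 t20 (@ltr01 R).
have te := lt_trans tt2 t2e; have te1 := lt_trans tt2 t2e1.
apply: (@visible_ray_not_interior _ V S u q O t vq OS); first by rewrite !ltW.
have it : interior O (vadd u (vscale t m)) by apply: wi; rewrite t0 te1.
by apply: interior_seg it; apply: h; rewrite t0 te.
Qed.

(** Only one obstacle has [u] as a corner, and the orientation tells which of its two edges is [e1].
    The cones are allowed to differ: since [e1] lies in the split cone, this will show that a split
    adds only one subcone to the degree count. *)
Lemma splits_unique u j j' O O' e1 e2 e1' e2' :
  splits V S u j O e1 e2 -> splits V S u j' O' e1' e2' -> [/\ O' = O, e1' = e1 & e2' = e2].
Proof.
move=> [OS [uO [nb [o0 _]]]] [OS' [uO' [nb' [o0' _]]]].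
have eO := obstacle_unique VS OS' OS uO' uO; rewrite eO in nb' *.
have anti : orient u e2 e1 = - orient u e1 e2 by rewrite orient_swap.
case: nb nb' o0 o0' => -[-> ->] [] [-> ->] // o0 o0'; exfalso; move: o0 o0';
  by rewrite /cross; lra.
Qed.

Lemma separated_splits u j p q : in_cone u j p -> in_cone u j q -> vis_edge V S u p ->
  vis_edge V S u q -> separated S u p q ->
  exists O e1 e2, [/\ splits V S u j O e1 e2, in_wedge (vsub p u) (vsub q u) (vsub e1 u) &
    in_wedge (vsub p u) (vsub q u) (vsub e2 u)].
Proof.
move=> cp cq vp vq [o0 [O [e1 [e2 [[OS uO nb e12 wi] [w1 w2]]]]]].
have [_ e1V e2V [e1u e2u _]] := corner_nbr_mem VS OS uO nb.
exists O, e1, e2; split=> //; split=> //; split=> //; split=> //; split=> //.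
split; first exact: in_cone_wedge cp cq o0 e1u w1.
split; first exact: in_cone_wedge cp cq o0 e2u w2.
split=> //; split.
  by exists p; split=> //; split=> //; case: w1.
by exists q; split=> //; split=> //; case: w2.
Qed.

Lemma in_cone_collinear u j p q : in_cone u j p -> in_cone u j q -> p \in V -> q \in V -> u \in V ->
  orient u p q = 0 -> q = p.
Proof.
move=> cp cq pV qV uV o0; have up : u <> p by case: cp => /nesym.
case: (collinear_eq VS uV pV qV up o0) => // qu.
by case: cq => /(_ qu).
Qed.

Lemma subcone_in_cone u j X p : subcone V S u j X -> X p -> in_cone u j p.
Proof. by case=> [[O [e1 [e2 [_ [->|->]]]]] []|[_ ->]]. Qed.

Lemma subcone_not_separated u j X p q : subcone V S u j X -> X p -> X q ->
  vis_edge V S u p -> vis_edge V S u q -> ~ separated S u p q.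
Proof.
move=> sX Xp Xq vp vq sep.
have cp := subcone_in_cone sX Xp; have cq := subcone_in_cone sX Xq.
have [uV [pV _]] := vp; have [_ [qV _]] := vq.
have [O [e1 [e2 [sp [p1 q1] [p2 q2]]]]] := separated_splits cp cq vp vq sep.
have [OS [uO [nb [o12 [c1 [c2 _]]]]]] := sp.
have [_ e1V e2V _] := corner_nbr_mem VS OS uO nb.
case: sX => [[O' [e1' [e2' [sp' h]]]]|[h _]]; last by apply: h; exists O, e1, e2.
have [_ e1E e2E] := splits_unique sp sp'; rewrite e1E e2E in h.
have anti (d1 d2 : point R) : cross d2 d1 = - cross d1 d2 by rewrite /cross; ring.
case: h => XE; rewrite XE in Xp Xq.
  case: Xq => _; rewrite anti => h.
  have : q = e1.
    by apply: (in_cone_collinear c1 cq) => //; rewrite /orient; lra.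
  by move=> qe; move: q2; rewrite qe anti; lra.
case: Xp => _; rewrite anti => h.
have : e2 = p.
  by apply: (in_cone_collinear cp c2) => //; rewrite /orient; lra.
by move=> qe; move: p1; rewrite -qe anti; lra.
Qed.

Lemma subcone_same_side u j X p q : subcone V S u j X -> X p -> X q ->
  vis_edge V S u p -> vis_edge V S u q -> same_side S u p q.
Proof. by move=> sX Xp Xq vp vq; split; apply: (subcone_not_separated sX). Qed.

Lemma splits_sides u j O e1 e2 q : splits V S u j O e1 e2 -> in_cone u j q ->
  vis_edge V S u q -> cw_side u j e1 q \/ ccw_side u j e2 q.
Proof.
move=> [OS [uO [nb [o12 [c1 [c2 [wi _]]]]]]] cq vq.
have anti (d1 d2 : point R) : cross d2 d1 = - cross d1 d2 by rewrite /cross; ring.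
case: (leP 0 (cross (vsub q u) (vsub e1 u))) => h1; first by left.
case: (leP 0 (cross (vsub e2 u) (vsub q u))) => h2; first by right.
exfalso; apply: (wedge_blocks OS uO nb o12 wi vq).
  by rewrite /orient anti; lra.
by rewrite /orient anti; lra.
Qed.

(** If [q] were on the other side of the split, both obstacle edges would lie in the sector between
    [p] and [q], and the two would be separated. *)
Lemma subcone_closed u j X p q : subcone V S u j X -> X p -> in_cone u j q ->
  vis_edge V S u p -> vis_edge V S u q -> same_side S u p q -> X q.
Proof.
move=> sX Xp cq vp vq [ns1 ns2].
have cp := subcone_in_cone sX Xp.
case: sX => [[O [e1 [e2 [sp h]]]]|[_ ->//]].
have [OS [uO [nb [o12 [c1 [c2 [wi _]]]]]]] := sp.
have far a b : in_cone u j a -> in_cone u j b -> 0 <= cross (vsub a u) (vsub e1 u) ->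
    0 <= cross (vsub e2 u) (vsub b u) -> separated S u a b.
  move=> ca cb h1 h2.
  have h3 := in_cone_trans ca c1 c2 h1 o12.
  have h4 := in_cone_trans' c1 c2 cb o12 h2.
  split; first exact: in_cone_trans ca c1 cb h1 h4.
  exists O, e1, e2; split=> //; split; split=> //; exact: ltW.
have := splits_sides sp cq vq.
case: h => XE; rewrite XE in Xp *; case=> // -[_ h].
  by case: Xp => _ h'; case: ns1; apply: far.
by case: Xp => _ h'; case: ns2; apply: far.
Qed.

Lemma subcone_exists u j p : in_cone u j p -> vis_edge V S u p ->
  exists X, subcone V S u j X /\ X p.
Proof.
move=> cp vp.
have [[O [e1 [e2 sp]]]|nsp] := pselect (exists O e1 e2, splits V S u j O e1 e2); last first.
  by exists (in_cone u j); split=> //; right.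
case: (splits_sides sp cp vp) => h.
  by exists (cw_side u j e1); split=> //; left; exists O, e1, e2; split=> //; left.
by exists (ccw_side u j e2); split=> //; left; exists O, e1, e2; split=> //; right.
Qed.

(** Within one cone the classes of visible vertices are the subcones, which gives transitivity. *)
Lemma same_side_trans u j p q r : in_cone u j p -> in_cone u j q -> in_cone u j r ->
  vis_edge V S u p -> vis_edge V S u q -> vis_edge V S u r ->
  same_side S u p q -> same_side S u q r -> same_side S u p r.
Proof.
move=> cp cq cr vp vq vr pq qr.
have [X [sX Xq]] := subcone_exists cq vq.
apply: (subcone_same_side sX) => //.
  by apply: (subcone_closed sX Xq) => //; apply: same_sideC.
exact: (subcone_closed sX Xq).
Qed.

End Subcone.

(** * Hexagonal coordinates and frames *)

Section Frame.
Variable R : realType.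
Implicit Types (a b c d e n p q u v w x y z : point R) (F G H : point R -> R).

Definition hex j p : R := dot p (bis R j).

(* The odd permutations account for the mirror images of all later arguments. *)
Inductive frame : (point R -> R) -> (point R -> R) -> (point R -> R) -> Prop :=
| Frame024 : frame (hex 0) (hex 2) (hex 4)
| Frame042 : frame (hex 0) (hex 4) (hex 2)
| Frame204 : frame (hex 2) (hex 0) (hex 4)
| Frame240 : frame (hex 2) (hex 4) (hex 0)
| Frame402 : frame (hex 4) (hex 0) (hex 2)
| Frame420 : frame (hex 4) (hex 2) (hex 0).

Lemma frame_swap F G H : frame F G H -> frame F H G.
Proof. by case; constructor. Qed.

Lemma frame_flip F G H : frame F G H -> frame G F H.
Proof. by case; constructor. Qed.

Lemma frame_sum F G H p : frame F G H -> H p = - F p - G p.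
Proof. by case; rewrite /hex /dot /bis /=; field. Qed.

Lemma hex_comb j u a b (r s : R) :
  hex j (comb u a b r s) = hex j u + r * (hex j a - hex j u) + s * (hex j b - hex j u).
Proof. rewrite /hex /dot /comb /vadd /vscale /vsub /=; ring. Qed.

Lemma hex_ray j u a (r : R) : hex j (vadd u (vscale r (vsub a u))) = hex j u + r * (hex j a - hex j u).
Proof. rewrite /hex /dot /vadd /vscale /vsub /=; ring. Qed.

Lemma frame_comb F G H u a b (r s : R) : frame F G H ->
  [/\ F (comb u a b r s) = F u + r * (F a - F u) + s * (F b - F u),
      G (comb u a b r s) = G u + r * (G a - G u) + s * (G b - G u) &
      H (comb u a b r s) = H u + r * (H a - H u) + s * (H b - H u)].
Proof. by case; split; rewrite hex_comb. Qed.

Lemma frame_ray F G H u a (r : R) : frame F G H ->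
  [/\ F (vadd u (vscale r (vsub a u))) = F u + r * (F a - F u),
      G (vadd u (vscale r (vsub a u))) = G u + r * (G a - G u) &
      H (vadd u (vscale r (vsub a u))) = H u + r * (H a - H u)].
Proof. by case; split; rewrite hex_ray. Qed.

(** The orientation up to a nonzero factor depending on the frame. Its sign is kept by cyclic
    rotations of the frame and reversed by reflections. *)
Definition det F G u p q : R := (F p - F u) * (G q - G u) - (G p - G u) * (F q - F u).

Lemma frame_orient F G H : frame F G H ->
  exists2 k : R, k != 0 & forall u p q, orient u p q = k * det F G u p q.
Proof.
have s0 := sqrt3_gt0 R.
have sn : Num.sqrt 3 != 0 :> R by rewrite gt_eqF.
have kp : 2 / Num.sqrt 3 != 0 :> R by rewrite mulf_neq0 ?invr_eq0 ?pnatr_eq0.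
case; first [exists (2 / Num.sqrt 3); first by []; move=> u p q;
    by rewrite /det /hex /dot /bis /orient /cross /vsub /=; field
  |exists (- (2 / Num.sqrt 3)); first (by rewrite oppr_eq0); move=> u p q;
    by rewrite /det /hex /dot /bis /orient /cross /vsub /=; field].
Qed.

Lemma frame_dist F G H p q : frame F G H ->
  dist p q ^+ 2 = 4 / 3 * ((F q - F p) ^+ 2 + (F q - F p) * (G q - G p) + (G q - G p) ^+ 2).
Proof.
have s3 : Num.sqrt 3 ^+ 2 = 3 :> R by rewrite expr2 sqrt3_sq.
rewrite /dist sqr_sqrtr; last by rewrite /dot -!expr2 addr_ge0 // sqr_ge0.
rewrite /dot /vsub /=; case: p q => p1 p2 [q1 q2] /=.
suff E : (q1 - p1) * (q1 - p1) + (q2 - p2) * (q2 - p2) =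
  (Num.sqrt 3 ^+ 2 / 3) * (q1 - p1) ^+ 2 + (q2 - p2) ^+ 2.
  rewrite E; case; rewrite /hex /dot /bis /=; move: (Num.sqrt 3) s3 => s s3; by field.
by rewrite s3; field.
Qed.

Definition pcone F G H u v : Prop := [/\ F u < F v, G v < G u & H v < H u].

Lemma pcone_intro F G H u v : frame F G H -> G v < G u -> H v < H u -> pcone F G H u v.
Proof. by move=> fr g h; split=> //; have := frame_sum u fr; have := frame_sum v fr; lra. Qed.

Definition cone_index F G H j j' : Prop :=
  [/\ forall u v, in_cone u j v <-> pcone F G H u v,
      forall u v, in_cone u j' v <-> pcone F G H v u,
      forall u v, proj u j v = F v - F u &
      forall u v, proj u j' v = F u - F v].

Lemma rot_bis : [/\ rot120 (bis R 0) = bis R 2, rot240 (bis R 0) = bis R 4,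
  rot120 (bis R 2) = bis R 4, rot240 (bis R 2) = bis R 0 &
  rot120 (bis R 4) = bis R 0 /\ rot240 (bis R 4) = bis R 2].
Proof.
have h := sqrt3_sq R.
have e : Num.sqrt 3 / 2 * (Num.sqrt 3 / 2) = 3 / 4 :> R by nra.
by split; [| | | |split]; apply: pair_ext; rewrite /rot120 /rot240 /bis /= ?mulrN ?e; lra.
Qed.

Lemma hexB j u v : dot (vsub v u) (bis R j) = hex j v - hex j u.
Proof. rewrite /hex /dot /vsub /=; ring. Qed.

Lemma cone_index_even j j' k l : rot120 (bis R j) = bis R k -> rot240 (bis R j) = bis R l ->
  (forall p, hex l p = - hex j p - hex k p) -> bis R j' = vscale (-1) (bis R j) ->
  cone_index (hex j) (hex k) (hex l) j j'.
Proof.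
move=> e1 e2 sm ej; split.
- move=> u v; rewrite in_coneE e1 e2 !hexB; split=> [[h1 h2]|[h0 h1 h2]].
    by move: h2; rewrite !sm => h2; split; rewrite ?sm; lra.
  by split; lra.
- move=> u v; rewrite in_coneE.
  have r1 (d : point R) : dot d (rot120 (bis R j')) = - dot d (rot120 (bis R j)).
    by rewrite ej /rot120 /dot /vscale /=; field.
  have r2 (d : point R) : dot d (rot240 (bis R j')) = - dot d (rot240 (bis R j)).
    by rewrite ej /rot240 /dot /vscale /=; field.
  rewrite r1 r2 e1 e2 !hexB; split=> [[h1 h2]|[h0 h1 h2]].
    by move: h2; rewrite !sm => h2; split; rewrite ?sm; lra.
  by split; lra.
- by move=> u v; rewrite /proj hexB.
- move=> u v; rewrite /proj ej.
  have -> : dot (vsub v u) (vscale (-1) (bis R j)) = - dot (vsub v u) (bis R j).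
    by rewrite /dot /vscale /=; ring.
  by rewrite hexB opprB.
Qed.

Lemma cone_indexes : [/\ cone_index (hex 0) (hex 2) (hex 4) 0 3,
  cone_index (hex 2) (hex 4) (hex 0) 2 5 & cone_index (hex 4) (hex 0) (hex 2) 4 1].
Proof.
have [e1 e2 e3 e4 [e5 e6]] := rot_bis.
by split; apply: cone_index_even => //; try (move=> p; apply: frame_sum; constructor);
  apply: pair_ext; rewrite /vscale /bis /=; lra.
Qed.

Lemma pconeC F G H u v : pcone F G H u v <-> pcone F H G u v.
Proof. by split=> -[]. Qed.

Lemma cone_indexC F G H j j' : cone_index F G H j j' -> cone_index F H G j j'.
Proof. by case=> h1 h2 h3 h4; split=> // u v; rewrite ?h1 ?h2 pconeC. Qed.

Lemma frame_cones F G H : frame F G H ->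
  exists j j', [/\ positive_cone j, negative_cone j' & cone_index F G H j j'].
Proof.
have [h0 h2 h4] := cone_indexes.
case; [exists 0%N, 3%N|exists 0%N, 3%N|exists 2%N, 5%N|exists 2%N, 5%N|exists 4%N, 1%N|exists 4%N, 1%N];
  split=> //; by apply: cone_indexC.
Qed.

Lemma positive_cone_frame j : positive_cone j ->
  exists F G H, frame F G H /\ exists j', cone_index F G H j j'.
Proof.
have [h0 h2 h4] := cone_indexes.
case: j => [|[|[|[|[|[|j]]]]]] // _.
- by exists (hex 0), (hex 2), (hex 4); split; [constructor|exists 3%N].
- by exists (hex 2), (hex 4), (hex 0); split; [constructor|exists 5%N].
- by exists (hex 4), (hex 0), (hex 2); split; [constructor|exists 1%N].
Qed.

Lemma negative_cone_frame j' : negative_cone j' ->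
  exists F G H, frame F G H /\ exists j, cone_index F G H j j'.
Proof.
have [h0 h2 h4] := cone_indexes.
case: j' => [|[|[|[|[|[|j]]]]]] // _.
- by exists (hex 4), (hex 0), (hex 2); split; [constructor|exists 4%N].
- by exists (hex 0), (hex 2), (hex 4); split; [constructor|exists 0%N].
- by exists (hex 2), (hex 4), (hex 0); split; [constructor|exists 2%N].
Qed.

End Frame.

(** * Edges of [ginf] and canonical sequences in a frame *)

Section Canonical.
Variable R : realType.
Variables (V : seq (point R)) (S : seq (seq (point R))).
Hypothesis VS : valid_setting V S.
Implicit Types (a b c d e n p q u v w x y z : point R) (P O : seq (point R)).
Implicit Types (X : point R -> Prop) (F G H : point R -> R).

(** The level lines of the three projections are the parallels to the cone boundaries, and each
    carries at most one vertex. *)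
Lemma frame_neq F G H a b : frame F G H -> a \in V -> b \in V -> a <> b ->
  [/\ F a <> F b, G a <> G b & H a <> H b].
Proof.
move=> fr aV bV ab.
case: VS => _ [_ [_ [_ /(_ a b aV bV ab) [n0 [n1 n2]]]]]; move: n0 n1 n2; rewrite /vsub /= => n0 n1 n2.
have h0 : hex 0 a <> hex 0 b by rewrite /hex /dot /bis /= => h; apply: n0; lra.
have h2 : hex 2 a <> hex 2 b by rewrite /hex /dot /bis /= => h; apply: n2; lra.
have h4 : hex 4 a <> hex 4 b by rewrite /hex /dot /bis /= => h; apply: n1; lra.
by case: fr.
Qed.

(** Three nonzero differences with sum 0 cannot all have the same sign; the one opposed to the other
    two names the cone. *)
Lemma frame_cover u v : u \in V -> v \in V -> u <> v ->
  exists F G H, frame F G H /\ (pcone F G H u v \/ pcone F G H v u).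
Proof.
move=> uV vV uv; have [n0 n2 n4] := frame_neq (Frame024 R) uV vV uv.
have s1 := frame_sum u (Frame024 R); have s2 := frame_sum v (Frame024 R).
case: (ltgtP (hex 0 u) (hex 0 v)) => l0; last by case: n0.
  case: (ltgtP (hex 2 u) (hex 2 v)) => l2; last by case: n2.
    exists (hex 4), (hex 0), (hex 2); split; [constructor|right; split=> //; lra].
  case: (ltgtP (hex 4 u) (hex 4 v)) => l4; last by case: n4.
    exists (hex 2), (hex 0), (hex 4); split; [constructor|right; split=> //; lra].
  exists (hex 0), (hex 2), (hex 4); split; [constructor|left; split=> //; lra].
case: (ltgtP (hex 2 u) (hex 2 v)) => l2; last by case: n2.
  case: (ltgtP (hex 4 u) (hex 4 v)) => l4; last by case: n4.
    exists (hex 0), (hex 2), (hex 4); split; [constructor|right; split=> //; lra].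
  exists (hex 2), (hex 0), (hex 4); split; [constructor|left; split=> //; lra].
exists (hex 4), (hex 0), (hex 2); split; [constructor|left; split=> //; lra].
Qed.

(** An edge of [ginf] seen from the vertex that chooses it. With [same_side] in place of the
    subcone, no subcone has to be carried along. *)
Definition out_edge F G H u v : Prop :=
  [/\ vis_edge V S u v, pcone F G H u v &
   forall w, vis_edge V S u w -> pcone F G H u w -> same_side S u v w -> F v <= F w].

Lemma out_edgeC F G H u v : out_edge F G H u v -> out_edge F H G u v.
Proof. by case=> h1 h2 h3; split=> //; [rewrite -pconeC|move=> w vw /pconeC; apply: h3]. Qed.

Lemma same_side_ptrans F G H u p q r : frame F G H ->
  pcone F G H u p -> pcone F G H u q -> pcone F G H u r ->
  vis_edge V S u p -> vis_edge V S u q -> vis_edge V S u r ->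
  same_side S u p q -> same_side S u q r -> same_side S u p r.
Proof.
by move=> /frame_cones [j [j' [_ _ [h _ _ _]]]] /h cp /h cq /h cr; apply: (same_side_trans VS cp cq cr).
Qed.

Lemma same_side_ntrans F G H u p q r : frame F G H ->
  pcone F G H p u -> pcone F G H q u -> pcone F G H r u ->
  vis_edge V S u p -> vis_edge V S u q -> vis_edge V S u r ->
  same_side S u p q -> same_side S u q r -> same_side S u p r.
Proof.
by move=> /frame_cones [j [j' [_ _ [_ h _ _]]]] /h cp /h cq /h cr; apply: (same_side_trans VS cp cq cr).
Qed.

Lemma out_edge_exists F G H u w : frame F G H -> vis_edge V S u w -> pcone F G H u w ->
  exists v, [/\ out_edge F G H u v, same_side S u w v & F v <= F w].
Proof.
move=> fr vw pw.
have [|v [vV [vv pv sv] vm]] := @ex_argmin _ V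
    (fun v => [/\ vis_edge V S u v, pcone F G H u v & same_side S u w v]) F.
  by exists w; [case: vw => _ []|split=> //; apply: same_side_refl].
exists v; split=> //; last first.
  by apply: vm; [case: vw => _ []|split=> //; apply: same_side_refl].
split=> // x vx px sx; apply: vm; first by case: vx => _ [].
split=> //; exact: (same_side_ptrans fr pw pv px).
Qed.

Lemma out_edge_unique F G H u v v' : frame F G H -> out_edge F G H u v -> out_edge F G H u v' ->
  same_side S u v v' -> v = v'.
Proof.
move=> fr [vv pv vm] [vv' pv' vm'] sm; apply: contrapT => ne.
have [_ [vV _]] := vv; have [_ [vV' _]] := vv'.
have [nF _ _] := frame_neq fr vV vV' ne; apply: nF.
apply/eqP; rewrite eq_le vm // vm' //; exact: same_sideC.
Qed.

Lemma out_edge_frame F G H F' G' H' u v : frame F G H -> frame F' G' H' ->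
  pcone F G H u v -> out_edge F' G' H' u v -> out_edge F G H u v.
Proof.
move=> fr fr' p o; have [_ p' _] := o.
case: fr' o p' => o; case: fr p => -[p1 p2 p3] [q1 q2 q3]; first [exact: o|exact: out_edgeC|lra].
Qed.

Lemma out_edge_pos_neg F G H F' G' H' u v : frame F G H -> frame F' G' H' ->
  pcone F G H v u -> ~ out_edge F' G' H' u v.
Proof.
move=> fr fr' p [_ p' _]; have s1 := frame_sum u fr; have s2 := frame_sum v fr.
case: fr' p' fr p s1 s2 => -[q1 q2 q3]; case=> -[p1 p2 p3] s1 s2; lra.
Qed.

Lemma ginf_dirP u v : ginf_dir V S u v <-> exists F G H, frame F G H /\ out_edge F G H u v.
Proof.
split.
  move=> [uV [j [pj [X [sX [vv Xv vm]]]]]].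
  have [F [G [H [fr [j' [h1 h2 h3 h4]]]]]] := positive_cone_frame R pj.
  have cv := subcone_in_cone sX Xv.
  exists F, G, H; split=> //; split=> //; first exact/h1.
  move=> w vw /h1 cw sw; have := vm w vw (subcone_closed VS sX Xv cw vv vw sw).
  by rewrite !h3; lra.
move=> [F [G [H [fr [vv pv vm]]]]]; have [uV _] := vv.
have [j [j' [pj _ [h1 h2 h3 h4]]]] := frame_cones fr.
split=> //; exists j; split=> //; have [X [sX Xv]] := subcone_exists VS (iffRL (h1 u v) pv) vv.
exists X; split=> //; split=> // w vw Xw; rewrite !h3 lerB // vm //.
  by apply/h1; apply: subcone_in_cone sX Xw.
exact: subcone_same_side sX Xv Xw vv vw.
Qed.

Lemma ginf_neg F G H u v : frame F G H -> pcone F G H v u -> ginf V S u v -> out_edge F G H v u.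
Proof.
move=> fr p [] /ginf_dirP [F' [G' [H' [fr' o]]]].
  by case: (out_edge_pos_neg fr fr' p o).
exact: out_edge_frame fr fr' p o.
Qed.

Lemma out_edge_ginf F G H u v : frame F G H -> out_edge F G H v u -> ginf V S u v.
Proof. by move=> fr o; right; apply/ginf_dirP; exists F, G, H. Qed.

(** The open sector is written with positive coefficients instead of orientations. Unlike
    [canon_consec], this form can be exchanged in [v] and [w] and is unaffected by reflections of
    the frame. *)
Definition consecutive F G H u v w : Prop :=
  [/\ out_edge F G H v u, out_edge F G H w u, same_side S u v w, v <> w &
   forall z, out_edge F G H z u -> same_side S u v z ->
     forall r s : R, 0 < r -> 0 < s -> z <> comb u v w r s].

Lemma consecutiveC F G H u v w : frame F G H -> consecutive F G H u v w -> consecutive F G H u w v.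
Proof.
move=> fr [ov ow sm ne h]; split=> //; [exact: same_sideC|exact: nesym|].
move=> z oz sz r s r0 s0 zE; apply: (h z oz _ s r) => //; last by rewrite combC.
have [vv pv _] := ov; have [vw pw _] := ow; have [vz pz _] := oz.
exact: (same_side_ntrans fr pv pw pz (vis_edgeC vv) (vis_edgeC vw) (vis_edgeC vz)).
Qed.

Lemma consecutive_swap F G H u v w : consecutive F G H u v w -> consecutive F H G u v w.
Proof.
move=> [ov ow sm ne h]; split=> //; try exact: out_edgeC.
by move=> z /out_edgeC; apply: h.
Qed.

Lemma canon_consec_consecutive F G H j j' u X v w : frame F G H -> cone_index F G H j j' ->
  subcone V S u j' X -> canon_consec V S u X v w -> consecutive F G H u v w.
Proof.
move=> fr [h1 h2 h3 h4] sX [[gv Xv gw Xw o0] nob].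
have pX z : X z -> pcone F G H z u by move=> Xz; apply/h2; apply: subcone_in_cone sX Xz.
have ov := ginf_neg fr (pX v Xv) gv; have ow := ginf_neg fr (pX w Xw) gw.
have [vv _ _] := ov; have [vw _ _] := ow.
split=> //.
- exact: subcone_same_side sX Xv Xw (vis_edgeC vv) (vis_edgeC vw).
- by move=> e; move: o0; rewrite e /cross mulrC subrr ltxx.
move=> z oz sz r s r0 s0 zE; have [vz pz _] := oz.
have Xz : X z.
  by apply: (subcone_closed VS sX Xv) => //; [apply/h2|apply: vis_edgeC|apply: vis_edgeC].
apply: (nob z (out_edge_ginf fr oz) Xz).
have := comb_orient1 u v w r s; have := comb_orient2 u v w r s; rewrite -zE /orient => -> ->.
by split; apply: mulr_gt0.
Qed.

Lemma consecutive_g10 F G H u v w : frame F G H -> consecutive F G H u v w -> g10 V S v w.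
Proof.
move=> fr; have [j [j' [_ nj [h1 h2 h3 h4]]]] := frame_cones fr.
have main v' w' : consecutive F G H u v' w' -> 0 < orient u v' w' -> g10_edge V S v' w'.
  move=> [ov ow sm ne nob] o0; have [vv pv _] := ov; have [vw pw _] := ow.
  have [_ [uV _]] := vv.
  have [X [sX Xv]] := subcone_exists VS (iffRL (h2 u v') pv) (vis_edgeC vv).
  have Xw : X w'.
    by apply: (subcone_closed VS sX Xv) => //; [apply/h2|apply: vis_edgeC|apply: vis_edgeC].
  exists u; split=> //; exists j'; split=> //; exists X; split=> //; right; split.
    by split=> //; apply: (out_edge_ginf fr).
  move=> z gz Xz [z1 z2].
  have pz : pcone F G H z u by apply/h2; apply: subcone_in_cone sX Xz.
  have oz := ginf_neg fr pz gz; have [vz _ _] := oz.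
  have sz : same_side S u v' z := subcone_same_side VS sX Xv Xz (vis_edgeC vv) (vis_edgeC vz).
  apply: (nob z oz sz (orient u z w' / orient u v' w') (orient u v' z / orient u v' w')).
  - exact: divr_gt0.
  - exact: divr_gt0.
  by apply: comb_coords => h; rewrite h ltxx in o0.
move=> co; have [ov ow _ ne _] := co; have [vv pv _] := ov; have [vw pw _] := ow.
have [vV [uV [vu _]]] := vv; have [wV [_ [wu _]]] := vw.
have on : orient u v w <> 0 by apply: (orient_neq0 VS) => //; apply: nesym.
case: (ltgtP (orient u v w) 0) => [lt|gt|//].
  right; apply: main; first exact: consecutiveC.
  by rewrite orient_swap oppr_gt0.
by left; apply: main.
Qed.

Lemma closest_edge F G H u v : frame F G H -> out_edge F G H v u ->
  exists c, [/\ g10 V S u c, out_edge F G H c u, same_side S u v c &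
    forall w, out_edge F G H w u -> same_side S u v w -> F w <= F c].
Proof.
move=> fr ov; have [vv pv _] := ov; have [vV [uV _]] := vv.
have [j [j' [_ nj [h1 h2 h3 h4]]]] := frame_cones fr.
have [|c [cV [oc sc] cm]] := @ex_argmin _ V
    (fun w => out_edge F G H w u /\ same_side S u v w) (fun w => - F w).
  by exists v => //; split=> //; apply: same_side_refl.
have cm' w : out_edge F G H w u -> same_side S u v w -> F w <= F c.
  by move=> ow sw; rewrite -lerN2; apply: cm => //; case: ow => -[].
exists c; split=> //.
have [X [sX Xv]] := subcone_exists VS (iffRL (h2 u v) pv) (vis_edgeC vv).
have [vc pc _] := oc.
have Xc : X c.
  by apply: (subcone_closed VS sX Xv) => //; [apply/h2|apply: vis_edgeC|apply: vis_edgeC].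
left; exists u; split=> //; exists j'; split=> //; exists X; split=> //; left; split=> //.
split=> //; first exact: out_edge_ginf fr oc.
move=> w gw Xw; rewrite !h4 lerB //.
have pw : pcone F G H w u by apply/h2; apply: subcone_in_cone sX Xw.
have ow := ginf_neg fr pw gw; have [vw _ _] := ow.
by apply: cm' => //; apply: (subcone_same_side VS sX) => //; apply: vis_edgeC.
Qed.

End Canonical.

(** * Planarity and canonical paths *)

Section Planarity.
Variable R : realType.
Variables (V : seq (point R)) (S : seq (seq (point R))).
Hypothesis VS : valid_setting V S.
Implicit Types (a b c d e n p q u v w x y z : point R) (P O : seq (point R)).
Implicit Types (X : point R -> Prop) (F G H : point R -> R).
Notation out := (out_edge V S).
Notation vis := (vis_edge V S).
Notation same := (same_side S).

Lemma pcone_comb F G H u a b (r s : R) : frame F G H -> pcone F G H u a -> pcone F G H u b ->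
  0 <= r -> 0 < s -> pcone F G H u (comb u a b r s).
Proof.
move=> fr [a1 a2 a3] [b1 b2 b3] r0 s0; have [e1 e2 e3] := frame_comb u a b r s fr.
by rewrite /pcone e1 e2 e3; split; nra.
Qed.

Lemma pcone_comb_neg F G H u a b (r s : R) : frame F G H -> pcone F G H a u -> pcone F G H b u ->
  0 <= r -> 0 < s -> pcone F G H (comb u a b r s) u.
Proof.
move=> fr [a1 a2 a3] [b1 b2 b3] r0 s0; have [e1 e2 e3] := frame_comb u a b r s fr.
by rewrite /pcone e1 e2 e3; split; nra.
Qed.

Lemma out_edge_not_crossed F G H u v x y c (l m : R) : frame F G H -> out F G H u v -> vis x y ->
  0 < l < 1 -> c = vadd u (vscale l (vsub v u)) ->
  0 < m < 1 -> c = vadd x (vscale m (vsub y x)) -> orient u v y <> 0 ->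
  pcone F G H u y -> F y < F v -> False.
Proof.
move=> fr [vv pv vm] vxy l01 cE m01 cE' oy py Fy.
have [z [zV vz sz [r [s [r0 s0 rs zE]]]]] := crossing_visible_vertex VS vv vxy l01 cE m01 cE' oy.
have pc : pcone F G H u c.
  have [e1 e2 e3] := frame_ray u v l fr; rewrite cE /pcone e1 e2 e3.
  by case: pv => h1 h2 h3; case/andP: l01 => ? ?; split; nra.
have pz : pcone F G H u z by rewrite zE; apply: pcone_comb.
have := vm z vz pz sz; have [e1 _ _] := frame_comb u c y r s fr; rewrite zE e1.
have [e2 _ _] := frame_ray u v l fr; rewrite -cE in e2; rewrite e2.
case: pv => h1 _ _; case/andP: l01 => l0 l1.
have h : l * (F v - F u) <= F v - F u by nra.
have h2 : r * (l * (F v - F u)) <= r * (F v - F u) by rewrite ler_wpM2l.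
have h3 : s * (F y - F u) < s * (F v - F u) by rewrite ltr_pM2l // ltrD2r.
have h4 : (r + s) * (F v - F u) <= F v - F u by nra.
lra.
Qed.

Lemma open_segC a b x : open_seg a b x -> open_seg b a x.
Proof.
case=> t [/andP [t0 t1] ->]; exists (1 - t); split; first by apply/andP; split; lra.
by point_ring.
Qed.

Lemma open_seg_shared u v y c : u \in V -> v \in V -> y \in V -> u <> v -> u <> y ->
  open_seg u v c -> open_seg u y c -> v = y.
Proof.
move=> uV vV yV uv uy /open_on_seg/on_seg_orient o0 [m [/andP [m0 m1] cE]].
have oy : m * orient u v y = 0.
  by rewrite -o0 cE; orient_ring.
have {}oy : orient u v y = 0 by apply/eqP; move/eqP: oy; rewrite mulf_eq0 gt_eqF.
by case: (collinear_eq VS uV vV yV uv oy) => // yu; case: uy.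
Qed.

Lemma crossing_distinct u v x y c : vis u v -> vis x y -> open_seg u v c -> open_seg x y c ->
  ~ ((u = x /\ v = y) \/ (u = y /\ v = x)) -> [/\ u <> x, u <> y, v <> x & v <> y].
Proof.
move=> [uV [vV [uv _]]] [xV [yV [xy _]]] cu cx ns.
split=> e; apply: ns.
- left; split=> //; rewrite -e in cx xy; exact: (open_seg_shared uV vV yV uv xy cu cx).
- right; split=> //; rewrite -e in cx xy yV; apply: (open_seg_shared uV vV xV uv (nesym xy) cu).
  exact: open_segC.
- right; split=> //; rewrite -e in cx xy xV; apply: (open_seg_shared vV uV yV (nesym uv) xy _ cx).
  exact: open_segC.
- left; split=> //; rewrite -e in cx xy yV.
  exact: (open_seg_shared vV uV xV (nesym uv) (nesym xy) (open_segC cu) (open_segC cx)).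
Qed.

(** Let [y] be the lower target. It lies in the cone of [c], and [c] in the cone of [u], so [y] is
    in the cone of [u] below [v]. *)
Lemma out_edges_plane_same F G H u v x y c : frame F G H -> out F G H u v -> out F G H x y ->
  open_seg u v c -> open_seg x y c -> ~ ((u = x /\ v = y) \/ (u = y /\ v = x)) -> False.
Proof.
move=> fr; wlog lt : u v x y / F y < F v => [th|] ou ox cu cx ns.
  have [vu _ _] := ou; have [vx _ _] := ox.
  have [ux uy vx' vy] := crossing_distinct vu vx cu cx ns.
  have [_ [vV _]] := vu; have [_ [yV _]] := vx.
  have [nF _ _] := frame_neq VS fr vV yV vy.
  case: (ltgtP (F v) (F y)) => h; [|exact: th cu cx ns|by case: nF].
  apply: (th x y u v h ox ou cx cu) => -[[e1 e2]|[e1 e2]]; first by case: ux.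
  by case: uy.
have [vu pu _] := ou; have [vx px _] := ox.
have [ux uy vx' vy] := crossing_distinct vu vx cu cx ns.
have [uV [vV [uv _]]] := vu; have [_ [yV _]] := vx.
have [l [l01 cE]] := cu; have [m [m01 cE']] := cx.
apply: (out_edge_not_crossed fr ou vx l01 cE m01 cE' _ _ lt).
  exact: (orient_neq0 VS).
have [a1 a2 a3] := frame_ray u v l fr; have [b1 b2 b3] := frame_ray x y m fr.
rewrite -cE in a1 a2 a3; rewrite -cE' in b1 b2 b3.
case: pu => p1 p2 p3; case: px => q1 q2 q3.
case/andP: l01 => l0 l1; case/andP: m01 => m0 m1.
apply: pcone_intro fr _ _; [clear - a2 b2 p2 q2 l0 l1 m0 m1|clear - a3 b3 p3 q3 l0 l1 m0 m1]; nra.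
Qed.

(** Some end of one edge lies in the cone of the other's source, below its target. The ends [y],
    [v], [x], [u] are tried in this order, and the failed comparisons supply the inequalities for
    the later ones. *)
Lemma out_edges_plane_diff F G H u v x y c : frame F G H -> out F G H u v -> out G F H x y ->
  open_seg u v c -> open_seg x y c -> ~ ((u = x /\ v = y) \/ (u = y /\ v = x)) -> False.
Proof.
move=> fr ou ox cu cx ns.
have [vu [p1 p2 p3] _] := ou; have [vx [q1 q2 q3] _] := ox.
have [ux uy vx' vy] := crossing_distinct vu vx cu cx ns.
have [uV [vV [uv _]]] := vu; have [xV [yV [xy _]]] := vx.
have [l [l01 cE]] := cu; have [m [m01 cE']] := cx.
have [a1 a2 a3] := frame_ray u v l fr; have [b1 b2 b3] := frame_ray x y m fr.
rewrite -cE in a1 a2 a3; rewrite -cE' in b1 b2 b3.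
have [l0 l1] := andP l01; have [m0 m1] := andP m01.
have [F1 F2] : F u < F c /\ F c < F v by clear - a1 l0 l1 p1; split; nra.
have [G1 G2] : G c < G u /\ G v < G c by clear - a2 l0 l1 p2; split; nra.
have [H1 H2] : H c < H u /\ H v < H c by clear - a3 l0 l1 p3; split; nra.
have [F3 F4] : F c < F x /\ F y < F c by clear - b1 m0 m1 q2; split; nra.
have [G3 G4] : G x < G c /\ G c < G y by clear - b2 m0 m1 q1; split; nra.
have [H3 H4] : H c < H x /\ H y < H c by clear - b3 m0 m1 q3; split; nra.
have fr' := frame_flip fr.
have l01' : 0 < 1 - l < 1 by clear - l0 l1; apply/andP; split; lra.
have m01' : 0 < 1 - m < 1 by clear - m0 m1; apply/andP; split; lra.
have cEr : c = vadd v (vscale (1 - l) (vsub u v)).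
  by rewrite cE; point_ring.
have cEr' : c = vadd y (vscale (1 - m) (vsub x y)).
  by rewrite cE'; point_ring.
have [_ nGuy _] := frame_neq VS fr uV yV uy.
have [nFvx _ _] := frame_neq VS fr vV xV vx'.
have [_ _ nHux] := frame_neq VS fr uV xV ux.
case: (lt_or_gt nGuy) => g; last first.
  apply: (out_edge_not_crossed fr ou vx l01 cE m01 cE'); first exact: (orient_neq0 VS).
    exact: pcone_intro fr g (lt_trans H4 H1).
  exact: lt_trans F4 F2.
case: (lt_or_gt nFvx) => f.
  apply: (out_edge_not_crossed fr' ox vu m01 cE' l01 cE).
  - by apply: (orient_neq0 VS) => //; apply: nesym.
  - exact: pcone_intro fr' f (lt_trans H2 H3).
  - exact: lt_trans G2 G4.
case: (lt_or_gt nHux) => h; last first.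
  apply: (out_edge_not_crossed fr ou (vis_edgeC vx) l01 cE m01' cEr'); first exact: (orient_neq0 VS).
    exact: pcone_intro fr (lt_trans G3 G1) h.
  exact: f.
apply: (out_edge_not_crossed fr' ox (vis_edgeC vu) m01 cE' l01' cEr).
- by apply: (orient_neq0 VS) => //; apply: nesym.
- exact: pcone_intro fr' (lt_trans F1 F3) h.
- exact: g.
Qed.

Lemma out_edge_cases F G H F' G' H' u v : frame F G H -> frame F' G' H' -> out F' G' H' u v ->
  [\/ out F G H u v, out G F H u v | out H F G u v].
Proof.
move=> fr fr'; case: fr' => o; case: fr;
 by first [constructor 1; first [exact: o|exact: out_edgeC]
          |constructor 2; first [exact: o|exact: out_edgeC]
          |constructor 3; first [exact: o|exact: out_edgeC]].
Qed.

Lemma out_edges_plane F G H F' G' H' u v x y c : frame F G H -> frame F' G' H' ->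
  out F G H u v -> out F' G' H' x y ->
  open_seg u v c -> open_seg x y c -> (u = x /\ v = y) \/ (u = y /\ v = x).
Proof.
move=> fr fr' ou ox cu cx; apply: contrapT => ns.
case: (out_edge_cases fr fr' ox) => o.
- exact: out_edges_plane_same fr ou o cu cx ns.
- exact: out_edges_plane_diff fr ou o cu cx ns.
- exact: out_edges_plane_diff (frame_swap fr) (out_edgeC ou) o cu cx ns.
Qed.

(** Otherwise take a vertex [y] of the closed triangle [uvw], visible from [u], such that [u w y] is
    free. Then [w] sees [y] in the subcone of [u], and [y] is closer than [u], which [w] chose. *)
Lemma in_neighbors_incomparable F G H u v w : frame F G H -> out F G H v u -> out F G H w u ->
  same u v w -> ~ pcone F G H w v.
Proof.
move=> fr ov ow sm pwv.
have [vv pv _] := ov; have [vw pw wm] := ow.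
have [vV [uV [vu _]]] := vv; have [wV [_ [wu _]]] := vw.
have wv : w <> v by case: pwv => h _ _ e; rewrite e ltxx in h.
have o0 : orient u v w <> 0 by apply: (orient_neq0 VS) => //; apply: nesym.
have [||||y [[vy sy [r [s [r0 s0 rs yE]]]] fr_y _]] := @ex_free_triangle _ V S VS u w
    (fun y => [/\ vis u y, same u w y &
       exists r s : R, [/\ 0 < r, 0 <= s, r + s <= 1 & y = comb u v w r s]]).
- exact: vis_edgeC.
- move=> y [vy sy [r [s [r0 _ _ yE]]]]; split=> //.
  by rewrite orient_swap yE comb_orient1 -mulrN; apply: pmulr_neq0 => // /eqP; rewrite oppr_eq0 => /eqP.
- move=> y z a b [_ _ [r [s [r0 s0 rs yE]]]] a0 b0 ab zE vz sz; split=> //.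
  exists (b * r), (b * s + a); split; last by rewrite zE yE; point_ring.
  - exact: mulr_gt0.
  - by rewrite addr_ge0 ?mulr_ge0 // ltW.
  - by clear - r0 s0 rs a0 b0 ab; nra.
- exists v; split; [exact: vis_edgeC|exact: same_sideC|].
  by exists 1, 0; split=> //; [rewrite addr0|point_ring].
have [_ [yV _]] := vy.
have yw : w <> y.
  move=> e; have : orient u y w = r * orient u v w by rewrite yE comb_orient1.
  have -> : orient u y w = 0 by rewrite e; orient_ring.
  by move/esym; apply: pmulr_neq0.
have vwy : vis w y := free_tri_visible fr_y wV yV yw.
have [e1 e2 e3] := frame_comb u v w r s fr; rewrite -yE in e1 e2 e3.
case: pv pw pwv => [p1 p2 p3] [q1 q2 q3] [t1 t2 t3].
have pwy : pcone F G H w y.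
  have k : 0 <= 1 - r - s by clear - rs; lra.
  apply: pcone_intro fr _ _; [clear - e2 q2 t2 r0 k|clear - e3 q3 t3 r0 k]; nra.
have swy : same w u y by apply: free_same_side1; apply: free_tri_rot.
have := wm y vwy pwy swy; rewrite e1; clear - r0 s0 p1 q1; nra.
Qed.

Lemma consecutive_order F G H u v w : frame F G H -> consecutive V S F G H u v w ->
  (G v < G w /\ H w < H v) \/ (G w < G v /\ H v < H w).
Proof.
move=> fr [ov ow sm ne _].
have n1 := in_neighbors_incomparable fr ov ow sm.
have n2 := in_neighbors_incomparable fr ow ov (same_sideC sm).
have [[vV _] _ _] := ov; have [[wV _] _ _] := ow.
have [_ nG nH] := frame_neq VS fr vV wV ne.
have sv := frame_sum v fr; have sw := frame_sum w fr.
case: (ltgtP (G v) (G w)) => [g|g|//]; case: (ltgtP (H v) (H w)) => [h|h|//];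
  rewrite ?g ?h; [|by left|by right|].
  by case: n1; split; lra.
by case: n2; split; lra.
Qed.

(** The segment from [z] to [z2] meets the line [uv] in [c], at the fraction [t] from [u]. For
    [t < 1] it crosses the edge chosen by [v] in the way forbidden by [out_edge_not_crossed]; for
    [t > 1] the vertex [v] is in the empty triangle; [t = 1] contradicts general position. *)
Lemma crossing_into_out_edge F G H u v w z z2 (r s r2 s2 : R) : frame F G H -> out F G H v u ->
  w \in V -> orient u v w <> 0 -> vis z z2 -> pcone F G H z z2 -> F z2 < F u ->
  (forall x, x \in V -> ~ in_tri z u z2 x) ->
  0 < r -> 0 < s -> z = comb u v w r s -> 0 < r2 -> s2 < 0 -> z2 = comb u v w r2 s2 -> False.
Proof.
move=> fr ov wV o0 vz pz Fz2 em r0 s0 zE r20 s20 z2E.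
have [vv pv _] := ov; have [vV [uV [vu _]]] := vv; have [zV [z2V [zz2 _]]] := vz.
have D0 : 0 < s - s2 by lra.
have Dn : s - s2 != 0 by rewrite gt_eqF.
pose m := s / (s - s2).
have mD : m * (s - s2) = s by rewrite /m divfK.
have m0 : 0 < m by rewrite divr_gt0.
have m1 : m < 1 by rewrite ltr_pdivrMr // mul1r; lra.
pose t := r + m * (r2 - r).
have t0 : 0 < t by rewrite /t; nra.
have tn : t != 0 by rewrite gt_eqF.
pose c := vadd z (vscale m (vsub z2 z)).
have cE : c = vadd u (vscale t (vsub v u)).
  have -> : c = comb u v w t (s - m * (s - s2)).
    by rewrite /c zE z2E /t; point_ring.
  by rewrite mD subrr; point_ring.
have m01 : 0 < m < 1 by rewrite m0 m1.
have ovz : orient u v z <> 0 by rewrite zE comb_orient2; apply: pmulr_neq0.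
have ovz2 : orient u v z2 <> 0.
  rewrite z2E comb_orient2 => /eqP; rewrite mulf_eq0 (lt_eqF s20) /= => /eqP; exact: o0.
have cov x : orient u v x <> 0 -> v <> x.
  by move=> h e; apply: h; rewrite -e /orient /cross; ring.
case: (ltgtP t 1) => [t1|t1|t1].
- have cE2 : c = vadd v (vscale (1 - t) (vsub u v)).
    by rewrite cE; point_ring.
  apply: (@out_edge_not_crossed F G H v u z z2 c (1 - t) m) => //.
  - by apply/andP; split; lra.
  - by rewrite orientC => /eqP; rewrite oppr_eq0 => /eqP.
  have [a1 a2 a3] := frame_ray u v t fr; have [b1 b2 b3] := frame_ray z z2 m fr.
  rewrite -cE in a1 a2 a3; rewrite -/c in b1 b2 b3.
  case: pv pz => [p1 p2 p3] [q1 q2 q3].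
  apply: pcone_intro fr _ _; [clear - a2 b2 p2 q2 t0 t1 m0 m1|clear - a3 b3 p3 q3 t0 t1 m0 m1]; nra.
- apply: (em v vV); exists (1 - 1 / t), (m / t); split.
  - by rewrite subr_gt0 ltr_pdivrMr // mul1r.
  - exact: divr_gt0.
  - have -> : 1 - 1 / t + m / t = 1 - (1 - m) / t by field.
    by rewrite ltrBlDr ltrDl divr_gt0 // subr_gt0.
  have cE1 : v.1 = u.1 + (c.1 - u.1) / t.
    by rewrite cE /vadd /vscale /vsub /=; field.
  have cE2 : v.2 = u.2 + (c.2 - u.2) / t.
    by rewrite cE /vadd /vscale /vsub /=; field.
  by apply: pair_ext; rewrite ?cE1 ?cE2 /c /comb /vadd /vscale /vsub /=; field.
- have vc : v = c by rewrite cE t1 vadd_vscale1.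
  have : orient z z2 v = 0 by rewrite vc; apply: on_seg_orient; exists m; rewrite !ltW.
  case/(collinear_eq VS zV z2V vV zz2) => e.
    exact: cov _ ovz e.
  exact: cov _ ovz2 e.
Qed.

(* The vertex of the box closest to [u] would be adjacent to [u], hence a member of
   the canonical sequence strictly between [v] and [w]. *)
Lemma consecutive_box_empty F G H u v w z0 (r0 s0 : R) : frame F G H -> consecutive V S F G H u v w ->
  vis u z0 -> 0 < r0 -> 0 < s0 -> z0 = comb u v w r0 s0 -> H z0 < H v -> G z0 < G w -> False.
Proof.
move=> fr co vz0 r00 s00 z0E Hz0 Gz0.
have [ov ow sm ne nob] := co.
have [vv pv _] := ov; have [vw pw _] := ow.
have [vV [uV [vu _]]] := vv; have [wV [_ [wu _]]] := vw.
have o0 : orient u v w <> 0 by apply: (orient_neq0 VS) => //; apply: nesym.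
pose P z := [/\ vis u z, H z < H v, G z < G w & exists r s : R, [/\ 0 < r, 0 < s & z = comb u v w r s]].
have [|z [zV [vz Hz Gz [r [s [rp sp zE]]]] zm]] := @ex_argmin _ V P (fun z => - F z).
  by exists z0; [case: vz0 => _ []|split=> //; exists r0, s0].
have pz : pcone F G H z u by rewrite zE; apply: pcone_comb_neg => //; apply: ltW.
have sz : same u v z by rewrite zE; apply: same_side_sub => //; apply: ltW.
(* It remains to see that [z] chooses [u]. A closer choice gives a vertex [y] with [z u y] free; it
   cannot be outside the sector by [crossing_into_out_edge], so it is in the box and closer to [u]
   than [z]. *)
apply: (nob z _ sz r s) => //; split=> //; first exact: vis_edgeC.
move=> y0 vy0 py0 sy0; rewrite leNgt; apply/negP => Fy0.
have zu : z <> u by case: pz => h _ _ e; rewrite e ltxx in h.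
have noz y : vis z y -> F y < F u -> orient z u y <> 0.
  move=> [_ [yV [zy _]]] Fy; apply: (orient_neq0 VS) => //.
  by move=> e; rewrite e ltxx in Fy.
have [||||y [[vy py sy Fy] fry em]] := @ex_free_triangle _ V S VS z u
    (fun y => [/\ vis z y, pcone F G H z y, same z u y & F y < F u]).
- exact: vis_edgeC.
- by move=> y [vy py sy Fy]; split=> //; apply: noz.
- move=> y x a b [vy py sy Fy] a0 b0 ab xE vx sx; split=> //.
    by rewrite xE; apply: pcone_comb => //; apply: ltW.
  have [e1 _ _] := frame_comb z u y a b fr; rewrite xE e1.
  by case: pz => h _ _; clear - a0 b0 ab Fy h; nra.
- by exists y0.
have [_ [yV _]] := vy.
have uy : u <> y by move=> e; rewrite -e ltxx in Fy.
have vuy : vis u y := free_tri_visible fry uV yV uy.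
have [py1 py2 py3] := py.
have [r2 [s2 yE]] : exists r2 s2 : R, y = comb u v w r2 s2.
  by exists (orient u y w / orient u v w), (orient u v y / orient u v w); apply: comb_coords.
have [e1 e2 e3] := frame_comb u v w r2 s2 fr; rewrite -yE in e1 e2 e3.
have nr2 : r2 <> 0.
  move=> r2z; have : orient u w y = 0 by rewrite orient_swap yE comb_orient1 r2z mul0r oppr0.
  case/(collinear_eq VS uV wV yV (nesym wu)) => [/esym //|ye].
  by move: py2; rewrite ye; lra.
have ns2 : s2 <> 0.
  move=> s2z; have : orient u v y = 0 by rewrite yE comb_orient2 s2z mul0r.
  case/(collinear_eq VS uV vV yV (nesym vu)) => [/esym //|ye].
  by move: py3; rewrite ye; lra.
have [pv1 _ _] := pv; have [pw1 _ _] := pw.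
case: (ltgtP s2 0) => [sn|spos|//].
  have rpos : 0 < r2 by clear - e1 Fy pv1 pw1 sn; rewrite ltNge; apply/negP => rn; nra.
  exact: (crossing_into_out_edge fr ov wV o0 vy py Fy em rp sp zE rpos sn yE).
case: (ltgtP r2 0) => [rn|rpos|//].
  apply: (crossing_into_out_edge fr ow vV _ vy py Fy em sp rp _ spos rn); last by rewrite combC.
    by rewrite orient_swap => /eqP; rewrite oppr_eq0 => /eqP.
  by rewrite combC.
have Py : P y by split; [|exact: lt_trans Hz|exact: lt_trans Gz|exists r2, s2].
by have := zm y yV Py; rewrite lerN2 leNgt py1.
Qed.

(** A vertex in the triangle yields one visible from [u], and the open triangle is contained in the
    box of [consecutive_box_empty]. *)
Lemma consecutive_empty F G H u v w z : frame F G H -> consecutive V S F G H u v w ->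
  z \in V -> ~ in_tri u v w z.
Proof.
wlog [g h] : G H v w / G v < G w /\ H w < H v.
  move=> th fr co zV zT; case: (consecutive_order fr co) => [gh|[g h]]; first exact: th gh fr co zV zT.
  exact: (th H G v w (conj h g) (frame_swap fr) (consecutive_swap co) zV zT).
move=> fr co; have [ov ow sm ne nob] := co.
have [vv [pv1 pv2 pv3] _] := ov; have [vw [pw1 pw2 pw3] _] := ow.
have [vV [uV [vu _]]] := vv; have [wV [_ [wu _]]] := vw.
have o0 : orient u v w <> 0 by apply: (orient_neq0 VS) => //; apply: nesym.
move=> zV zT.
have [z1 [z1V [a [b [a0 b0 ab z1E]]] vz1 _ _]] :=
  tri_visible_vertex VS (vis_edgeC vv) (vis_edgeC vw) o0 sm zV zT.
have [_ e2 e3] := frame_comb u v w a b fr; rewrite -z1E in e2 e3.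
apply: (consecutive_box_empty fr co vz1 a0 b0 z1E).
  have : b * (H w - H u) < b * (H v - H u) by rewrite ltr_pM2l // ltrD2r.
  have : (a + b) * (H v - H u) < H v - H u by nra.
  by lra.
have : a * (G v - G u) < a * (G w - G u) by rewrite ltr_pM2l // ltrD2r.
have : (a + b) * (G w - G u) < G w - G u by nra.
by lra.
Qed.

Lemma consecutive_free F G H u v w : frame F G H -> consecutive V S F G H u v w -> free_tri S u v w.
Proof.
move=> fr co; have [ov ow sm ne nob] := co.
have [vv _ _] := ov; have [vw _ _] := ow.
have [vV [uV [vu _]]] := vv; have [wV [_ [wu _]]] := vw.
apply: (empty_free VS) => //; try exact: vis_edgeC.
  by apply: (orient_neq0 VS) => //; apply: nesym.
by move=> z; apply: consecutive_empty fr co.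
Qed.

Lemma consecutive_visible F G H u v w : frame F G H -> consecutive V S F G H u v w -> vis v w.
Proof.
move=> fr co; have [[[vV _] _ _] [[wV _] _ _] _ ne _] := co.
exact: free_tri_visible (consecutive_free fr co) vV wV ne.
Qed.

(** Suppose [u] sees some [z] in the subcone of [w], lower than [w]. On the side of [v] of the line
    [uw], either [z] is in the empty triangle or [uz] crosses the edge chosen by [w]. On the other
    side [z] can be taken with [u w z] free; then [v] sees [z] through two free triangles, and [z]
    is in the empty box between [u] and [w]. *)
Lemma consecutive_out F G H v u w : frame F G H -> consecutive V S F G H v u w ->
  G u < G w -> F w < F u -> out G F H u w.
Proof.
move=> fr co Guw Fwu.
have Hwu : H w < H u by case: (consecutive_order fr co) => -[]; lra.
have [ou ow sm ne nob] := co.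
have [vu [pu1 pu2 pu3] _] := ou; have [vw [pw1 pw2 pw3] _] := ow.
have [uV [vV [uv _]]] := vu; have [wV [_ [wv _]]] := vw.
have frT := consecutive_free fr co.
have vuw := consecutive_visible fr co.
have fr' := frame_flip fr.
have o0 : orient u v w <> 0 by apply: (orient_neq0 VS) => //; apply: nesym.
have on : orient u v w != 0 by apply/eqP.
have coord z : exists r s : R, z = comb u v w r s.
  by exists (orient u z w / orient u v w), (orient u v z / orient u v w); apply: comb_coords.
split=> // z0 vz0 pz0 sz0; rewrite leNgt; apply/negP => Gz0.
have rneq z (r s : R) : vis u z -> G z < G w -> z = comb u v w r s -> r <> 0.
  move=> [_ [zV [uz _]]] Gz zE r0; have : orient u w z = 0.
    by rewrite orient_swap zE comb_orient1 r0 mul0r oppr0.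
  by case/(collinear_eq VS uV wV zV ne) => e; [case: uz|rewrite e ltxx in Gz].
have above z (r s : R) : vis u z -> pcone G F H u z -> G z < G w -> z = comb u v w r s -> ~ 0 < r.
  move=> vz [pz1 pz2 pz3] Gz zE r0.
  have [_ [zV [uz _]]] := vz.
  have [e1 e2 e3] := frame_comb u v w r s fr; rewrite -zE in e1 e2 e3.
  have s0 : 0 < s by clear - e2 pz1 r0 pu2 Guw; rewrite ltNge; apply/negP => s0; nra.
  have rs0 : 0 < r + s by rewrite addr_gt0.
  have rsn : r + s != 0 by rewrite gt_eqF.
  have zw : z <> w by move=> e; rewrite e ltxx in Gz.
  have zv : z <> v by move=> e; rewrite e in pz1; lra.
  case: (ltgtP (r + s) 1) => rs.
  - by apply: (consecutive_empty fr co zV); apply: in_tri_rot; exists r, s.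
  - pose c := vadd u (vscale (1 / (r + s)) (vsub z u)).
    have c01 : 0 < 1 / (r + s) < 1 by rewrite divr_gt0 //= ltr_pdivrMr // mul1r.
    have r01 : 0 < r / (r + s) < 1 by rewrite divr_gt0 //= ltr_pdivrMr // mul1r ltrDl.
    have cE : c = vadd w (vscale (r / (r + s)) (vsub v w)).
      by rewrite /c zE; apply: pair_ext; rewrite /comb /vadd /vscale /vsub /=; field.
    apply: (@out_edge_not_crossed F G H w v u z c _ _ fr ow vz r01 cE c01 erefl).
    - by apply: (orient_neq0 VS) => //; apply: nesym.
    - have [b1 b2 b3] := frame_ray w v (r / (r + s)) fr; rewrite -cE in b1 b2 b3.
      have [a1 a2 a3] := frame_ray u z (1 / (r + s)) fr; rewrite -/c in a1 a2 a3.
      case/andP: c01 => c0 c1; case/andP: r01 => q0 q1.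
      apply: pcone_intro fr Gz _; clear - a3 b3 c0 c1 q0 q1 pw3 pz3; nra.
    - exact: lt_trans pz2 pu1.
  - have : orient v w z = 0.
      apply: on_seg_orient; exists s; split; first by clear - r0 s0 rs; apply/andP; split; lra.
      rewrite zE; have -> : r = 1 - s by clear - rs; lra.
      by point_ring.
    by case/(collinear_eq VS vV wV zV (nesym wv)).
have [|||z [[vz pz sz Gz] frz _]] := @ex_free_triangle _ V S VS u w
    (fun z => [/\ vis u z, pcone G F H u z, same u w z & G z < G w]) vuw.
- move=> z [vz pz sz Gz]; split=> //; have [_ [zV [uz _]]] := vz.
  by apply: (orient_neq0 VS) => // e; rewrite e ltxx in Gz.
- move=> z x a b [vz pz sz Gz] a0 b0 ab xE vx sx; split=> //.
    by rewrite xE; apply: pcone_comb => //; apply: ltW.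
  have [_ e2 _] := frame_comb u w z a b fr; rewrite xE e2.
  by case: pz => h _ _; clear - a0 b0 ab Gz h Guw; nra.
- by exists z0.
have [r [s zE]] := coord z.
have rn : r < 0.
  case: (lt_or_gt (rneq z r s vz Gz zE)) => // r0.
  by case: (above z r s vz pz Gz zE r0).
have [_ [zV [uz _]]] := vz.
case: (pz) => pz1 pz2 pz3.
have [e1 e2 e3] := frame_comb u v w r s fr; rewrite -zE in e1 e2 e3.
have s0 : 0 < s by clear - e3 pz3 rn pu3 Hwu; rewrite ltNge; apply/negP => s0; nra.
have k0 : 0 < 1 - r - s by clear - e2 Gz rn pw2 Guw; rewrite ltNge; apply/negP => k0; nra.
have zE' : z = comb v u w (1 - r - s) s by rewrite zE comb_rot.
have vz' : v <> z by move=> e; rewrite -e in pz1; lra.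
have vvz : vis v z.
  split=> //; split=> //; split=> // O OS x [t [/andP [t0 t1] xE]].
  (* The segment [vz] meets the line [uw] at the parameter [1 / (1 - r)]: up to it the point is in
     the triangle [uvw], afterwards in [uwz]. *)
  case: (leP (t * (1 - r)) 1) => [le|gt].
    apply: (free_closed frT _ OS); exists (t * (1 - r - s)), (t * s); split.
    - by rewrite mulr_ge0 // ltW.
    - by rewrite mulr_ge0 // ltW.
    - by rewrite -mulrDr; have -> : 1 - r - s + s = 1 - r by ring.
    by rewrite xE zE'; point_ring.
  have rN : - r != 0 by rewrite oppr_eq0 lt_eqF.
  have rp : 0 < - r by rewrite oppr_gt0.
  pose b := t - (1 - t) / (- r).
  pose a := (1 - t) / (- r) * s.
  have q0 : 0 <= (1 - t) / (- r) by rewrite divr_ge0 // ?subr_ge0 // ltW.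
  have q1 : (1 - t) / (- r) * (- r) = 1 - t by rewrite divfK.
  apply: (free_closed frz _ OS); exists a, b; split.
  - by rewrite mulr_ge0 // ltW.
  - by rewrite /b subr_ge0 ler_pdivrMr //; clear - gt; lra.
  - rewrite /a /b; move: q0 q1; move: (_ / _) => q q0 q1; clear - q0 q1 k0 s0 rn t1; nra.
  rewrite xE zE /a /b; have rN' : r != 0 by rewrite lt_eqF.
  by apply: pair_ext; rewrite /comb /vadd /vscale /vsub /=; field; rewrite ?rN' ?oppr_eq0.
exact: (consecutive_box_empty fr co vvz k0 s0 zE' pz3 Gz).
Qed.

End Planarity.

(** * Walks of bounded length, and lengths in hexagonal coordinates *)

Section Reach.
Variable R : realType.
Implicit Types (a b c d e n p q u v w x y z : point R) (E : point R -> point R -> Prop).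
Implicit Types (F G H : point R -> R).

Definition reach E (d : R) x y : Prop :=
  exists s, [/\ walk E x s, last x s = y & walk_len x s <= d].

Lemma walk_cat E x s t : walk E x s -> walk E (last x s) t -> walk E x (s ++ t).
Proof. by elim: s x => [|y s IH] x //= [xy ws] wt; split=> //; apply: IH. Qed.

Lemma walk_len_cat x s t : walk_len x (s ++ t) = walk_len x s + walk_len (last x s) t.
Proof. by elim: s x => [|y s IH] x /=; rewrite ?add0r // IH addrA. Qed.

Lemma reach_trans E (d1 d2 : R) x y z : reach E d1 x y -> reach E d2 y z -> reach E (d1 + d2) x z.
Proof.
move=> [s [ws ls s1]] [t [wt lt t1]]; exists (s ++ t); split.
- by apply: walk_cat => //; rewrite ls.
- by rewrite last_cat ls.
- by rewrite walk_len_cat ls lerD.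
Qed.

Lemma reach_le E (d1 d2 : R) x y : d1 <= d2 -> reach E d1 x y -> reach E d2 x y.
Proof. by move=> d12 [s [ws ls s1]]; exists s; split=> //; apply: le_trans d12. Qed.

Lemma reach_edge E x y : E x y -> reach E (dist x y) x y.
Proof. by move=> xy; exists [:: y]; split=> //=; rewrite addr0. Qed.

Lemma distC x y : dist x y = dist y x.
Proof. by rewrite /dist; congr Num.sqrt; rewrite /dot /vsub /=; ring. Qed.

Lemma reach_sym E (d : R) x y : (forall x y, E x y -> E y x) -> reach E d x y -> reach E d y x.
Proof.
move=> sym [s [ws ls s1]]; apply: reach_le s1 _; rewrite -ls.
elim: s x ws {ls} => [|z s IH] x /=; first by exists [::].
move=> [xz ws]; rewrite addrC; apply: reach_trans (IH z ws) _.
by rewrite distC; apply: reach_edge; apply: sym.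
Qed.

(** The ratio between a length along a cone boundary and its projection on the bisector,
    [1 / cos (pi / 6)]. *)
Definition kappa : R := 2 / Num.sqrt 3.

Lemma kappa_gt0 : 0 < kappa.
Proof. by rewrite divr_gt0 // sqrt3_gt0. Qed.

Lemma kappa_sq : kappa ^+ 2 = 4 / 3.
Proof.
rewrite /kappa expr_div_n; congr (_ / _); first by rewrite expr2; ring.
by rewrite expr2 sqrt3_sq.
Qed.

Lemma dist_ge0 p q : 0 <= dist p q.
Proof. exact: sqrtr_ge0. Qed.

Lemma dist_le F G H p q (B : R) : frame F G H -> 0 <= B ->
  (F q - F p) ^+ 2 + (F q - F p) * (G q - G p) + (G q - G p) ^+ 2 <= B ^+ 2 ->
  dist p q <= kappa * B.
Proof.
move=> fr B0 le; have k0 := kappa_gt0.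
have kB : 0 <= kappa * B by rewrite mulr_ge0 // ltW.
have d0 := dist_ge0 p q.
rewrite -ler_sqr ?nnegrE //.
by rewrite (frame_dist p q fr) exprMn kappa_sq ler_pM2l // divr_gt0.
Qed.

Lemma dist_ge F G H p q (B k : R) : frame F G H -> 0 <= B -> 0 <= k ->
  B ^+ 2 <= k ^+ 2 * ((F q - F p) ^+ 2 + (F q - F p) * (G q - G p) + (G q - G p) ^+ 2) ->
  kappa * B <= k * dist p q.
Proof.
move=> fr B0 k0 le; have kp := kappa_gt0.
have kB : 0 <= kappa * B by rewrite mulr_ge0 // ltW.
have d0 : 0 <= k * dist p q by rewrite mulr_ge0 // dist_ge0.
rewrite -ler_sqr ?nnegrE //.
by rewrite [(kappa * B) ^+ 2]exprMn [(k * _) ^+ 2]exprMn (frame_dist p q fr) kappa_sq [k ^+ 2 * _]mulrCA ler_pM2l // divr_gt0.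
Qed.

Lemma count_sub_lt (T : eqType) (P Q : pred T) (s : seq T) (x : T) :
  subpred P Q -> x \in s -> Q x -> ~~ P x -> (count P s < count Q s)%N.
Proof.
move=> sub; elim: s => //= a s IH; rewrite inE => /orP [/eqP <- Qx nPx|xs Qx nPx].
  by rewrite Qx (negPf nPx) add0n add1n ltnS; apply: sub_count.
have : (P a <= Q a)%N by case Pa: (P a) => //; rewrite (sub a Pa).
by have := IH xs Qx nPx; lia.
Qed.

End Reach.

(** * Detours along canonical paths *)

Section CanonicalPath.
Variable R : realType.
Variables (V : seq (point R)) (S : seq (seq (point R))).
Hypothesis VS : valid_setting V S.
Implicit Types (a b c d e n p q u v w x y z : point R).
Implicit Types (F G H : point R -> R).
Notation out := (out_edge V S).
Notation vis := (vis_edge V S).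
Notation same := (same_side S).

Lemma comb_dominated (ga ha gb hb r s : R) : 0 < ga -> 0 < hb -> 0 < ha -> ga < gb -> hb < ha ->
  0 < r -> 0 < s -> r * ga + s * gb <= ga -> r * ha + s * hb < ha.
Proof.
move=> ga0 hb0 ha0 gab hba r0 s0 le.
have rs : r + s < 1 by rewrite ltNge; apply/negP => rs; nra.
nra.
Qed.

Lemma comb_dominating (ga ha gb hb r s : R) : 0 < ga -> 0 < hb -> ga < gb -> hb < ha ->
  0 < r -> 0 < s -> gb <= r * ga + s * gb -> hb < r * ha + s * hb.
Proof.
move=> ga0 hb0 gab hba r0 s0 le.
have rs : 1 < r + s by rewrite ltNge; apply/negP => rs; nra.
nra.
Qed.

Lemma in_neighbors_order F G H u v w : frame F G H -> out F G H v u -> out F G H w u ->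
  same u v w -> G v <= G w -> H v < H w -> False.
Proof.
move=> fr ov ow sm g h.
have [[vV _] _ _] := ov; have [[wV _] _ _] := ow.
have vw : v <> w by move=> e; rewrite e ltxx in h.
have [_ nG _] := frame_neq VS fr vV wV vw.
have {}g : G v < G w by rewrite lt_neqAle g andbT; apply/eqP.
apply: (in_neighbors_incomparable VS fr ov ow sm).
have sv := frame_sum v fr; have sw := frame_sum w fr; split=> //; lra.
Qed.

(** Along the sequence [G] increases and [H] decreases, so the bound is additive, and an edge is no
    longer than [kappa] times the sum of its two coordinate changes. The induction counts the
    members with [G] strictly between; [a0] names the subcone. *)
Lemma canonical_path F G H u a0 a b : frame F G H ->
  out F G H a u -> out F G H b u -> out F G H a0 u -> same u a0 a -> same u a0 b -> G a < G b ->
  reach (g10 V S) (kappa R * ((G b - G a) + (H a - H b))) a b.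
Proof.
move=> fr.
pose N x y : pred (point R) := fun z => `[< [/\ out F G H z u, same u a0 z, G x < G z & G z < G y] >].
move: {2}(count (N a b) V).+1 (ltnSn (count (N a b) V)) => n.
elim: n a b => // n IH a b; rewrite ltnS => cn oa ob oa0 sa sb ab.
have tr z z' : out F G H z u -> out F G H z' u -> same u a0 z -> same u a0 z' -> same u z z'.
  move=> [vz pz _] [vz' pz' _] sz sz'; case: oa0 => v0 p0 _.
  by apply: (same_side_ntrans VS fr pz p0 pz') => //; try exact: vis_edgeC; exact: same_sideC.
have [[z zV Nz]|nN] := pselect (exists2 z, z \in V & N a b z).
  have /asboolP [oz sz az zb] := Nz.
  have c1 : (count (N a z) V < n)%N.
    apply: leq_trans cn; apply: (count_sub_lt _ zV Nz).
      by move=> x /asboolP [h1 h2 h3 h4]; apply/asboolP; split=> //; apply: lt_trans zb.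
    by apply/asboolPn => -[_ _ _]; rewrite ltxx.
  have c2 : (count (N z b) V < n)%N.
    apply: leq_trans cn; apply: (count_sub_lt _ zV Nz).
      by move=> x /asboolP [h1 h2 h3 h4]; apply/asboolP; split=> //; apply: lt_trans az _.
    by apply/asboolPn => -[_ _]; rewrite ltxx.
  have r1 := IH a z c1 oa oz oa0 sa sz az; have r2 := IH z b c2 oz ob oa0 sz sb zb.
  by apply: reach_le (reach_trans r1 r2); lra.
have sab := tr a b oa ob sa sb.
have [va [pa1 pa2 pa3] _] := oa; have [vb [pb1 pb2 pb3] _] := ob.
have hab : H b < H a.
  rewrite ltNge; apply/negP => hab.
  have ne : b <> a by move=> e; rewrite e ltxx in ab.
  have [[aV _] [[bV _] _]] := (va, (vb, tt)).
  have [_ _ nH] := frame_neq VS fr bV aV ne.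
  apply: (in_neighbors_order fr oa ob sab (ltW ab)).
  by rewrite lt_neqAle hab andbT; apply/eqP => e; apply: nH.
(* A member in the open sector with [G] outside the range would be comparable with [a] or [b],
   against [in_neighbors_order]. *)
have co : consecutive V S F G H u a b.
  split=> //; first by move=> e; rewrite e ltxx in ab.
  move=> z oz sz r s r0 s0 zE; apply: nN; have [[zV _] _ _] := oz.
  have s0z : same u a0 z.
    have [va0 pa0 _] := oa0; have [vz pz _] := oz.
    have pa : pcone F G H a u by split.
    exact: (same_side_ntrans VS fr pa0 pa pz (vis_edgeC va0) (vis_edgeC va) (vis_edgeC vz)).
  have [_ e2 e3] := frame_comb u a b r s fr; rewrite -zE in e2 e3.
  exists z => //; apply/asboolP; split=> //.
    rewrite ltNge; apply/negP => le.
    apply: (in_neighbors_order fr oz oa (same_sideC sz) le); rewrite e3.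
    have := @comb_dominated (G a - G u) (H a - H u) (G b - G u) (H b - H u) r s.
    by rewrite !subr_gt0 !ltrD2r => /(_ pa2 pb3 pa3 ab hab r0 s0) h; have := h _; lra.
  rewrite ltNge; apply/negP => le.
  apply: (in_neighbors_order fr ob oz (tr b z ob oz sb s0z) le); rewrite e3.
  have := @comb_dominating (G a - G u) (H a - H u) (G b - G u) (H b - H u) r s.
  by rewrite !subr_gt0 !ltrD2r => /(_ pa2 pb3 ab hab r0 s0) h; have := h _; lra.
have e := consecutive_g10 VS fr co.
apply: reach_le (reach_edge e).
apply: (dist_le (frame_swap (frame_flip (frame_swap fr)))).
  by lra.
move: ab hab; move: (G a) (G b) (H a) (H b) => ga gb ha hb *; nra.
Qed.

(** Let [g] and [h] be the changes of the two coordinates from [u] to [v]. The edge to the closest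
    vertex [c] and the canonical path from [c] to [v] cost at most [kappa (3 g + h)], because [c]
    does not project farther than [v]; and [(3 g + h)^2 <= 9 (g^2 + g h + h^2)]. *)
Lemma out_edge_reach F G H u v : frame F G H -> out F G H v u -> reach (g10 V S) (3 * dist u v) u v.
Proof.
move=> fr ov; have [c [gc oc sc cm]] := closest_edge VS fr ov.
have rc := reach_edge gc.
have [vv [pv1 pv2 pv3] _] := ov; have [vc [pc1 pc2 pc3] _] := oc.
have [vV [uV [vu _]]] := vv; have [cV _] := vc.
have Fc := cm v ov (same_side_refl _ _ _).
have main G' H' : frame F G' H' -> out F G' H' v u -> out F G' H' c u ->  G' c < G' v ->
    reach (g10 V S) (3 * dist u v) u v.
  move=> fr' ov' oc' lt.
  have r := canonical_path fr' oc' ov' ov' sc (same_side_refl _ _ _) lt.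
  apply: reach_le (reach_trans rc r).
  have [_ [p1 p2 p3] _] := ov'; have [_ [q1 q2 q3] _] := oc'.
  have su := frame_sum u fr'; have sv := frame_sum v fr'; have scc := frame_sum c fr'.
  have fr2 := frame_swap (frame_flip (frame_swap fr')).
  have d1 : dist u c <= kappa R * ((G' c - G' u) + (H' c - H' u)).
    apply: (dist_le fr2); first lra.
    by move: q2 q3; move: (G' c) (H' c) (G' u) (H' u) => *; nra.
  have d2 : kappa R * (3 * (G' v - G' u) + (H' v - H' u)) <= 3 * dist u v.
    apply: (dist_ge fr2); [lra|lra|].
    by move: p2 p3; move: (G' v) (H' v) (G' u) (H' u) => *; nra.
  apply: le_trans d2; apply: le_trans (lerD d1 (lexx _)) _.
  rewrite -mulrDr ler_pM2l ?kappa_gt0 //; lra.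
have [e|ne] := pselect (c = v).
  by rewrite -e; apply: reach_le rc; have := dist_ge0 u c; lra.
have [_ nG nH] := frame_neq VS fr cV vV ne.
case: (ltgtP (G c) (G v)) => [lt|gt|//]; first exact: main fr ov oc lt.
case: (ltgtP (H c) (H v)) => [lt|gt2|//].
  exact: main (frame_swap fr) (out_edgeC ov) (out_edgeC oc) lt.
by case: (in_neighbors_order fr ov oc sc (ltW gt) gt2).
Qed.

Lemma g10_sym x y : g10 V S x y -> g10 V S y x.
Proof. by case=> h; [right|left]. Qed.

Lemma ginf_reach x y : ginf V S x y -> reach (g10 V S) (3 * dist x y) x y.
Proof.
case=> /(ginf_dirP VS) [F [G [H [fr o]]]]; last exact: out_edge_reach fr o.
by rewrite distC; apply: (reach_sym g10_sym); apply: out_edge_reach fr o.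
Qed.

Lemma ginf_walk_reach x s : walk (ginf V S) x s -> reach (g10 V S) (3 * walk_len x s) x (last x s).
Proof.
elim: s x => [|y s IH] x /=; first by exists [::]; split=> //=; rewrite mulr0.
by move=> [xy ws]; rewrite mulrDr; apply: reach_trans (ginf_reach xy) (IH y ws).
Qed.

End CanonicalPath.

(** * Stretch of [ginf] *)

Section Predecessor.
Variable R : realType.
Variables (V : seq (point R)) (S : seq (seq (point R))).
Hypothesis VS : valid_setting V S.
Implicit Types (a b c d e n p q u v w x y z : point R).
Implicit Types (F G H : point R -> R).
Notation out := (out_edge V S).
Notation vis := (vis_edge V S).
Notation same := (same_side S).

Lemma det_neq0 F G H u p q : frame F G H -> u \in V -> p \in V -> q \in V ->
  u <> p -> u <> q -> p <> q -> det F G u p q <> 0.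
Proof.
move=> fr uV pV qV up uq pq; have [k _ kE] := frame_orient fr => d0.
by apply: (orient_neq0 VS uV pV qV up uq pq); rewrite kE d0 mulr0.
Qed.

Lemma det_coords F G H u w y p : frame F G H -> det F G u w y <> 0 ->
  exists r s : R, p = comb u y w r s.
Proof.
move=> fr d0; have [k k0 kE] := frame_orient fr.
exists (orient u p w / orient u y w), (orient u y p / orient u y w); apply: comb_coords.
rewrite orient_swap kE => /eqP; rewrite oppr_eq0 mulf_eq0 (negPf k0) => /eqP.
exact: d0.
Qed.

Lemma det_comb F G H u w y (r s : R) : frame F G H ->
  let p := comb u y w r s in let D := det F G u w y in
  [/\ det F G u w p = r * D, det F G u y p = - s * D,
      det F G w p y = - (1 - r - s) * D & det F G y w p = - (1 - r - s) * D].
Proof.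
move=> fr p D; have [e1 e2 _] := frame_comb u y w r s fr.
by split; rewrite /D /det e1 e2; ring.
Qed.

Lemma det_swap F G H u p q : frame F G H -> det F H u p q = - det F G u p q.
Proof. by move=> fr; rewrite /det !(frame_sum _ fr); ring. Qed.

Lemma det_rot F G H u p q : frame F G H -> det G H u p q = det F G u p q.
Proof. by move=> fr; rewrite /det !(frame_sum _ fr); ring. Qed.

Lemma detC F G u p q : det F G u q p = - det F G u p q.
Proof. by rewrite /det; ring. Qed.

Lemma pcone_neq F G H u v : pcone F G H u v -> u <> v.
Proof. by case=> h _ _ e; rewrite e ltxx in h. Qed.

Lemma pcone_trans F G H u v w : pcone F G H u v -> pcone F G H v w -> pcone F G H u w.
Proof. by case=> h1 h2 h3 [k1 k2 k3]; split; [apply: lt_trans k1|apply: lt_trans h2|apply: lt_trans h3]. Qed.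

Definition lower_left F G H u w p : Prop :=
  [/\ vis u p, pcone F G H u p, same u w p, F p < F w & 0 < det F G u w p].

(* [y] precedes [w] on the convex hull of the vertices seen by [u] left of [uw]. *)
Definition predecessor F G H u w y : Prop :=
  [/\ lower_left F G H u w y, forall p, lower_left F G H u w p -> 0 <= det F G w p y,
      forall x, x \in V -> ~ in_tri u y w x & vis y w].

(** Gift wrapping from [w]: the slope of the segment to [w] is extremal at [y]. A vertex in the
    triangle [uyw] would beat it, so the triangle is free and [y] sees [w]. *)
Lemma predecessor_exists F G H u w v : frame F G H -> vis u w -> pcone F G H u w ->
  lower_left F G H u w v -> exists y, predecessor F G H u w y.
Proof.
move=> fr vw pw lv; have [vv _ _ _ _] := lv; have [uV [wV _]] := vw.
pose f p := - ((G w - G p) / (F w - F p)).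
have [|y [yV ly ym]] := @ex_argmin _ V (lower_left F G H u w) f.
  by exists v => //; case: vv => _ [].
have max p : lower_left F G H u w p -> 0 <= det F G w p y.
  move=> lp; have pV : p \in V by case: lp => -[_ []].
  have := ym p pV lp; rewrite /f lerN2.
  have p0 : 0 < F w - F p by rewrite subr_gt0; case: lp.
  have y0 : 0 < F w - F y by rewrite subr_gt0; case: ly.
  by rewrite ler_pdivrMr // mulrAC ler_pdivlMr // /det => h; lra.
have [vy py sy Fy Dy] := ly.
have yw : y <> w by move=> e; rewrite e ltxx in Fy.
have o0 : orient u y w <> 0.
  by apply: (orient_neq0 VS uV yV wV) => //; [exact: pcone_neq py|exact: pcone_neq pw].
have em x : x \in V -> ~ in_tri u y w x.
  move=> xV xT.
  have [z [zV [a [b [a0 b0 ab zE]]] vz _ sz]] :=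
    tri_visible_vertex VS vy vw o0 (same_sideC sy) xV xT.
  have [d1 d2 d3 d4] := det_comb u w y a b fr; rewrite -zE in d1 d2 d3 d4.
  have lz : lower_left F G H u w z.
    split=> //; first by rewrite zE; apply: pcone_comb => //; apply: ltW.
      have [e1 _ _] := frame_comb u y w a b fr; rewrite zE e1.
      case: pw => pw1 _ _; case: py => py1 _ _; nra.
    by rewrite d1 mulr_gt0.
  have := max z lz; rewrite d3.
  have : 0 < (1 - a - b) * det F G u w y by rewrite mulr_gt0 //; lra.
  by lra.
exists y; split=> //.
have frT : free_tri S u y w by apply: (empty_free VS) => //; apply: same_sideC.
exact: free_tri_visible frT yV wV yw.
Qed.

Lemma predecessor_cone F G H u w y : frame F G H -> vis u w -> pcone F G H u w ->
  predecessor F G H u w y -> pcone F G H y w \/ pcone G F H w y.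
Proof.
move=> fr vw [pw1 pw2 pw3] [[vy [py1 py2 py3] _ Fy Dy] _ _ vyw].
have [yV [wV [yw _]]] := vyw.
have [_ nG nH] := frame_neq VS fr yV wV yw.
have Gyw : G w < G y.
  rewrite ltNge; apply/negP => le; move: Dy; rewrite /det.
  move: (F u) (F w) (F y) (G u) (G w) (G y) pw1 pw2 py1 py2 Fy le => *; nra.
case: (ltgtP (H y) (H w)) => [h|h|//]; [right|left]; by split.
Qed.

(* a visible vertex beyond the segment [uy] would be a vertex of the lower left
   region whose direction to [w] is steeper than that of the predecessor *)
Lemma predecessor_side_empty F G H u w y p : frame F G H -> vis u w -> pcone F G H u w ->
  predecessor F G H u w y -> pcone G F H w y -> ~ lower_left G H F w y p.
Proof.
move=> fr vw pw [ly ym em vyw] pwy [vp pp _ Gp Dp].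
have [vy py sy Fy Dy] := ly.
have [uV [wV [uw _]]] := vw; have [_ [yV [uy _]]] := vy; have [_ [pV _]] := vp.
have D0 : det F G u w y <> 0 by move=> h; rewrite h ltxx in Dy.
have [r [s pE]] := det_coords p fr D0.
have [d1 d2 d3 d4] := det_comb u w y r s fr; rewrite -pE in d1 d2 d3 d4.
move: Dp; rewrite (det_rot w y p fr) -[det F G w y p]opprK -detC d3 mulNr opprK => Dp.
have k0 : 0 < 1 - r - s by move: Dp; rewrite pmulr_lgt0.
have [pw1 pw2 pw3] := pw; have [py1 py2 py3] := py; have [pp1 pp2 pp3] := pp.
have r0 : 0 < r.
  have : 0 < det F G u w p.
    rewrite /det; have := frame_sum w fr; have := frame_sum p fr; have := frame_sum u fr.
    move: (F u) (F w) (F p) (G u) (G w) (G p) (H u) (H w) (H p) pw1 pw2 pw3 pp1 pp2 pp3.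
    move=> fu fw fp gu gw gp hu hw hp pw1 pw2 pw3 pp1 pp2 pp3 s1 s2 s3.
    have -> : (fw - fu) * (gp - gu) - (gw - gu) * (fp - fu) =
      (gu - gw) * (hw - hp) + (hu - hw) * (gp - gw) by rewrite s1 s2 s3; ring.
    by rewrite addr_gt0 // mulr_gt0 // subr_gt0.
  by rewrite d1 pmulr_lgt0.
have pu : pcone F G H u p.
  by apply: pcone_intro fr _ _; [apply: lt_trans Gp py2|apply: lt_trans pp2 pw3].
have up := pcone_neq pu.
have yp : y <> p by move=> e; rewrite e ltxx in Gp.
have ouyp : orient u y p <> 0 by apply: (orient_neq0 VS).
(* For [s < 0] the segment [wp] crosses [uy], and [crossing_visible_vertex] supplies the steeper
   vertex; for [s > 0] the vertex [p] is in the empty triangle [uyw]. *)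
case: (ltgtP s 0) => [s0|s0|s0].
- have sn : 1 - s != 0 by rewrite gt_eqF //; lra.
  have s1 : 0 < 1 - s by lra.
  pose m := 1 / (1 - s); pose l := r / (1 - s).
  have m01 : 0 < m < 1 by rewrite divr_gt0 //= ltr_pdivrMr // mul1r; lra.
  have l01 : 0 < l < 1 by rewrite divr_gt0 //= ltr_pdivrMr // mul1r; lra.
  pose c := vadd w (vscale m (vsub p w)).
  have cE : c = vadd u (vscale l (vsub y u)).
    by rewrite /c pE /m /l; apply: pair_ext; rewrite /comb /vadd /vscale /vsub /=; field.
  have [z [zV vz sz [a [b [a0 b0 ab zE]]]]] := crossing_visible_vertex VS vy vp l01 cE m01 erefl ouyp.
  have [l0 l1] := andP l01.
  have zE' : z = comb u y w (a * l + b * r) (b * s).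
    by rewrite zE pE cE; point_ring.
  have [z1 z2 z3 z4] := det_comb u w y (a * l + b * r) (b * s) fr; rewrite -zE' in z1 z2 z3 z4.
  have pc : pcone F G H u c.
    have [e1 e2 e3] := frame_ray u y l fr; rewrite cE /pcone e1 e2 e3.
    by rewrite ltrDl !gtrDl (pmulr_rgt0 _ l0) !(pmulr_rlt0 _ l0) subr_gt0 !subr_lt0.
  have pz : pcone F G H u z by rewrite zE; apply: pcone_comb.
  have br : 0 < b * r by rewrite mulr_gt0.
  have al : 0 <= a * l by rewrite mulr_ge0 // ltW.
  have lz : lower_left F G H u w z.
    split=> //.
    - exact: (same_side_ptrans VS fr pw py pz).
    - have [e1 _ _] := frame_comb u c p a b fr; rewrite zE e1.
      have [e2 _ _] := frame_ray u y l fr; rewrite -cE in e2; rewrite e2.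
      have h1 : l * (F y - F u) <= F w - F u.
        by apply: le_trans (_ : 1 * (F y - F u) <= _); rewrite ?ler_pM2r ?mul1r ?lerD2r ?(ltW Fy) ?(ltW l1) // subr_gt0.
      have h2 : b * (F p - F u) < b * (F w - F u) by rewrite ltr_pM2l // ltrD2r.
      have h3 : a * (l * (F y - F u)) <= a * (F w - F u) by rewrite ler_wpM2l.
      have h4 : (a + b) * (F w - F u) <= 1 * (F w - F u) by rewrite ler_pM2r // subr_gt0.
      by clear - h2 h3 h4; lra.
    - by rewrite z1 mulr_gt0 //; clear - br al; lra.
  have := ym z lz; rewrite z3.
  have h5 : 0 < 1 - (a * l + b * r) - b * s.
    have h1 : a * l <= a by rewrite -[leRHS]mulr1 ler_wpM2l // ltW.
    have h2 : b * (r + s) < b by rewrite -[ltRHS]mulr1 ltr_pM2l //; clear - k0; lra.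
    by move: h2; rewrite mulrDr => h2; clear - h1 h2 ab; lra.
  have := mulr_gt0 h5 Dy; clear; lra.
- apply: (em p pV); exists r, s; split=> //; clear - k0; lra.
- apply: ouyp; rewrite pE comb_orient2 s0 mul0r //.
Qed.

(** If [r < 0], the segment [yp] crosses [uw], and [u] would see a vertex to the right of [uw]; if
    [r > 0], the vertex [p] is in the empty triangle [uyw]. *)
Lemma predecessor_right_empty F G H u w y p : frame F G H -> vis u w -> pcone F G H u w ->
  predecessor F G H u w y -> (forall q, ~ lower_left F H G u w q) -> pcone F G H y w ->
  ~ lower_left F H G y w p.
Proof.
move=> fr vw pw [ly ym em vyw] noB pyw [vp /pconeC pp _ Fp Dp].
have [vy py sy Fy Dy] := ly.
have [uV [wV [uw _]]] := vw; have [_ [yV [uy _]]] := vy; have [_ [pV _]] := vp.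
have D0 : det F G u w y <> 0 by move=> h; rewrite h ltxx in Dy.
have [r [s pE]] := det_coords p fr D0.
have [d1 d2 d3 d4] := det_comb u w y r s fr; rewrite -pE in d1 d2 d3 d4.
move: Dp; rewrite (det_swap y w p fr) d4 mulNr opprK => Dp.
have k0 : 0 < 1 - r - s by move: Dp; rewrite pmulr_lgt0.
have pu : pcone F G H u p := pcone_trans py pp.
have [pw1 pw2 pw3] := pw; have [py1 py2 py3] := py; have [pp1 pp2 pp3] := pp.
have s0 : 0 < s.
  have [e1 _ _] := frame_comb u y w r s fr; rewrite -pE in e1.
  have h1 : 0 < (1 - r - s) * (F y - F u) by rewrite mulr_gt0 // subr_gt0.
  have h2 : s * (F w - F y) = (F p - F y) + (1 - r - s) * (F y - F u) by rewrite e1; ring.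
  have h3 : 0 < s * (F w - F y) by rewrite h2; clear - h1 pp1; lra.
  by move: h3; rewrite pmulr_lgt0 // subr_gt0.
have up := pcone_neq pu.
have wp : w <> p by move=> e; rewrite e ltxx in Fp.
have ouwp : orient u w p <> 0 by apply: (orient_neq0 VS).
case: (ltgtP r 0) => [r0|r0|r0].
- have rn : 1 - r != 0 by rewrite gt_eqF //; lra.
  have r1 : 0 < 1 - r by lra.
  pose m := 1 / (1 - r); pose l := s / (1 - r).
  have m01 : 0 < m < 1 by rewrite divr_gt0 //= ltr_pdivrMr // mul1r; lra.
  have l01 : 0 < l < 1 by rewrite divr_gt0 //= ltr_pdivrMr // mul1r; lra.
  pose c := vadd y (vscale m (vsub p y)).
  have cE : c = vadd u (vscale l (vsub w u)).
    by rewrite /c pE /m /l; apply: pair_ext; rewrite /comb /vadd /vscale /vsub /=; field.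
  have [z [zV vz sz [a [b [a0 b0 ab zE]]]]] := crossing_visible_vertex VS vw vp l01 cE m01 erefl ouwp.
  have [l0 l1] := andP l01.
  have zE' : z = comb u y w (b * r) (a * l + b * s).
    by rewrite zE pE cE; point_ring.
  have [z1 _ _ _] := det_comb u w y (b * r) (a * l + b * s) fr; rewrite -zE' in z1.
  have pc : pcone F G H u c.
    have [e1 e2 e3] := frame_ray u w l fr; rewrite cE /pcone e1 e2 e3.
    by rewrite ltrDl !gtrDl (pmulr_rgt0 _ l0) !(pmulr_rlt0 _ l0) subr_gt0 !subr_lt0.
  have pz : pcone F G H u z by rewrite zE; apply: pcone_comb.
  apply: (noB z); split=> //; first exact/pconeC.
  - have [e1 _ _] := frame_comb u c p a b fr; rewrite zE e1.
    have [e2 _ _] := frame_ray u w l fr; rewrite -cE in e2; rewrite e2.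
    have h1 : l * (F w - F u) <= F w - F u by rewrite ger_pMl ?subr_gt0 // ltW.
    have h2 : b * (F p - F u) < b * (F w - F u) by rewrite ltr_pM2l // ltrD2r.
    have h3 : a * (l * (F w - F u)) <= a * (F w - F u) by rewrite ler_wpM2l.
    have h4 : (a + b) * (F w - F u) <= 1 * (F w - F u) by rewrite ler_pM2r // subr_gt0.
    by clear - h2 h3 h4; lra.
  - rewrite (det_swap u w z fr) z1 -mulNr mulr_gt0 // -mulrN mulr_gt0 //; clear - r0; lra.
- apply: (em p pV); exists r, s; split=> //; clear - k0; lra.
- apply: ouwp; rewrite orient_swap pE comb_orient1 r0 mul0r oppr0 //.
Qed.

(** By extremality of [y], the vertex [p] of the sector between [uy] and [uw] is not on the near
    side of the line [yw], and [y] is lower than [w]. *)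
Lemma predecessor_above F G H u w y p : frame F G H -> pcone F G H u w ->
  predecessor F G H u w y -> lower_left F G H u w p -> det F G u y p < 0 -> F y < F p.
Proof.
move=> fr pw [[vy py sy Fy Dy] ym _ _] lp Dp.
have := ym p lp; case: lp => [vp pp sp Fp Dwp].
have D0 : det F G u w y <> 0 by move=> h; rewrite h ltxx in Dy.
have [r [s pE]] := det_coords p fr D0.
have [d1 d2 d3 d4] := det_comb u w y r s fr; rewrite -pE in d1 d2 d3 d4.
rewrite d3 mulNr oppr_ge0 (pmulr_lle0 _ Dy) => k0.
have r0 : 0 < r by move: Dwp; rewrite d1 pmulr_lgt0.
have s0 : 0 < s by move: Dp; rewrite d2 mulNr oppr_lt0 pmulr_lgt0.
have [e1 _ _] := frame_comb u y w r s fr; rewrite -pE in e1; rewrite e1.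
case: py => py1 _ _.
have h1 : s * (F y - F u) < s * (F w - F u) by rewrite ltr_pM2l // ltrD2r.
have h2 : 1 * (F y - F u) <= (r + s) * (F y - F u).
  by rewrite ler_pM2r ?subr_gt0 //; clear - k0; lra.
by move: h2; rewrite mulrDl mul1r => h2; clear - h1 h2; lra.
Qed.

Lemma predecessor_no_right F G H u w y : frame F G H -> vis u w -> pcone F G H u w ->
  predecessor F G H u w y -> (forall q, ~ lower_left F H G u w q) ->
  forall q, ~ lower_left F H G u y q.
Proof.
move=> fr vw pw py noB q [vq /pconeC pq sq Fq Dq].
have [[vy pyc sy Fy Dy] _ _ _] := py.
have sw : same u w q := same_side_ptrans VS fr pw pyc pq vw vy vq sy sq.
have Fqw : F q < F w := lt_trans Fq Fy.
have [uV [wV _]] := vw; have [_ [qV _]] := vq.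
have wq : w <> q by move=> e; rewrite e ltxx in Fqw.
have := det_neq0 fr uV wV qV (pcone_neq pw) (pcone_neq pq) wq.
case: (ltgtP (det F G u w q) 0) => [lt _|gt _|//].
  by apply: (noB q); split=> //; [exact/pconeC|rewrite (det_swap u w q fr) oppr_gt0].
have lq : lower_left F G H u w q by split.
have := predecessor_above fr pw py lq.
by rewrite -oppr_gt0 -(det_swap u y q fr) => /(_ Dq); rewrite ltNge (ltW Fq).
Qed.

Lemma predecessor_lower_left F G H u w y z : frame F G H -> vis u w -> pcone F G H u w ->
  predecessor F G H u w y -> lower_left F G H u y z -> lower_left F G H u w z.
Proof.
move=> fr vw pw [[vy py sy Fy Dy] _ _ _] [vz pz sz Fz Dz]; split=> //.
- exact: (same_side_ptrans VS fr pw py pz).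
- exact: lt_trans Fy.
have D0 : det F G u w y <> 0 by move=> h; rewrite h ltxx in Dy.
have [r [s zE]] := det_coords z fr D0.
have [d1 d2 _ _] := det_comb u w y r s fr; rewrite -zE in d1 d2.
rewrite d1 mulr_gt0 //; have s0 : s < 0 by move: Dz; rewrite d2 pmulr_lgt0 // oppr_gt0.
have [e1 _ _] := frame_comb u y w r s fr; rewrite -zE in e1.
case: pz pw py => pz1 _ _ [pw1 _ _] [py1 _ _].
have h1 : s * (F w - F u) < 0 by rewrite nmulr_rlt0 // subr_gt0.
have h2 : 0 < r * (F y - F u) by clear - e1 pz1 h1; lra.
by move: h2; rewrite pmulr_lgt0 // subr_gt0.
Qed.

End Predecessor.

(** * The induction for stretch 2, and its consequences for [g10] *)

Section Spanner.
Variable R : realType.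
Variables (V : seq (point R)) (S : seq (seq (point R))).
Hypothesis VS : valid_setting V S.
Implicit Types (a b c d e n p q u v w x y z : point R).
Implicit Types (F G H : point R -> R).
Notation out := (out_edge V S).
Notation vis := (vis_edge V S).
Notation same := (same_side S).
Notation lower_left := (lower_left V S).
Notation predecessor := (predecessor V S).

Lemma ginf_sym x y : ginf V S x y -> ginf V S y x.
Proof. by case=> h; [right|left]. Qed.

(** On the bisector [dG = dH = - dF / 2]; in the cone [F] the condition means that [dG] is at least
    as large as [dH] in absolute value. *)
Definition leans F G u w : Prop := 2 * (G w - G u) <= - (F w - F u).
(** For [w] in the cone [F] of [u]: the length of the way along the cone triangle with [w] on its
    base, through the corner with [dG = 0]. Being linear, it telescopes along walks, whatever cones
    the steps lie in. *)
Definition bound F G u w : R := kappa R * ((F w - F u) - (G w - G u)).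

Lemma bound_split F G u y w : bound F G u y + bound F G y w = bound F G u w.
Proof. by rewrite /bound -mulrDr; congr (_ * _); ring. Qed.

Lemma bound_flip F G u w : bound G F w u = bound F G u w.
Proof. by rewrite /bound; congr (_ * _); ring. Qed.

Lemma leans_or F G H u w : frame F G H -> leans F G u w \/ leans F H u w.
Proof.
move=> fr; rewrite /leans (frame_sum u fr) (frame_sum w fr).
by case: (leP (2 * (G w - G u)) (- (F w - F u))) => h; [left|right; lra].
Qed.

Lemma leans_bound F G H u w : frame F G H -> leans F H u w -> bound F G u w <= bound F H u w.
Proof.
move=> fr; rewrite /leans /bound ler_pM2l ?kappa_gt0 // (frame_sum u fr) (frame_sum w fr).
lra.
Qed.

(** Common form of the slope comparisons below: [W] is a determinant, and the equation is a
    comparison of slopes with denominators cleared. *)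
Lemma scaled_le0 (A X Y Z W : R) : 0 < A -> Y <= 0 -> 0 < Z -> 0 <= W ->
  A * X = Y * Z - 2 * W -> X <= 0.
Proof. by move=> A0 Y0 Z0 W0 e; rewrite -(pmulr_rle0 _ A0) e; nra. Qed.

Lemma leans_from_apex F G u w z : F u < F w -> F z < F w -> leans F G u w ->
  0 < det F G u w z -> leans F G z w.
Proof.
rewrite /leans -subr_gt0 -(subr_gt0 (F z)) => A0 Z0 l d.
have := @scaled_le0 (F w - F u) (2 * (G w - G z) + (F w - F z))
  (2 * (G w - G u) + (F w - F u)) (F w - F z) (det F G u w z) A0 _ Z0 (ltW d).
by rewrite /det => h; have := h _ _; lra.
Qed.

Lemma leans_steeper F G w y z : F y < F w -> F z < F w -> leans F G y w ->
  0 <= det F G w z y -> leans F G z w.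
Proof.
rewrite /leans -subr_gt0 -(subr_gt0 (F z)) => A0 Z0 l d.
have := @scaled_le0 (F w - F y) (2 * (G w - G z) + (F w - F z))
  (2 * (G w - G y) + (F w - F y)) (F w - F z) (det F G w z y) A0 _ Z0 d.
by rewrite /det => h; have := h _ _; lra.
Qed.

Lemma leans_chain F G w y z : F z < F y -> F y < F w -> leans F G y w ->
  0 <= det F G w z y -> leans F G z y.
Proof.
rewrite /leans -subr_gt0 -(subr_gt0 (F y)) => Z0 A0 l d.
have := @scaled_le0 (F w - F y) (2 * (G y - G z) + (F y - F z))
  (2 * (G w - G y) + (F w - F y)) (F y - F z) (det F G w z y) A0 _ Z0 d.
by rewrite /det => h; have := h _ _; lra.
Qed.

Lemma leans_opposite F G H u w y : frame F G H -> F u < F w -> F u < F y -> leans F H u w ->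
  0 < det F G u w y -> leans F H u y.
Proof.
move=> fr; rewrite /leans -subr_gt0 -(subr_gt0 (F u) (F y)) => A0 Z0 l d.
have := @scaled_le0 (F w - F u) (2 * (H y - H u) + (F y - F u))
  (2 * (H w - H u) + (F w - F u)) (F y - F u) (det F G u w y) A0 _ Z0 (ltW d).
by rewrite /det !(frame_sum _ fr) in l * => h; have := h _ _; lra.
Qed.

(* The last two bounds make the induction work: the first applies when nothing is
   visible from [u] on the right of [uw], the second when the convex chain from
   the closest vertex [v] to [w] turns only through directions leaning right. *)
Definition span_claim F G H u w : Prop :=
  [/\ leans F G u w -> reach (ginf V S) (bound F G u w) u w,
      leans F H u w -> reach (ginf V S) (bound F H u w) u w,
      (forall p, ~ lower_left F H G u w p) -> reach (ginf V S) (bound F G u w) u w &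
      forall v, out F G H u v -> same u w v -> v = w \/ 0 < det F G u w v ->
        (forall z, lower_left F G H u w z -> leans F G z w) ->
        reach (ginf V S) (bound F G u w) u w].

(** Measure of the induction. It does not depend on the frame, so pairs in different cones can be
    compared. *)
Definition hexnorm u w : R := `|hex 0 w - hex 0 u| + `|hex 2 w - hex 2 u| + `|hex 4 w - hex 4 u|.

Lemma frame_hexnorm F G H u w : frame F G H -> pcone F G H u w -> hexnorm u w = 2 * (F w - F u).
Proof.
move=> fr [h1 h2 h3].
have -> : hexnorm u w = `|F w - F u| + `|G w - G u| + `|H w - H u|.
  by rewrite /hexnorm; case: fr {h1 h2 h3}; ring.
rewrite gtr0_norm ?subr_gt0 // !ltr0_norm ?subr_lt0 //.
by have := frame_sum u fr; have := frame_sum w fr; lra.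
Qed.

Definition span_below u w : Prop := forall u' w', hexnorm u' w' < hexnorm u w -> vis u' w' ->
  forall F G H, frame F G H -> pcone F G H u' w' -> span_claim F G H u' w'.

(** The walk is cut at the predecessor [y] of [w]; both pairs are smaller and the bounds add up
    exactly. The step from [y] to [w] is in the cone [F] of [y], or it reverses to the cone [G] of
    [w], where the third clause applies by [predecessor_side_empty]. *)
Lemma span_left F G H u w v : frame F G H -> vis u w -> pcone F G H u w -> span_below u w ->
  out F G H u v -> same u w v -> lower_left F G H u w v -> span_claim F G H u w.
Proof.
move=> fr vw pw IH ov sv lv.
have [y py] := predecessor_exists VS fr vw pw lv.
have [ly ym em vyw] := py; have [vy pcy sy Fy Dy] := ly.
have [pw1 pw2 pw3] := pw; have [py1 py2 py3] := pcy.
have [|c1 c2 c3 c4] := IH u y _ vy F G H fr pcy.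
  by rewrite (frame_hexnorm fr pcy) (frame_hexnorm fr pw); clear - Fy; lra.
have step_side : pcone G F H w y -> reach (ginf V S) (bound F G y w) y w.
  move=> pwy; rewrite -bound_flip; apply: (reach_sym ginf_sym).
  have [|_ _ h _] := IH w y _ (vis_edgeC vyw) G F H (frame_flip fr) pwy.
    rewrite (frame_hexnorm (frame_flip fr) pwy) (frame_hexnorm fr pw).
    have := frame_sum u fr; have := frame_sum w fr.
    by clear - pw3 py2; lra.
  by apply: h => p; exact: (predecessor_side_empty VS fr vw pw py pwy).
have below_yw : pcone F G H y w -> span_claim F G H y w.
  move=> pyw; apply: IH => //.
  by rewrite (frame_hexnorm fr pyw) (frame_hexnorm fr pw); clear - py1; lra.
have cone := predecessor_cone VS fr vw pw py.
(* The side condition of the fourth clause for [uy]: to the right of [uy], [v] would be higher than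
   [y] by [predecessor_above], although [u] chose it. *)
have v_left : v = y \/ 0 < det F G u y v.
  have [e|ne] := pselect (v = y); [by left|right].
  have [vv pv vm] := ov; have [uV [vV _]] := vv; have [_ [yV _]] := vy.
  have := det_neq0 VS fr uV yV vV (pcone_neq pcy) (pcone_neq pv) (nesym ne).
  case: (ltgtP (det F G u y v) 0) => // lt _.
  have := predecessor_above fr pw py lv lt; rewrite ltNge vm //.
  exact: (same_side_ptrans VS fr pv pw pcy vv vw vy (same_sideC sv) sy).
have syv : same u y v.
  have [vv pv _] := ov.
  exact: (same_side_ptrans VS fr pcy pw pv vy vw vv (same_sideC sy) sv).
have all_lean : (forall z, lower_left F G H u w z -> leans F G z w) ->
    reach (ginf V S) (bound F G u w) u w.
  move=> al; have lyw := al y ly.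
  rewrite -(bound_split F G u y w); apply: reach_trans.
    apply: (c4 v ov syv v_left) => z lz.
    have lz' := predecessor_lower_left VS fr vw pw py lz.
    by case: lz => _ _ _ Fz _; exact: leans_chain Fz Fy lyw (ym z lz').
  case: cone => [pyw|]; last exact: step_side.
  by have [h _ _ _] := below_yw pyw; apply: h.
split.
- move=> lw; apply: all_lean => z [_ _ _ Fz Dz].
  exact: leans_from_apex pw1 Fz lw Dz.
(* If [leans F G y w], extremality of [y] makes every [z] lean likewise, and [bound F G u w] is the
   smaller bound here. Otherwise [uy] and [yw] both satisfy [leans F H], and their second clauses
   are added. *)
- move=> lw; case: (leans_or y w fr) => lyw.
    apply: reach_le (leans_bound fr lw) _; apply: all_lean => z lz.
    have Fz : F z < F w by case: lz.
    exact: leans_steeper Fy Fz lyw (ym z lz).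
  rewrite -(bound_split F H u y w).
  have pyw : pcone F G H y w.
    case: cone => // -[g1 g2 g3]; exfalso; move: lyw; rewrite /leans => lyw.
    by clear - g2 g3 lyw; lra.
  apply: reach_trans; first by apply: c2; exact: leans_opposite fr pw1 py1 lw Dy.
  by have [_ h _ _] := below_yw pyw; apply: h.
- move=> noB; rewrite -(bound_split F G u y w); apply: reach_trans.
    by apply: c3; exact: (predecessor_no_right VS fr vw pw py).
  case: cone => [pyw|]; last exact: step_side.
  have [_ _ h _] := below_yw pyw; apply: h => p.
  exact: (predecessor_right_empty VS fr vw pw py noB).
- by move=> v' _ _ _; apply: all_lean.
Qed.

Lemma edge_bound F G H u w : frame F G H -> pcone F G H u w -> dist u w <= bound F G u w.
Proof.
move=> fr [h1 h2 h3]; apply: (dist_le fr); first by clear - h1 h2; lra.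
have p : 0 <= (F w - F u) * (G u - G w) by rewrite mulr_ge0 // subr_ge0 ltW.
rewrite -subr_ge0; have -> : (F w - F u - (G w - G u)) ^+ 2 - ((F w - F u) ^+ 2 +
  (F w - F u) * (G w - G u) + (G w - G u) ^+ 2) = 3 * ((F w - F u) * (G u - G w)) by ring.
by rewrite mulr_ge0.
Qed.

(** Only the last two clauses are not symmetric. A chosen [v] on the right refutes the hypothesis of
    the third and, being the only choice in its subcone, the side condition of the fourth. *)
Lemma span_swap F G H u w v : frame F G H -> vis u w -> pcone F G H u w -> out F G H u v ->
  same u w v -> lower_left F H G u w v -> span_claim F H G u w -> span_claim F G H u w.
Proof.
move=> fr vw pw ov sv lv [c1 c2 c3 c4]; split=> //.
  by move=> /(_ v lv).
move=> v' ov' sv' side _; exfalso.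
have [vv pv _] := ov; have [vv' pv' _] := ov'.
have e : v = v'.
  apply: (out_edge_unique VS fr ov ov').
  exact: (same_side_ptrans VS fr pv pw pv' vv vw vv' (same_sideC sv) sv').
case: lv => _ _ _ Fv Dv; move: Dv; rewrite (det_swap u w v fr) oppr_gt0 => Dv.
case: side; rewrite -e => h; first by rewrite h ltxx in Fv.
by move: h; rewrite ltNge ltW.
Qed.

Lemma span_step u w : vis u w -> span_below u w ->
  forall F G H, frame F G H -> pcone F G H u w -> span_claim F G H u w.
Proof.
move=> vw IH F G H fr pw.
have [v [ov sv Fv]] := out_edge_exists VS fr vw pw.
have [vv pv _] := ov; have [uV [vV _]] := vv; have [_ [wV _]] := vw.
have [e|ne] := pselect (v = w).
  have gw : ginf V S u w by rewrite -e; apply: ginf_sym; apply: (out_edge_ginf VS fr ov).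
  have r1 := reach_le (edge_bound fr pw) (reach_edge gw).
  have r2 := reach_le (edge_bound (frame_swap fr) (iffLR (pconeC _ _ _ _ _) pw)) (reach_edge gw).
  by split.
have [nF _ _] := frame_neq VS fr vV wV ne.
have Fvw : F v < F w by rewrite lt_neqAle Fv andbT; apply/eqP.
have := det_neq0 VS fr uV wV vV (pcone_neq pw) (pcone_neq pv) (nesym ne).
case: (ltgtP (det F G u w v) 0) => [lt _|gt _|//].
  have lv : lower_left F H G u w v.
    by split=> //; [exact/pconeC|rewrite (det_swap u w v fr) oppr_gt0].
  apply: (span_swap fr vw pw ov sv lv).
  exact: (span_left (frame_swap fr) vw (iffLR (pconeC _ _ _ _ _) pw) IH (out_edgeC ov) sv lv).
by apply: (span_left fr vw pw IH ov sv).
Qed.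

(** A real measure supports induction here because there are finitely many pairs of vertices. *)
Lemma vertex_pair_ind (m : point R -> point R -> R) (Q : point R -> point R -> Prop) :
  (forall u w, u \in V -> w \in V ->
     (forall u' w', u' \in V -> w' \in V -> m u' w' < m u w -> Q u' w') -> Q u w) ->
  forall u w, u \in V -> w \in V -> Q u w.
Proof.
move=> step u w.
pose pairs := [seq (x, y) | x <- V, y <- V].
pose N u w : pred (point R * point R) := fun k => m k.1 k.2 < m u w.
move: {2}(count (N u w) pairs).+1 (ltnSn (count (N u w) pairs)) => n.
elim: n u w => // n IH u w; rewrite ltnS => cn uV wV.
apply: step => // u' w' u'V w'V lt; apply: IH => //; apply: leq_trans cn.
apply: (@count_sub_lt _ _ _ _ (u', w')) => //.
- by move=> k; rewrite /N => h; apply: lt_trans lt.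
- exact: allpairs_f.
- by rewrite /N ltxx.
Qed.

Lemma visible_span u w : vis u w -> reach (ginf V S) (2 * dist u w) u w.
Proof.
move=> vw; have [uV [wV [uw _]]] := vw.
have claim : forall u w, u \in V -> w \in V -> vis u w ->
    forall F G H, frame F G H -> pcone F G H u w -> span_claim F G H u w.
  apply: (vertex_pair_ind (m := hexnorm)) => a b aV bV IH vab.
  apply: span_step => // u' w' lt vu'; have [u'V [w'V _]] := vu'.
  exact: IH.
(* The difference of the squares is a multiple of [3 (dF + dG)^2 = 3 dH^2], so the factor 2 is
   attained by this bound at [dH = 0]. *)
have two F G H x y : frame F G H -> pcone F G H x y -> bound F G x y <= 2 * dist x y.
  move=> fr [h1 h2 h3]; apply: (dist_ge fr) => //; first by clear - h1 h2; lra.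
  by have := sqr_ge0 ((F y - F x) + (G y - G x)); nra.
have pos F G H x y : vis x y -> frame F G H -> pcone F G H x y -> reach (ginf V S) (2 * dist x y) x y.
  move=> vxy fr pxy; have [xV [yV _]] := vxy.
  have [c1 c2 _ _] := claim x y xV yV vxy F G H fr pxy.
  case: (leans_or x y fr) => l.
    exact: reach_le (two F G H x y fr pxy) (c1 l).
  exact: reach_le (two F H G x y (frame_swap fr) (iffLR (pconeC _ _ _ _ _) pxy)) (c2 l).
have [F [G [H [fr []]]]] := frame_cover VS uV wV uw; first exact: pos.
move=> pwu; rewrite distC; apply: (reach_sym ginf_sym).
exact: pos (vis_edgeC vw) fr pwu.
Qed.

Lemma visible_reach_g10 u w : vis u w -> reach (g10 V S) (6 * dist u w) u w.
Proof.
move=> /visible_span [s [ws <- len]].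
by apply: reach_le (ginf_walk_reach VS ws); lra.
Qed.

Lemma out_edge_consecutive_ginf F G H v u w : frame F G H -> consecutive V S F G H v u w ->
  ginf V S u w.
Proof.
wlog Gl : F G H u w / G u < G w /\ H w < H u.
  move=> th fr co; case: (consecutive_order VS fr co) => [|[h1 h2]]; first by move=> h; apply: th co.
  exact: (th F H G u w (conj h2 h1) (frame_swap fr) (consecutive_swap co)).
move=> fr co; have [ou ow _ ne _] := co.
have [[uV _] _ _] := ou; have [[wV _] _ _] := ow.
have [nF _ _] := frame_neq VS fr uV wV ne; case: Gl => g h.
case: (ltgtP (F w) (F u)) => [lt|gt|e]; last by case: nF.
  by apply: ginf_sym; apply: (out_edge_ginf VS (frame_flip fr)); apply: (consecutive_out VS fr co).
have co' := consecutive_swap (consecutiveC VS fr co).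
exact: (out_edge_ginf VS (frame_flip (frame_swap fr)) (consecutive_out VS (frame_swap fr) co' h gt)).
Qed.

Lemma g10_edge_ginf x y : g10_edge V S x y -> ginf V S x y.
Proof.
case=> u [uV [j [nj [X [sX [[-> [g _ _]] //|cc]]]]]].
have [F [G [H [fr [j' ci]]]]] := negative_cone_frame R nj.
exact: (out_edge_consecutive_ginf fr (canon_consec_consecutive VS fr ci sX cc)).
Qed.

Lemma g10_ginf x y : g10 V S x y -> ginf V S x y.
Proof. by case=> /g10_edge_ginf // /ginf_sym. Qed.

Lemma ginf_visible x y : ginf V S x y -> vis x y.
Proof.
case=> /(ginf_dirP VS) [F [G [H [_ [h _ _]]]]] //; exact: vis_edgeC.
Qed.

Lemma g10_spanner : spanner V (g10 V S) vis 6.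
Proof.
split; first by move=> x y /g10_ginf/ginf_visible.
move=> x y _ _ s ws <-; elim: s x ws => [|z s IH] x /=; first by exists [::]; rewrite /= mulr0.
move=> [xz ws]; rewrite mulrDr; exact: reach_trans (visible_reach_g10 xz) (IH z ws).
Qed.

Lemma ginf_out x y : ginf V S x y -> exists F G H, frame F G H /\ (out F G H x y \/ out F G H y x).
Proof.
by case=> /(ginf_dirP VS) [F [G [H [fr o]]]]; exists F, G, H; split=> //; [left|right].
Qed.

Lemma ginf_plane : plane (ginf V S).
Proof.
move=> a b c d /ginf_out [F [G [H [fr o]]]] /ginf_out [F' [G' [H' [fr' o']]]] ns [x [xab xcd]].
apply: ns; case: o o' => o [] o'.
- exact: out_edges_plane fr fr' o o' xab xcd.
- by case: (out_edges_plane VS fr fr' o o' xab (open_segC xcd)) => -[-> ->]; [right|left].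
- by case: (out_edges_plane VS fr fr' o o' (open_segC xab) xcd) => -[-> ->]; [right|left].
- by case: (out_edges_plane VS fr fr' o o' (open_segC xab) (open_segC xcd)) => -[-> ->]; [left|right].
Qed.

Lemma g10_plane : plane (g10 V S).
Proof. by move=> a b c d /g10_ginf gab /g10_ginf gcd; apply: ginf_plane. Qed.

End Spanner.

(** * Degree *)

Lemma count_subsingletons (T : eqType) (n : nat) (c : nat -> T -> Prop) (q : pred T) (s : seq T) :
  uniq s -> (forall i, (i < n)%N -> forall x y, c i x -> c i y -> x = y) ->
  (forall x, x \in s -> q x -> exists2 i, (i < n)%N & c i x) -> (count q s <= n)%N.
Proof.
move=> us; elim: n q => [|n IH] q sub cov.
  rewrite leqNgt -has_count; apply/hasPn => x xs; apply/negP => qx.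
  by case: (cov x xs qx).
pose a : pred T := fun x => `[< c n x >].
pose q' : pred T := fun x => q x && ~~ a x.
have h1 : (count q' s <= n)%N.
  apply: IH; first by move=> i ni; apply: sub; apply: ltnW.
  move=> x xs /andP [qx nax]; have [i] := cov x xs qx.
  rewrite ltnS leq_eqVlt => /orP [/eqP -> cx|ni cx]; last by exists i.
  by case/asboolP: nax.
have h2 : (count a s <= 1)%N.
  case: (posnP (count a s)) => [-> //|]; rewrite -has_count => /hasP [x0 x0s /asboolP ax0].
  rewrite -[1%N]/(nat_of_bool true) -x0s -(count_uniq_mem x0 us); apply: sub_count => x /asboolP ax /=.
  by apply/eqP; apply: (sub n).
have h3 : (count q s <= count (predU a q') s)%N.
  by apply: sub_count => x qx /=; rewrite /q' qx /=; case: (a x).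
have := count_predUI a q' s; lia.
Qed.

Section Degree.
Variable R : realType.
Variables (V : seq (point R)) (S : seq (seq (point R))).
Hypothesis VS : valid_setting V S.
Implicit Types (a b c d e n p q u v w x y z : point R).
Implicit Types (F G H : point R -> R) (X : point R -> Prop).
Notation out := (out_edge V S).
Notation vis := (vis_edge V S).
Notation same := (same_side S).
Notation consecutive := (consecutive V S).

Lemma det_between F G H u p q z : frame F G H -> 0 < det F G u p q -> 0 < det F G u z q ->
  0 < det F G u p z -> exists r s : R, [/\ 0 < r, 0 < s & z = comb u p q r s].
Proof.
move=> fr dpq dzq dpz; have [k k0 kE] := frame_orient fr.
have o0 : orient u p q <> 0.
  by rewrite kE => /eqP; rewrite mulf_eq0 (negPf k0) gt_eqF.
exists (orient u z q / orient u p q), (orient u p z / orient u p q); split.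
- by rewrite !kE -mulf_div divff // mul1r divr_gt0.
- by rewrite !kE -mulf_div divff // mul1r divr_gt0.
exact: comb_coords.
Qed.

Lemma det_pcone_side F G H u v x : pcone F G H u v -> F u < F x -> G u < G x -> 0 < det F G u v x.
Proof.
case=> h1 h2 h3 f g; rewrite /det.
have a1 : 0 < (F v - F u) * (G x - G u) by rewrite mulr_gt0 // subr_gt0.
have a2 : 0 < (G u - G v) * (F x - F u) by rewrite mulr_gt0 // subr_gt0.
have -> : (F v - F u) * (G x - G u) - (G v - G u) * (F x - F u) =
  (F v - F u) * (G x - G u) + (G u - G v) * (F x - F u) by ring.
by rewrite addr_gt0.
Qed.

Lemma det_pcone_next F G H u v x : frame F G H -> pcone F G H u v -> pcone G F H u x ->
  0 < det F G u v x.
Proof.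
move=> fr [h1 h2 h3] [k1 k2 k3].
have -> : det F G u v x = (G u - G v) * (H u - H x) + (H u - H v) * (G x - G u).
  by rewrite /det !(frame_sum _ fr); ring.
by rewrite addr_gt0 // mulr_gt0 // subr_gt0.
Qed.

(** A vertex in the sector between [v] and [x] is on the side of [v] when [x] is; so [v'] would be
    the same choice as [v]. *)
Lemma out_edge_sector_unique F G H u v v' x : frame F G H -> out F G H u v -> out F G H u v' ->
  same u v x -> 0 < det F G u v x -> 0 < det F G u v' x -> 0 < det F G u v v' -> False.
Proof.
move=> fr ov ov' sx d1 d2 d3.
have [r [s [r0 s0 v'E]]] := det_between fr d1 d2 d3.
have e : v = v'.
  by apply: (out_edge_unique VS fr ov ov'); rewrite v'E; apply: same_side_sub => //; apply: ltW.
by move: d3; rewrite e /det mulrC subrr ltxx.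
Qed.

Lemma consecutive_same F G H v u x : frame F G H -> consecutive F G H v u x -> same u v x.
Proof.
by move=> fr co; apply: free_same_side1; apply: free_tri_rot; apply: (consecutive_free VS fr co).
Qed.

(* The inequalities place [x] in a negative cone of [u]. *)
Definition side_nbr F G H u x : Prop :=
  exists v, [/\ out F G H u v, consecutive F G H v u x, G u < G x & F u < F x].

(** If the choices [v] and [v'] differ, one of them is in the sector between the other and its
    neighbour, against [out_edge_sector_unique]. If they agree, the neighbour with the smaller [G]
    is between [u] and the other one in the canonical sequence of [v]. *)
Lemma side_nbr_unique F G H u x x' : frame F G H -> side_nbr F G H u x -> side_nbr F G H u x' ->
  x = x'.
Proof.
move=> fr [v [ov co g f]] [v' [ov' co' g' f']].
have [_ pv _] := ov; have [_ pv' _] := ov'.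
have [ev|nv] := pselect (v = v'); last first.
  have [[uV [vV _]] [[_ [vV' _]] _]] := ((let: And3 h _ _ := ov in h), ((let: And3 h _ _ := ov' in h), tt)).
  have := det_neq0 VS fr uV vV vV' (pcone_neq pv) (pcone_neq pv') nv.
  case: (ltgtP (det F G u v v') 0) => [lt|gt|//] _; exfalso.
    apply: (out_edge_sector_unique fr ov' ov (consecutive_same fr co')).
    - exact: (det_pcone_side pv').
    - exact: (det_pcone_side pv).
    - by rewrite detC oppr_gt0.
  apply: (out_edge_sector_unique fr ov ov' (consecutive_same fr co)) => //.
  - exact: (det_pcone_side pv).
  - exact: (det_pcone_side pv').
subst v'.
clear ov' pv'; wlog lt : x x' co co' g g' f f' / G x < G x'.
  move=> th; have [e|ne] := pselect (x = x'); first by [].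
  have [_ [[xV _] _ _] _ _ _] := co; have [_ [[xV' _] _ _] _ _ _] := co'.
  have [_ nG _] := frame_neq VS fr xV xV' ne.
  case: (ltgtP (G x) (G x')) => [lt|gt|//]; first exact: th.
  by apply: esym; apply: th.
exfalso; have [ou ox sx _ _] := co; have [_ ox' sx' _ nob] := co'.
have [[uV _] [pu1 pu2 pu3] _] := ou; have [vx [px1 px2 px3] _] := ox.
have [vx' [px1' px2' px3'] _] := ox'.
have sxx' : same v x x'.
  have [vu pu _] := ou; have [_ px _] := ox; have [_ px' _] := ox'.
  exact: (same_side_ntrans VS fr px pu px' (vis_edgeC vx) (vis_edgeC vu) (vis_edgeC vx') (same_sideC sx) sx').
have ord a b : out F G H a v -> out F G H b v -> same v a b -> G a < G b -> H b < H a.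
  move=> oa ob sab ab; rewrite ltNge; apply/negP => le.
  have [[aV _] _ _] := oa; have [[bV _] _ _] := ob.
  have ne : a <> b by move=> e; rewrite e ltxx in ab.
  have [_ _ nH] := frame_neq VS fr aV bV ne.
  apply: (in_neighbors_order VS fr oa ob sab (ltW ab)).
  by rewrite lt_neqAle le andbT; apply/eqP.
have h1 := ord u x ou ox sx g; have h2 := ord x x' ox ox' sxx' lt.
have d a b : G v < G a -> H v < H b -> G a < G b -> H b < H a -> 0 < det H G v a b.
  move=> ga hb gab hba; rewrite /det.
  have a1 : 0 < (H a - H b) * (G b - G v) by rewrite mulr_gt0 // subr_gt0 // (lt_trans ga).
  have a2 : 0 < (H b - H v) * (G b - G a) by rewrite mulr_gt0 // subr_gt0.
  have -> : (H a - H v) * (G b - G v) - (G a - G v) * (H b - H v) =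
    (H a - H b) * (G b - G v) + (H b - H v) * (G b - G a) by ring.
  by rewrite addr_gt0.
have fr' : frame H G F by apply: frame_flip; apply: frame_swap; apply: frame_flip.
have [|||r [s [r0 s0 xE]]] := @det_between H G F v u x' x fr'.
- by apply: d => //; apply: lt_trans h1.
- exact: d.
- exact: d.
exact: (nob x ox sx r s r0 s0 xE).
Qed.

(* The slot of the cone [F] on the side of [G]. *)
Definition slot F G H u x : Prop := side_nbr F G H u x \/
  [/\ forall x', ~ side_nbr F G H u x', out F G H u x &
      forall v, out F G H u v -> v <> x -> 0 < det F G u v x].

Lemma slot_unique F G H u x x' : frame F G H -> slot F G H u x -> slot F G H u x' -> x = x'.
Proof.
move=> fr [s|[n o h]] [s'|[n' o' h']].
- exact: side_nbr_unique fr s s'.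
- by case: (n' x s).
- by case: (n x' s').
apply: contrapT => ne; have d1 := h x' o' (nesym ne); have := h' x o ne.
by rewrite detC oppr_gt0 => d2; have := lt_trans d1 d2; rewrite ltxx.
Qed.

(** The factor [orient u p q] frees the conclusion from the order of [p] and [q] around [u]. *)
Lemma not_same_side_wedge u p q : ~ same u p q -> exists O e1 e2,
  [/\ O \in S, u \in O, corner_nbrs O u e1 e2, 0 < orient u e1 e2 &
   forall e, e = e1 \/ e = e2 ->
    0 <= orient u p e * orient u p q /\ 0 <= orient u e q * orient u p q].
Proof.
move=> ns; have [|] : separated S u p q \/ separated S u q p.
- by apply: contrapT => /not_orP.
- move=> [o0 [O [e1 [e2 [[OS uO nb e12 _] [[a1 a2] [b1 b2]]]]]]].
  exists O, e1, e2; split=> // e [->|->]; split; apply: mulr_ge0 => //; exact: ltW.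
- move=> [o0 [O [e1 [e2 [[OS uO nb e12 _] [[a1 a2] [b1 b2]]]]]]].
  exists O, e1, e2; split=> // e; rewrite (orient_swap u q p) (orient_swap u e p) (orient_swap u q e) !mulrNN.
  by case=> ->; split; apply: mulr_ge0 => //; exact: ltW.
Qed.

(** Distinct choices in a cone are separated by the one obstacle at [u]. Both its edges at [u] would
    lie in the sectors on either side of [x], hence both would end at [x]. *)
Lemma out_edges_at_most_two F G H u x v v' : frame F G H -> out F G H u x -> out F G H u v ->
  out F G H u v' -> 0 < det F G u x v -> 0 < det F G u v' x -> False.
Proof.
move=> fr ox ov ov' d1 d2.
have [vx px _] := ox; have [uV [xV [ux _]]] := vx.
have ns w : out F G H u w -> w <> x -> ~ same u x w.
  by move=> ow wx sw; apply: wx; apply: esym; apply: (out_edge_unique VS fr ox ow).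
have vx' : v <> x by move=> e; move: d1; rewrite e /det mulrC subrr ltxx.
have v'x : v' <> x by move=> e; move: d2; rewrite e /det mulrC subrr ltxx.
have [O [e1 [e2 [OS uO nb e12 h]]]] := not_same_side_wedge (ns v ov vx').
have [O' [f1 [f2 [OS' uO' nb' f12 h']]]] := not_same_side_wedge (fun s => ns v' ov' v'x (same_sideC s)).
have eO := obstacle_unique VS OS' OS uO' uO; rewrite eO in nb'.
have mem e : e = e1 \/ e = e2 -> e = f1 \/ e = f2.
  by case: nb nb' => -[-> ->] [] [-> ->] [] ->; auto.
have [k k0 kE] := frame_orient fr.
have k2 : 0 < k ^+ 2 by rewrite exprn_even_gt0.
have zero e : e = e1 \/ e = e2 -> orient u x e = 0.
  move=> ee; have [a1 _] := h e ee; have [_ a2] := h' e (mem e ee).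
  move: a1 a2; rewrite !kE.
  have -> : k * det F G u x e * (k * det F G u x v) = k ^+ 2 * (det F G u x e * det F G u x v) by ring.
  have -> : k * det F G u e x * (k * det F G u v' x) = - (k ^+ 2 * (det F G u x e * det F G u v' x)).
    by rewrite (detC F G u x e); ring.
  rewrite oppr_ge0 (pmulr_rge0 _ k2) (pmulr_lge0 _ d1) (pmulr_rle0 _ k2) (pmulr_lle0 _ d2) => a1 a2.
  by apply/eqP; rewrite mulf_eq0 (negPf k0) /= eq_le a1 a2.
have [_ e1V e2V [e1u e2u e12']] := corner_nbr_mem VS OS uO nb.
case: (collinear_eq VS uV xV e1V ux (zero e1 (or_introl erefl))) => // E1.
by case: (collinear_eq VS uV xV e2V ux (zero e2 (or_intror erefl))) => // E2; apply: e12'; rewrite E1.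
Qed.

(** The vertex [x'] is in the sector from [ux] to [uv]: either in the empty triangle [uxv], or on
    [xv], which general position forbids, or beyond it, where [ux'] crosses [xv] against
    planarity. *)
Lemma side_target_not_consecutive F G H u x x' v : frame F G H -> pcone F G H u x ->
  consecutive G F H v u x -> consecutive F G H x u x' -> G u < G x' -> F u < F x' -> False.
Proof.
move=> fr px co co' g f; have fr' := frame_flip fr.
have [ou ox _ _ _] := co; have [ou' ox' _ ux' _] := co'.
have [vu pu _] := ou; have [vxv pxv _] := ox; have [vx'x px'x _] := ox'.
have [uV [vV [uv _]]] := vu; have [xV _] := vxv; have [x'V [_ [x'x _]]] := vx'x.
have d1 := det_pcone_side px f g.
have d2 := det_pcone_next fr px pu.
have d3 : 0 < det F G u x' v.
  rewrite /det; case: pu => p1 p2 p3.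
  have a1 : 0 < (F x' - F u) * (G v - G u) by rewrite mulr_gt0 // subr_gt0.
  have a2 : 0 < (G x' - G u) * (F u - F v) by rewrite mulr_gt0 // subr_gt0.
  have -> : (F x' - F u) * (G v - G u) - (G x' - G u) * (F v - F u) =
    (F x' - F u) * (G v - G u) + (G x' - G u) * (F u - F v) by ring.
  by rewrite addr_gt0.
have x'v : x' <> v by move=> e; rewrite e in f; case: pu => _ h _; rewrite ltNge (ltW h) in f.
have [r [s [r0 s0 x'E]]] := det_between fr d2 d3 d1.
have rs0 : 0 < r + s by rewrite addr_gt0.
have rsn : r + s != 0 by rewrite gt_eqF.
case: (ltgtP (r + s) 1) => rs.
- apply: (consecutive_empty VS fr' co x'V); apply: in_tri_rot; apply: in_triC; by exists r, s.
- pose c := vadd u (vscale (1 / (r + s)) (vsub x' u)).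
  have c1 : open_seg u x' c.
    by exists (1 / (r + s)); split=> //; rewrite divr_gt0 //= ltr_pdivrMr // mul1r.
  have c2 : open_seg x v c.
    exists (s / (r + s)); split; first by rewrite divr_gt0 //= ltr_pdivrMr // mul1r; clear - r0; lra.
    by rewrite /c x'E; apply: pair_ext; rewrite /comb /vadd /vscale /vsub /=; field.
  have g1 : ginf V S u x' := out_edge_consecutive_ginf VS fr co'.
  have g2 : ginf V S x v := ginf_sym (out_edge_ginf VS fr' ox).
  apply: (ginf_plane VS g1 g2); last by exists c.
  by case=> -[e _]; [exact: pcone_neq px e|exact: uv e].
- have : orient x v x' = 0.
    apply: on_seg_orient; exists s; split; first by apply/andP; split; clear - r0 s0 rs; lra.
    rewrite x'E; have -> : r = 1 - s by clear - rs; lra.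
    by point_ring.
  have xv : x <> v by case: vxv => _ [_ []].
  by case/(collinear_eq VS xV vV x'V xv).
Qed.

(* The ways in which the target of an out-edge of [u] can be adjacent to [u]. *)
Definition target_source F G H u x : Prop :=
  [\/ forall w, out F G H w x -> same x u w -> F w <= F u,
      exists v, consecutive G F H v u x | exists v, consecutive H F G v u x].

Lemma target_sourceC F G H u x : target_source F G H u x -> target_source F H G u x.
Proof.
case=> h; [constructor 1|constructor 3|constructor 2] => //.
by move=> w /out_edgeC; apply: h.
Qed.

(** As [u] has at most two choices in a cone and [v] is on one side of [x], the vertex [x] is the
    extreme choice on the other side. Each case of [target_source] excludes a side neighbour
    there. *)
Lemma target_slot_right F G H u x v : frame F G H -> out F G H u x -> target_source F G H u x ->
  out F G H u v -> 0 < det F G u x v -> slot F H G u x.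
Proof.
move=> fr ox src ov d.
have fr' := frame_swap fr.
have [vx px _] := ox; have [uV [xV _]] := vx.
have vs w : out F G H u w -> w <> x -> 0 < det F G u x w.
  move=> ow wx; have [[_ [wV _]] pw _] := ow.
  have := det_neq0 VS fr uV xV wV (pcone_neq px) (pcone_neq pw) (nesym wx).
  case: (ltgtP (det F G u x w) 0) => // lt _.
  by case: (out_edges_at_most_two fr ox ov ow d); rewrite detC oppr_gt0.
right; split.
- move=> x' [w [ow co h f]].
  have [wx|wx] := pselect (w = x); last first.
    have dw := vs w (out_edgeC ow) wx; have [_ pw _] := ow.
    apply: (out_edge_sector_unique fr' ow (out_edgeC ox) (consecutive_same fr' co)).
    - exact: (det_pcone_side pw).
    - exact: (det_pcone_side (iffLR (pconeC _ _ _ _ _) px)).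
    - by rewrite (det_swap u w x fr) detC opprK.
  rewrite wx in co; case: src => [cl|[t co2]|[t co2]].
  - have [_ ox' sx' _ _] := co.
    by have := cl x' (out_edgeC ox') sx'; rewrite leNgt f.
  - have [out_t _ _ _ _] := co2; have [_ pt _] := out_t; have [_ pv _] := ov.
    apply: (out_edge_sector_unique fr ox ov (same_sideC (consecutive_same (frame_flip fr) co2))) => //.
      exact: det_pcone_next fr px pt.
    exact: det_pcone_next fr pv pt.
  - exact: (side_target_not_consecutive fr' (iffLR (pconeC _ _ _ _ _) px) co2 co).
- exact: out_edgeC.
- move=> w /out_edgeC ow wx; rewrite (det_swap u w x fr) detC opprK; exact: vs.
Qed.

Lemma target_slot F G H u x : frame F G H -> out F G H u x -> target_source F G H u x ->
  slot F G H u x \/ slot F H G u x.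
Proof.
move=> fr ox src; have fr' := frame_swap fr.
have [vx px _] := ox; have [uV [xV _]] := vx.
have [[v [ov d]]|n1] := pselect (exists v, out F G H u v /\ 0 < det F G u x v).
  by right; apply: (target_slot_right fr ox src ov d).
have [[v [ov d]]|n2] := pselect (exists v, out F G H u v /\ det F G u x v < 0).
  left; apply: (@target_slot_right F H G u x v) => //; try exact: out_edgeC.
    exact: target_sourceC.
  by rewrite (det_swap u x v fr) oppr_gt0.
have only v : out F G H u v -> v = x.
  move=> ov; apply: contrapT => ne; have [[_ [vV _]] pv _] := ov.
  have := det_neq0 VS fr uV xV vV (pcone_neq px) (pcone_neq pv) (nesym ne).
  case: (ltgtP (det F G u x v) 0) => [lt|gt|//] _; first by apply: n2; exists v.
  by apply: n1; exists v.
have onlyC v : out F H G u v -> v = x by move=> /out_edgeC; apply: only.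
case: src => [cl|[t co]|[t co]].
- left; right; split=> // [x' [v [ov co g f]]|v ov ne]; last by case: ne; apply: only.
  rewrite (only v ov) in co; have [_ ox' sx' _ _] := co.
  by have := cl x' ox' sx'; rewrite leNgt f.
- left; right; split=> // [x' [v [ov co' g f]]|v ov ne]; last by case: ne; apply: only.
  rewrite (only v ov) in co'; exact: (side_target_not_consecutive fr px co co').
- right; right; split=> // [x' [v [ov co' g f]]||v ov ne]; last by case: ne; apply: onlyC.
    rewrite (onlyC v ov) in co'.
    exact: (side_target_not_consecutive fr' (iffLR (pconeC _ _ _ _ _) px) co co').
  exact: out_edgeC.
Qed.

(** With [G] increasing from [u] to [x], a larger [F] makes [x] a side neighbour; otherwise [u]
    chooses [x] in the cone [G], and [target_slot] applies there. *)
Lemma consecutive_slot F G H v u x : frame F G H -> consecutive F G H v u x ->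
  exists F' G' H', frame F' G' H' /\ slot F' G' H' u x.
Proof.
wlog gh : G H / G u < G x.
  move=> th fr co; case: (consecutive_order VS fr co) => -[g h]; first exact: th g fr co.
  exact: th h (frame_swap fr) (consecutive_swap co).
move=> fr co; have [ou ox _ ne _] := co.
have [[uV _] _ _] := ou; have [[xV _] _ _] := ox.
have [nF _ _] := frame_neq VS fr uV xV ne.
case: (ltgtP (F u) (F x)) => [lt|gt|//].
  by exists F, G, H; split=> //; left; exists v.
have o := consecutive_out VS fr co gh gt; have fr' := frame_flip fr.
have [|s|s] := target_slot fr' o; first by constructor 2; exists v.
  by exists G, F, H.
by exists G, H, F; split=> //; apply: frame_swap.
Qed.

(** The unsplit cone or its clockwise part. The counterclockwise part goes to [extra_closest], one
    class for the three negative cones, since at most one of them is split. *)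
Definition main_closest j u x : Prop := exists X,
  [/\ subcone V S u j X, closest_nb V S u j X x &
   forall O e1 e2, splits V S u j O e1 e2 -> X = cw_side u j e1].

Definition extra_closest u x : Prop := exists j O e1 e2,
  [/\ negative_cone j, splits V S u j O e1 e2 & closest_nb V S u j (ccw_side u j e2) x].

Lemma closest_nb_unique j u X x x' : negative_cone j -> closest_nb V S u j X x ->
  closest_nb V S u j X x' -> x = x'.
Proof.
move=> nj [g Xx m] [g' Xx' m'].
have [F [G [H [fr [j' [_ _ _ h4]]]]]] := negative_cone_frame R nj.
have [_ [xV _]] := ginf_visible VS g; have [_ [xV' _]] := ginf_visible VS g'.
apply: contrapT => ne; have [nF _ _] := frame_neq VS fr xV xV' ne; apply: nF.
by have := m x' g' Xx'; have := m' x g Xx; rewrite !h4; lra.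
Qed.

Lemma main_closest_unique j u x x' : negative_cone j -> main_closest j u x ->
  main_closest j u x' -> x = x'.
Proof.
move=> nj [X [sX cX h]] [X' [sX' cX' h']].
have e : X = X'.
  have [[O [e1 [e2 sp]]]|ns] := pselect (exists O e1 e2, splits V S u j O e1 e2).
    by rewrite (h _ _ _ sp) (h' _ _ _ sp).
  case: sX => [[O [e1 [e2 [sp _]]]]|[_ ->]]; first by case: ns; exists O, e1, e2.
  by case: sX' => [[O [e1 [e2 [sp _]]]]|[_ ->]] //; case: ns; exists O, e1, e2.
by rewrite -e in cX'; apply: closest_nb_unique nj cX cX'.
Qed.

Lemma negative_cone_unique j j' u v : negative_cone j -> negative_cone j' ->
  in_cone u j v -> in_cone u j' v -> j = j'.
Proof.
have [[_ i3 _ _] [_ i5 _ _] [_ i1 _ _]] := cone_indexes R.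
case: j => [|[|[|[|[|[|j]]]]]] // _; case: j' => [|[|[|[|[|[|j']]]]]] // _;
  rewrite ?i1 ?i3 ?i5 // => -[p1 p2 p3] [q1 q2 q3]; exfalso; lra.
Qed.

Lemma extra_closest_unique u x x' : extra_closest u x -> extra_closest u x' -> x = x'.
Proof.
move=> [j [O [e1 [e2 [nj sp c]]]]] [j' [O' [e1' [e2' [nj' sp' c']]]]].
have [_ e1E e2E] := splits_unique VS sp sp'.
have [_ [_ [_ [_ [c1 _]]]]] := sp; have [_ [_ [_ [_ [c1' _]]]]] := sp'.
rewrite e1E in c1'; have ej := negative_cone_unique nj nj' c1 c1'.
rewrite e2E -ej in c'; exact: closest_nb_unique nj c c'.
Qed.

Lemma g10_neighbor_cases u x : g10 V S u x ->
  [\/ exists F G H, frame F G H /\ slot F G H u x,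
      exists2 j, negative_cone j & main_closest j u x | extra_closest u x].
Proof.
have cons t j X v w : negative_cone j -> subcone V S t j X -> canon_consec V S t X v w ->
    exists F G H, frame F G H /\ consecutive F G H t v w.
  move=> nj sX cc; have [F [G [H [fr [j' ci]]]]] := negative_cone_frame R nj.
  by exists F, G, H; split=> //; apply: (canon_consec_consecutive VS fr ci sX cc).
case=> -[t [tV [j [nj [X [sX [[e cl]|cc]]]]]]].
- rewrite -e in sX cl; have [[O [e1 [e2 [sp [XE|XE]]]]]|[ns XE]] := sX.
  + constructor 2; exists j => //; exists X; split=> // O' e1' e2' sp'.
    by have [_ -> _] := splits_unique VS sp sp'.
  + by constructor 3; exists j, O, e1, e2; rewrite -XE.
  + constructor 2; exists j => //; exists X; split=> // O e1 e2 sp.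
    by case: ns; exists O, e1, e2.
- constructor 1; have [F [G [H [fr co]]]] := cons t j X u x nj sX cc.
  exact: consecutive_slot fr co.
- constructor 1; rewrite -e in sX cl; case: cl => g Xu m.
  have [F [G [H [fr [j' [_ h2 _ h4]]]]]] := negative_cone_frame R nj.
  have pu : pcone F G H u x by apply/h2; apply: subcone_in_cone sX Xu.
  have o := ginf_neg VS fr pu g; have [vu _ _] := o.
  have [|s|s] := target_slot fr o.
  + constructor 1 => w ow sw; have [vw pw _] := ow.
    have Xw : X w.
      by apply: (subcone_closed VS sX Xu) => //; [apply/h2|exact: vis_edgeC|exact: vis_edgeC].
    by have := m w (out_edge_ginf VS fr ow) Xw; rewrite !h4; lra.
  + by exists F, G, H.
  + by exists F, H, G; split=> //; apply: frame_swap.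
- constructor 1; have [F [G [H [fr co]]]] := cons t j X x u nj sX cc.
  exact: consecutive_slot fr (consecutiveC VS fr co).
Qed.

(** Ten classes: two slots for each of three positive cones, three negative cones, and the one
    subcone that a split can add. *)
Definition nbr_class u (i : nat) : point R -> Prop :=
  nth (fun=> False) [:: slot (@hex R 0) (@hex R 2) (@hex R 4) u; slot (@hex R 0) (@hex R 4) (@hex R 2) u;
    slot (@hex R 2) (@hex R 0) (@hex R 4) u; slot (@hex R 2) (@hex R 4) (@hex R 0) u;
    slot (@hex R 4) (@hex R 0) (@hex R 2) u; slot (@hex R 4) (@hex R 2) (@hex R 0) u;
    main_closest 1 u; main_closest 3 u; main_closest 5 u; extra_closest u] i.

Lemma g10_max_degree : max_degree V (g10 V S) 10.
Proof.
move=> u uV; have uniqV : uniq V by case: VS.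
apply: (count_subsingletons (c := nbr_class u)) => //.
  have f024 := Frame024 R; have f042 := Frame042 R; have f204 := Frame204 R.
  have f240 := Frame240 R; have f402 := Frame402 R; have f420 := Frame420 R.
  by do 10 (case=> [_ x y|]; first (by first [exact: slot_unique|exact: main_closest_unique|exact: extra_closest_unique])).
move=> x xV /asboolP /g10_neighbor_cases [[F [G [H [fr s]]]]|[j nj m]|ex].
- by case: fr s => s; [exists 0%N|exists 1%N|exists 2%N|exists 3%N|exists 4%N|exists 5%N].
- by case: j nj m => [|[|[|[|[|[|j]]]]]] // _ m; [exists 6%N|exists 7%N|exists 8%N].
- by exists 9%N.
Qed.

End Degree.

Theorem theorem14 (R : realType) (V : seq (point R)) (S : seq (seq (point R))) :
  valid_setting V S ->
  [/\ spanner V (g10 V S) (vis_edge V S) 6,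
      plane (g10 V S) &
      max_degree V (g10 V S) 10].
Proof.
move=> VS; split; [exact: g10_spanner|exact: g10_plane|exact: g10_max_degree].
Qed.
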